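(* Let $X$ be a ball Banach function space over $\mathbb{R}^n$ with Köthe dual $X'$, and assume that the local Hardy--Littlewood maximal operator $M_{\mathrm{loc}}$ is bounded on $X$ and on $X'$. Let $K\ge1$ be an integer, $J\in\mathbb{Z}$, and let $\varphi,\psi^1,\dots,\psi^{2^n-1}\in C^K(\mathbb{R}^n)$ be a compactly supported wavelet system (in the sense of the context). Then the following are equivalent for any $f\in L^1_{\mathrm{loc}}(\mathbb{R}^n)$: (1) $Vf+Wf\in X$; (2) $f\in X$. Furthermore, in this case $\|f\|_X\sim\|Vf+Wf\|_X$, with implicit constants independent of $f$.
   Context: **Ball Banach function spaces.** $L^0(\mathbb{R}^n)$ is the space of (equivalence classes modulo null functions of) measurable functions on $\mathbb{R}^n$. A ball Banach function norm is a map $\rho$ assigning to measurable functions values in $[0,\infty]$ such that for all non-negative measurable $f,g,f_j$ ($j\in\mathbb{N}$), all constants $a\ge0$ and all open balls $B$: (P1) $\rho(f)=0\Leftrightarrow f=0$ a.e.; $\rho(af)=a\rho(f)$; $\rho(f+g)\le\rho(f)+\rho(g)$; (P2) $\rho(g)\le\rho(f)$ if $0\le g\le f$ a.e.; (P3) $\rho(f_j)\uparrow\rho(f)$ whenever $0\le f_j\uparrow f$ a.e.; (P4) $\rho(\chi_B)<\infty$; (P5) $\|\chi_Bf\|_{L^1}\le C_{B,\rho}\,\rho(f)$ with $C_{B,\rho}$ independent of $f$. The ball Banach function space generated by $\rho$ is $X=\{f\in L^0(\mathbb{R}^n):\|f\|_X:=\rho(|f|)<\infty\}$. Its Köthe dual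 $X'$ is the space generated in the same way by $\rho'(g):=\sup\{\|fg\|_{L^1}:f\in X,\ \rho(|f|)\le1\}$ for non-negative measurable $g$. **Local maximal operator.** $M_{\mathrm{loc}}f(x):=\sup_{0<r<1}\frac1{r^n}\int_{|y-x|<r}|f(y)|\,dy$. **Wavelet system.** A compactly supported $C^K$ wavelet system consists of real-valued, compactly supported $C^K$ functions $\varphi,\psi^l$ ($l=1,\dots,2^n-1$) on $\mathbb{R}^n$ such that, with $F_{j,k}:=2^{jn/2}F(2^j\cdot-k)$ for $j\in\mathbb{Z}$, $k\in\mathbb{Z}^n$: (i) for every $J\in\mathbb{Z}$, the system $\{\varphi_{J,k},\psi^l_{j,k}:k\in\mathbb{Z}^n,\ j\ge J,\ l=1,\dots,2^n-1\}$ is an orthonormal basis of $L^2(\mathbb{R}^n)$; (ii) $\int_{\mathbb{R}^n}\psi^l(x)\,dx=0$ for every $l$; (iii) $\mathrm{supp}(\varphi)=\mathrm{supp}(\psi^l)=[0,2N-1]^n$ for every $l$, for some $N\in\mathbb{N}$. **Square functions.** Let $\langle f,g\rangle:=\int_{\mathbb{R}^n}f(x)\overline{g(x)}\,dx$, $Q_{j,k}:=\prod_{m=1}^n[2^{-j}k_m,2^{-j}(k_m+1)]$ and $\chi_{j,k}:=2^{jn/2}\chi_{Q_{j,k}}$. For the fixed integer $J$ and $f\in L^1_{\mathrm{loc}}(\mathbb{R}^n)$, $$Vf:=\Bigl(\sum_{k\in\mathbb{Z}^n}|\langle f,\varphi_{J,k}\rangle\chi_{J,k}|^2\Bigr)^{1/2},\qquad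 Wf:=\Bigl(\sum_{l=1}^{2^n-1}\sum_{j=J}^\infty\sum_{k\in\mathbb{Z}^n}|\langle f,\psi^l_{j,k}\rangle\chi_{j,k}|^2\Bigr)^{1/2}.$$ $A\sim B$ means $C^{-1}B\le A\le CB$ for a constant $C>0$. *)

(* Defs.v *)
From HB Require Import structures.
From mathcomp Require Export all_boot all_order all_algebra complex.
From mathcomp Require Export all_classical all_reals all_analysis
  measurable_realfun.

Set Implicit Arguments.
Unset Strict Implicit.
Unset Printing Implicit Defensive.

Import Order.TTheory GRing.Theory Num.Theory.
Import numFieldNormedType.Exports.

Local Open Scope classical_set_scope.
Local Open Scope ring_scope.

(* Borel sigma-algebra of R^n, as the product of n copies of that of R. *)
Section measurable_rV.
Context {R : realType}.
Variable n : nat.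

Let coord : 'I_n -> 'rV[R]_n -> R := fun i x => x ord0 i.

Let rV_set0 : g_sigma_preimage coord set0.
Proof. exact: sigma_algebra0. Qed.

Let rV_setC A : g_sigma_preimage coord A -> g_sigma_preimage coord (~` A).
Proof. exact: sigma_algebraC. Qed.

Let rV_bigcup (F : _^nat) : (forall i, g_sigma_preimage coord (F i)) ->
  g_sigma_preimage coord (\bigcup_i (F i)).
Proof. exact: sigma_algebra_bigcup. Qed.

HB.instance Definition _ := @isMeasurable.Build
  (measure_tuple_display default_measure_display)
  'rV[R]_n (g_sigma_preimage coord) rV_set0 rV_setC rV_bigcup.

End measurable_rV.

Lemma measurable_fun_rVP {R : realType} d (T : measurableType d) n
    (f : T -> 'rV[R]_n) :
  (forall i, measurable_fun [set: T] (fun x => f x ord0 i)) ->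
  measurable_fun [set: T] f.
Proof.
move=> mf; pose c i (v : 'rV[R]_n) : R := v ord0 i.
suff sub : g_sigma_preimage (fun i => c i \o f) `<=` measurable.
  move=> _ A mA; rewrite setTI; apply: sub.
  by rewrite g_sigma_preimage_comp; exists A => //; rewrite setTI.
apply: smallest_sub; first exact: sigma_algebra_measurable.
case: n => [|n] in f mf c *; first by rewrite big_ord0.
rewrite -bigcup_mkord_ord; apply: bigcup_sub => i Ii.
by move=> A [B mB <-]; exact: mf.
Qed.

Lemma measurable_coord {R : realType} n (i : 'I_n) :
  measurable_fun [set: 'rV[R]_n] (fun x => x ord0 i).
Proof.
move=> _ Y mY; rewrite setTI; apply: sub_sigma_algebra => /=.
rewrite -bigcup_seq/=; exists i => /=; first by rewrite mem_index_enum.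
by exists Y => //; rewrite setTI.
Qed.

(* Lebesgue measure on R^n, by the identification of R^(n+1) with R x R^n. *)
Section lebesgue_measure_rV.
Context {R : realType}.

Definition rV_cons n (p : measurableTypeR R * 'rV[R]_n) : 'rV[R]_n.+1 :=
  row_mx (p.1%:M : 'rV[R]_1) p.2.

Lemma rV_cons0 n p : @rV_cons n p ord0 ord0 = p.1.
Proof.
by rewrite mxE; case: splitP => // j _; rewrite mxE (ord1 j).
Qed.

Lemma rV_consS n p i : @rV_cons n p ord0 (lift ord0 i) = p.2 ord0 i.
Proof.
rewrite mxE; case: splitP => j; first by rewrite (ord1 j).
by rewrite /= /bump leq0n => -[ij]; congr (p.2 _ _); exact: val_inj.
Qed.

Lemma measurable_rV_cons n : measurable_fun setT (@rV_cons n).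
Proof.
apply: measurable_fun_rVP => i; case: (unliftP ord0 i) => [j|] ->.
  rewrite (_ : (fun _ => _) = (fun v : 'rV[R]_n => v ord0 j) \o snd).
    by apply: measurableT_comp => //; exact: measurable_coord.
  by apply/funext => p /=; rewrite rV_consS.
rewrite (_ : (fun _ => _) = fst) //.
by apply/funext => p; rewrite rV_cons0.
Qed.

Definition rV_uncons n (v : 'rV[R]_n.+1) : measurableTypeR R * 'rV[R]_n :=
  (v ord0 ord0, \row_i v ord0 (lift ord0 i)).

Lemma rV_consK n : cancel (@rV_cons n) (@rV_uncons n).
Proof.
case=> a v; rewrite /rV_uncons rV_cons0; congr pair.
by apply/rowP => i; rewrite mxE rV_consS.
Qed.

Lemma measurable_rV_uncons n : measurable_fun setT (@rV_uncons n).
Proof.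
apply: measurable_fun_pair; first exact: measurable_coord.
apply: (@measurable_fun_rVP R _ _ n) => i.
rewrite (_ : (fun _ => _) = fun x : 'rV[R]_n.+1 => x ord0 (lift ord0 i)).
  exact: measurable_coord.
by apply/funext => x; rewrite mxE.
Qed.

Fixpoint lebesgue_rV (n : nat) : set 'rV[R]_n -> \bar R :=
  if n is m.+1 return set 'rV[R]_n -> \bar R
  then pushforward (lebesgue_measure \x @lebesgue_rV m)%E (@rV_cons m)
  else \d_(0 : 'rV[R]_0).

Section step.
Variables (n : nat) (m : {sigma_finite_measure set 'rV[R]_n -> \bar R}).

Let step := pushforward (lebesgue_measure \x m)%E (@rV_cons n).

Let step0 : step set0 = 0%E.
Proof. by rewrite /step /pushforward preimage_set0 measure0. Qed.

Let step_ge0 A : (0 <= step A)%E.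
Proof. exact: (measure_ge0 (lebesgue_measure \x m)%E). Qed.

Let step_sigma_additive : semi_sigma_additive step.
Proof.
move=> F mF tF mUF; rewrite /step /pushforward preimage_bigcup.
have mcons A : measurable A -> measurable (@rV_cons n @^-1` A).
  by move=> mA; rewrite -[X in measurable X]setTI; exact: measurable_rV_cons.
apply: measure_semi_sigma_additive.
- by move=> i; exact: mcons.
- apply/trivIsetP => /= i j _ _ ij; rewrite -preimage_setI.
  by move/trivIsetP : tF => /(_ _ _ _ _ ij) ->//; rewrite preimage_set0.
- by rewrite -preimage_bigcup; exact: mcons.
Qed.

HB.instance Definition _ := isMeasure.Build _ _ _ step
  step0 step_ge0 step_sigma_additive.

Let step_sigma_finite : sigma_finite setT step.
Proof.
have /sigma_finiteP[F [FT ndF Foo]] := sigma_finiteT (@lebesgue_measure R).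
have /sigma_finiteP[G [GT ndG Goo]] := sigma_finiteT m.
exists (fun i => @rV_uncons n @^-1` (F i `*` G i)).
  rewrite -preimage_bigcup (_ : \bigcup_i _ = setT) ?preimage_setT//.
  apply/seteqP; split => // -[x y] _.
  have [i _ Fx] : (\bigcup_i F i) x by rewrite -FT.
  have [j _ Gy] : (\bigcup_i G i) y by rewrite -GT.
  exists (maxn i j) => //; split => /=.
    by move: x Fx; exact/subsetPset/ndF/leq_maxl.
  by move: y Gy; exact/subsetPset/ndG/leq_maxr.
move=> i; have [mF Fi] := Foo i; have [mG Gi] := Goo i; split.
  rewrite -[X in measurable X]setTI.
  by apply: measurable_rV_uncons => //; exact: measurableX.
rewrite /step /pushforward -comp_preimage (_ : _ \o _ = id) ?preimage_id//.
  by rewrite product_measure1E// lte_mul_pinfty// ge0_fin_numE.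
by apply/funext => x /=; rewrite rV_consK.
Qed.

HB.instance Definition _ := Measure_isSigmaFinite.Build _ _ _ step
  step_sigma_finite.

Lemma lebesgue_rV_step : exists m' : {sigma_finite_measure set 'rV[R]_n.+1 -> \bar R},
  pushforward (lebesgue_measure \x m)%E (@rV_cons n) = m' :> (set _ -> \bar R).
Proof. by exists step. Qed.

End step.

Lemma lebesgue_rVP n : exists m : {sigma_finite_measure set 'rV[R]_n -> \bar R},
  @lebesgue_rV n = m :> (set _ -> \bar R).
Proof.
elim: n => [|n [m /= ->]]; last exact: lebesgue_rV_step.
by exists (dirac (0 : 'rV[R]_0)).
Qed.

Variable n : nat.

Let leb0 : @lebesgue_rV n set0 = 0%E.
Proof. by have [m ->] := lebesgue_rVP n. Qed.

Let leb_ge0 A : (0 <= @lebesgue_rV n A)%E.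
Proof. by have [m ->] := lebesgue_rVP n; exact: measure_ge0. Qed.

Let leb_sigma_additive : semi_sigma_additive (@lebesgue_rV n).
Proof. by have [m ->] := lebesgue_rVP n; exact: measure_semi_sigma_additive. Qed.

HB.instance Definition _ := isMeasure.Build _ _ _ (@lebesgue_rV n)
  leb0 leb_ge0 leb_sigma_additive.

Let leb_sigma_finite : sigma_finite setT (@lebesgue_rV n).
Proof. by have [m ->] := lebesgue_rVP n; exact: sigma_finiteT. Qed.

HB.instance Definition _ := Measure_isSigmaFinite.Build _ _ _ (@lebesgue_rV n)
  leb_sigma_finite.

End lebesgue_measure_rV.

Lemma lebesgue_rV_box {R : realType} n (B : 'I_n -> set (measurableTypeR R)) :
  (forall i, measurable (B i)) ->
  lebesgue_rV [set x : 'rV[R]_n | forall i, B i (x ord0 i)] =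
  (\prod_(i < n) lebesgue_measure (B i))%E.
Proof.
elim: n B => [|n IHn] B mB.
  by rewrite big_ord0 /= diracE mem_set// => -[].
rewrite big_ord_recl -IHn// -product_measure1E//=; last first.
  pose c i : set 'rV[R]_n := [set x | B (lift ord0 i) (x ord0 i)].
  rewrite (_ : [set _ | _] = \big[setI/setT]_(i < n) c i); last first.
    by apply/seteqP; split => x /=; rewrite -bigcap_seq => xB i //=;
      [move=> _; exact: xB|apply: (xB i); rewrite /= mem_index_enum].
  apply: bigsetI_measurable => i _; rewrite /c -[X in measurable X]setTI.
  exact: (@measurable_coord R n i measurableT (B (lift ord0 i)) (mB _)).
congr (product_measure1 _ _ _); apply/seteqP; split => -[a v] /=.
  move=> H; split; first by have := H ord0; rewrite rV_cons0.
  by move=> i; have := H (lift ord0 i); rewrite rV_consS.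
move=> [Ba Bv] i; case: (unliftP ord0 i) => [j|] ->.
  by rewrite rV_consS; exact: Bv.
by rewrite rV_cons0.
Qed.

Section function_spaces.
Context {R : realType}.
Variable n : nat.

Local Notation E := 'rV[R]_n.
Local Notation mu := (@lebesgue_rV R n).

(* The norm of the normed module 'rV[R]_n is the maximum norm. *)
Definition enorm (x : E) : R := Num.sqrt (\sum_(i < n) x ord0 i ^+ 2).

Definition eball (x : E) (r : R) : set E := [set y | enorm (y - x) < r].

(* Complex functions; cmod is the modulus as a real number (whereas `|z| is an
   element of R[i]). *)
Definition cmod (z : R[i]) : R := Normc.normc z.

Definition cmodf (f : E -> R[i]) : E -> \bar R := fun x => (cmod (f x))%:E.

Definition cmeasurable (f : E -> R[i]) :=
  measurable_fun setT (fun x => complex.Re (f x)) /\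
  measurable_fun setT (fun x => complex.Im (f x)).

Definition cintegral (f : E -> R[i]) : R[i] :=
  Complex (\int[mu]_x complex.Re (f x)) (\int[mu]_x complex.Im (f x)).

Definition inner (f g : E -> R[i]) : R[i] :=
  cintegral (fun x => f x * conjc (g x)).

Definition real_fun (F : E -> R) : E -> R[i] := fun x => Complex (F x) 0.

Definition L1loc (f : E -> R[i]) := cmeasurable f /\
  forall K : set E, compact K -> (\int[mu]_(x in K) cmodf f x < +oo)%E.

Definition L2 (f : E -> R[i]) :=
  cmeasurable f /\ ('N[mu]_2%:E [cmodf f] < +oo)%E.

Definition orthonormal_basis_L2 (I : eqType) (e : I -> E -> R[i]) :=
  [/\ forall a, L2 (e a),
      forall a b, inner (e a) (e b) = (a == b)%:R &
      forall f, L2 f -> forall eps : R, 0 < eps ->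
        exists (s : seq I) (c : I -> R[i]),
          ('N[mu]_2%:E [cmodf (fun x => f x - \sum_(a <- s) c a * e a x)%R]
             < eps%:E)%E].

Definition nonneg_measurable (f : E -> \bar R) :=
  measurable_fun setT f /\ forall x, (0 <= f x)%E.

(* A function norm is only meaningful at non-negative measurable functions, with
   values in [0, +oo]; its values elsewhere are unspecified and never used.
   Functions equal almost everywhere are identified through P2. *)
Record ball_Banach_norm (rho : (E -> \bar R) -> \bar R) : Prop := {
  bbn_ge0 : forall f, nonneg_measurable f -> (0 <= rho f)%E ;
  bbn_eq0 : forall f, nonneg_measurable f ->
    rho f = 0%E <-> {ae mu, forall x, f x = 0%E} ;
  bbn_scale : forall f (a : R), nonneg_measurable f -> 0 <= a ->
    rho (fun x => a%:E * f x)%E = (a%:E * rho f)%E ;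
  bbn_triangle : forall f g, nonneg_measurable f -> nonneg_measurable g ->
    (rho (fun x => f x + g x) <= rho f + rho g)%E ;
  bbn_mono : forall f g, nonneg_measurable f -> nonneg_measurable g ->
    {ae mu, forall x, (g x <= f x)%E} -> (rho g <= rho f)%E ;
  bbn_Fatou : forall (f_ : nat -> E -> \bar R) f,
    (forall j, nonneg_measurable (f_ j)) -> nonneg_measurable f ->
    {ae mu, forall x, nondecreasing_seq (f_ ^~ x) /\
                      f_ j x @[j --> \oo] --> f x} ->
    nondecreasing_seq (rho \o f_) /\ rho (f_ j) @[j --> \oo] --> rho f ;
  bbn_ball : forall x r, 0 < r ->
    (rho (fun y => (\1_(eball x r) y)%:E) < +oo)%E ;
  bbn_L1 : forall x r, 0 < r -> exists C : R,
    forall f, nonneg_measurable f ->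
      (\int[mu]_y ((\1_(eball x r) y)%:E * f y) <= C%:E * rho f)%E
}.

Definition Xnorm (rho : (E -> \bar R) -> \bar R) (f : E -> R[i]) : \bar R :=
  rho (cmodf f).

(* Membership in the space generated by rho, for complex functions and for
   functions with values in [0, +oo] respectively. *)
Definition inX (rho : (E -> \bar R) -> \bar R) (f : E -> R[i]) :=
  cmeasurable f /\ (Xnorm rho f < +oo)%E.

Definition inX_nonneg (rho : (E -> \bar R) -> \bar R) (g : E -> \bar R) :=
  nonneg_measurable g /\ (rho g < +oo)%E.

Definition Koethe_dual (rho : (E -> \bar R) -> \bar R) (g : E -> \bar R)
    : \bar R :=
  ereal_sup [set (\int[mu]_x (cmodf f x * g x))%E | f in
    [set f | inX rho f /\ (Xnorm rho f <= 1)%E]].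

Definition Mloc (f : E -> R[i]) (x : E) : \bar R :=
  ereal_sup [set ((r ^+ n)^-1%:E * \int[mu]_(y in eball x r) cmodf f y)%E |
    r in [set r : R | 0 < r < 1]].

Definition Mloc_bounded (rho : (E -> \bar R) -> \bar R) :=
  exists C : R, forall f, inX rho f ->
    (rho (Mloc f) <= C%:E * Xnorm rho f)%E.

End function_spaces.

Section wavelets.
Context {R : realType}.
Variable n : nat.

Local Notation E := 'rV[R]_n.
Local Notation mu := (@lebesgue_rV R n).

Fixpoint class_C (K : nat) (f : E -> R) : Prop :=
  continuous f /\
  if K is K'.+1 then
    forall i : 'I_n, (forall x, derivable f x (delta_mx ord0 i)) /\
      class_C K' (fun x => 'D_(delta_mx ord0 i) f x)
  else True.

Definition supp (f : E -> R) : set E := closure [set x | f x != 0].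

Definition cube (s : R) : set E := [set x | forall i, 0 <= x ord0 i <= s].

Definition L2_factor (j : int) : R := 2 `^ (j%:~R * n%:R / 2).

Definition dilate (F : E -> R) (j : int) (k : 'rV[int]_n) : E -> R :=
  fun x => L2_factor j * F ((2 : R) ^ j *: x - \row_i (k ord0 i)%:~R).

Definition dyadic_cube (j : int) (k : 'rV[int]_n) : set E :=
  [set x | forall i, (2 : R) ^ (- j) * (k ord0 i)%:~R <= x ord0 i
                     <= (2 : R) ^ (- j) * ((k ord0 i)%:~R + 1)].

Definition chi (j : int) (k : 'rV[int]_n) (x : E) : R :=
  L2_factor j * \1_(dyadic_cube j k) x.

(* inl k stands for phi_{J,k}, and inr (l, i, k) for psi^l_{J+i,k}. *)
Definition wavelet_index : eqType :=
  ('rV[int]_n + 'I_(2 ^ n - 1) * nat * 'rV[int]_n)%type.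

Definition wavelet_family (phi : E -> R) (psi : 'I_(2 ^ n - 1) -> E -> R)
    (J : int) (a : wavelet_index) : E -> R[i] :=
  match a with
  | inl k => real_fun (dilate phi J k)
  | inr (l, i, k) => real_fun (dilate (psi l) (J + i%:Z) k)
  end.

Record wavelet_system (K : nat) (phi : E -> R)
    (psi : 'I_(2 ^ n - 1) -> E -> R) : Prop := {
  ws_phi_C : class_C K phi ;
  ws_psi_C : forall l, class_C K (psi l) ;
  ws_basis : forall J : int,
    orthonormal_basis_L2 (wavelet_family phi psi J) ;
  ws_mean : forall l, \int[mu]_x psi l x = 0 ;
  ws_supp : exists N : nat,
    supp phi = cube (2 * N%:R - 1) /\
    forall l, supp (psi l) = cube (2 * N%:R - 1)
}.

Definition Vsq (J : int) (phi : E -> R) (f : E -> R[i]) (x : E) : \bar R :=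
  sqrte (\esum_(k in [set: 'rV[int]_n])
    ((cmod (inner f (real_fun (dilate phi J k))) * chi J k x) ^+ 2)%:E)%E.

Definition Wsq (J : int) (psi : 'I_(2 ^ n - 1) -> E -> R) (f : E -> R[i])
    (x : E) : \bar R :=
  sqrte (\sum_(l < 2 ^ n - 1) \sum_(0 <= i <oo)
    \esum_(k in [set: 'rV[int]_n])
      ((cmod (inner f (real_fun (dilate (psi l) (J + i%:Z) k)))
        * chi (J + i%:Z) k x) ^+ 2)%:E)%E.

End wavelets.

(* Main.v *)
Require Import Defs.
From mathcomp Require Import ring lra zify.
Import Order.TTheory GRing.Theory Num.Theory.
Import numFieldNormedType.Exports.
Set Implicit Arguments.
Unset Strict Implicit.
Unset Printing Implicit Defensive.
Local Open Scope classical_set_scope.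
Local Open Scope ring_scope.

(** Both implications rest on one bilinear estimate. Let psi be a Lipschitz function
    of bounded support whose dilates satisfy Bessel's inequality, and let S u be the
    square function whose square sums, over the levels j >= J, the squares of the
    normalised coefficients of u at the cell of level j containing the point. Then
      int (S u) g  <=  C int (A u) g + C int (M u) (M g)      (g >= 0)
    where M is the local maximal operator and A is an average over boundedly many
    neighbouring cells of one scale, which accounts for the finitely many levels too
    coarse for M ([lip_gen_bilinear]).

    The estimate is proved for finitely many levels, on the cells of the finest one, with
    constants that do not depend on their number. As psi is Lipschitz, replacing a dilate
    by a reference value on each cell of a smaller generation costs an error proportional
    to the ratio of the two scales. Suppose that the averages of u around a cell are at
    most lambda, and decompose u on the maximal cells where its average exceeds lambda, as
    Calderon and Zygmund do: the conditional average is bounded and is handled by Bessel's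
    inequality; the remainder has mean zero on each of those cells, and only the Lipschitz
    error survives. So the part of S u coming from the generations above the stopping
    cells has average at most C lambda ([local_estimate]). Stopping also where the averages of g are large, one bounds the
    contribution of these generations to int (S u) g by the product of the averages of u
    and g over the cell. The stopping cells fill at most half of the cell, and on the
    other half that product is dominated by (M u) (M g); inside the stopping cells one
    argues by induction ([discrete_bilinear]).

    As M is bounded on X and on X', the Hoelder inequality bounds int (S u) g by the
    product of the norms of u in X and of g in X', and also int (S g) u by exchanging the
    roles. By the Lorentz-Luxemburg theorem X'' = X ([lorentz_luxemburg]), the first bound
    says that S is bounded on X; by definition of the dual norm the second says that it
    is bounded on X' for test functions g. The closed cubes of the statement meet the
    half-open cell of a point only if they are its neighbours, so V f + W f is at most a
    finite sum of coefficients and of square functions S of integer translates of phi and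
    of the psi^l, and the map is bounded on X ([rho_VW]).

    For the converse, <u, g> is the sum of <u, e> <g, e> over the wavelet basis, for u
    locally integrable and g bounded of bounded support ([wavelet_expansion]): the part of
    the expansion of g below level J + p is the scaling projection of g at level J + p, so
    these partial sums are uniformly bounded with a common bounded support, besides
    converging in L^2. Spreading each product <u, e> <g, e> over the cell of e and applying
    the Cauchy-Schwarz inequality at every point gives
      |<u, g>|  <=  int (T u) (T g),      T u <= V u + W u
    ([pairing]). By the Hoelder inequality, boundedness of T on X' and the
    Lorentz-Luxemburg theorem, the norm of u is bounded by that of V u + W u
    ([rho_le_VW]). Complex functions are treated through their real and imaginary parts. *)

(** * Dyadic cells of the integer lattice *)

Lemma row_ext (T : Type) n (u v : 'rV[T]_n) :
  (forall i, u ord0 i = v ord0 i) -> u = v.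
Proof. by move=> uv; apply/rowP => i; rewrite -[0]/ord0 uv. Qed.

Section lattice.
Variable n : nat.
Local Notation Zn := 'rV[int]_n.
Implicit Types (a k q : Zn).

(** The index of the dyadic cell, e generations coarser, that contains the cell k. *)
Definition anc (e : nat) (k : Zn) : Zn := \row_i (k ord0 i %/ 2 ^+ e)%Z.

Definition ibox (N : nat) (a : Zn) : seq Zn :=
  [seq a + \row_i (f i : nat)%:Z | f : {ffun 'I_n -> 'I_N}].

Lemma mem_ibox N a k :
  (k \in ibox N a) = [forall i, a ord0 i <= k ord0 i < a ord0 i + N%:Z].
Proof.
apply/mapP/forallP => [[f _ ->] i|H].
  by rewrite !mxE lerDl lez_nat /= ltrD2l ltz_nat.
have h i : (`|k ord0 i - a ord0 i| < N)%N by have := H i; lia.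
exists [ffun i => Ordinal (h i)]; first by rewrite mem_enum.
apply: row_ext => i; rewrite !mxE ffunE /=; have := H i; lia.
Qed.

Lemma uniq_ibox N a : uniq (ibox N a).
Proof.
rewrite map_inj_uniq ?enum_uniq// => f g /rowP H.
by apply/ffunP => i; apply/val_inj; have := H i; rewrite !mxE /=; lia.
Qed.

Lemma size_ibox N a : size (ibox N a) = (N ^ n)%N.
Proof. by rewrite size_map -cardE card_ffun !card_ord. Qed.

Lemma anc0 k : anc 0 k = k.
Proof. by apply: row_ext => i; rewrite mxE expr0 divz1. Qed.

Lemma ancD e d k : anc e (anc d k) = anc (e + d) k.
Proof.
apply: row_ext => i; rewrite !mxE exprD mulrC -divzMA_ge0 //; exact: exprn_ge0.
Qed.

Lemma anc_eqW e d k k' : (e <= d)%N -> anc e k = anc e k' -> anc d k = anc d k'.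
Proof. by move=> ed H; rewrite -(subnK ed) -!ancD H. Qed.

(** The 2 ^ (e n) descendants, e generations finer, of the cell q. *)
Definition cells e (q : Zn) : seq Zn := ibox (2 ^ e) (\row_i (2 ^+ e * q ord0 i)).

(** The descendants, e generations finer, of the cells at distance at most s from q. Lists
    rather than sets, since sums over them are then sums over sequences. *)
Definition nbh s e (q : Zn) : seq Zn :=
  ibox ((2 * s + 1) * 2 ^ e) (\row_i (2 ^+ e * (q ord0 i - s%:Z))).

Let pow2Z e : (2 ^ e)%N%:Z = 2 ^+ e :> int.
Proof. by rewrite -[LHS]natz natrX. Qed.

Let two_gt0 e : (0 : int) < 2 ^+ e. Proof. exact: exprn_gt0. Qed.

Lemma mem_cells e q k : (k \in cells e q) = (anc e k == q).
Proof.
rewrite mem_ibox; apply/forallP/eqP => [H|<- i].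
  apply: row_ext => i; have := H i; rewrite !mxE => /andP[h1 h2].
  apply/eqP; rewrite eq_le; apply/andP; split.
    by rewrite -ltzD1 ltz_divLR// mulrDl mul1r mulrC -[X in _ + X]pow2Z.
  by rewrite lez_divRL// mulrC.
rewrite !mxE pow2Z mulrC -lez_divRL// lexx/=.
rewrite -[X in _ < _ + X]mul1r -mulrDl -ltz_divLR// ltzD1//.
Qed.

Lemma mem_nbh s e q k :
  (k \in nbh s e q) = [forall i, `|anc e k ord0 i - q ord0 i| <= s%:Z].
Proof.
rewrite mem_ibox; apply: eq_forallb => i; rewrite !mxE PoszM pow2Z.
rewrite [2 ^+ e * _]mulrC -mulrDl -lez_divRL// -ltz_divLR//.
by set x := (_ %/ _)%Z; rewrite PoszD PoszM; lia.
Qed.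

Lemma uniq_cells e q : uniq (cells e q). Proof. exact: uniq_ibox. Qed.
Lemma uniq_nbh s e q : uniq (nbh s e q). Proof. exact: uniq_ibox. Qed.

Lemma size_cells e q : size (cells e q) = ((2 ^ n) ^ e)%N.
Proof. by rewrite size_ibox -!expnM mulnC. Qed.

Lemma size_nbh s e q : size (nbh s e q) = ((2 * s + 1) ^ n * (2 ^ n) ^ e)%N.
Proof. by rewrite size_ibox expnMn -!expnM [(e * n)%N]mulnC. Qed.

Lemma mem_nbhC s e k k' :
  (k \in nbh s e (anc e k')) = (k' \in nbh s e (anc e k)).
Proof. by rewrite !mem_nbh; apply: eq_forallb => i; rewrite distrC. Qed.

Lemma nbhW s e d k k' : (e <= d)%N ->
  k \in nbh s e (anc e k') -> k \in nbh s d (anc d k').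
Proof.
move=> ed; rewrite !mem_nbh => /forallP H; apply/forallP => i.
have {}H := H i; rewrite -(subnK ed) -!ancD.
move: (anc e k) (anc e k') H => {}k {}k'; rewrite !mxE.
move: (d - e)%N => {ed}e; move: (k _ _) (k' _ _) => a b H.
have N0 := two_gt0 e; move: N0; set N := 2 ^+ e => N0.
have aux (x y : int) : x <= y + s%:Z -> (x %/ N)%Z <= (y %/ N)%Z + s%:Z.
  move=> xy; rewrite -ltzD1 ltz_divLR//.
  have := ltz_ceil y N0; set z := (y %/ N)%Z => yz.
  have sN : s%:Z <= s%:Z * N by nia.
  have -> : (z + s%:Z + 1) * N = (z + 1) * N + s%:Z * N by ring.
  lia.
have h1 := aux a b; have h2 := aux b a.
by rewrite ler_distl; apply/andP; split; lia.
Qed.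

Lemma cells_sub_nbh s e q q' : (forall i, `|q' ord0 i - q ord0 i| <= s%:Z) ->
  {subset cells e q' <= nbh s e q}.
Proof.
by move=> H k; rewrite mem_cells mem_nbh => /eqP ->; apply/forallP.
Qed.

Lemma cells_nbh s e k q : k \in nbh s e q -> {subset cells e (anc e k) <= nbh s e q}.
Proof.
rewrite mem_nbh => /forallP H; exact: cells_sub_nbh.
Qed.

Lemma cellsW e d k : (e <= d)%N -> {subset cells e (anc e k) <= cells d (anc d k)}.
Proof.
by move=> ed k'; rewrite !mem_cells => /eqP /(anc_eqW ed) ->.
Qed.

End lattice.

Section seqsum.
Variables (R : realFieldType) (T : eqType).
Implicit Types (s : seq T) (F : T -> R).

Lemma sum_subseq_filter s1 s2 F : uniq s1 -> uniq s2 -> {subset s1 <= s2} ->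
  \sum_(x <- s1) F x = \sum_(x <- s2 | x \in s1) F x.
Proof.
move=> u1 u2 s12; rewrite -[RHS]big_filter; apply: perm_big.
apply: uniq_perm => //; first exact: filter_uniq.
move=> x; rewrite mem_filter; case: (boolP (x \in s1)) => //= /s12 ->//.
Qed.

Lemma ler_sum_subset s1 s2 F : uniq s1 -> uniq s2 -> {subset s1 <= s2} ->
  (forall x, 0 <= F x) -> \sum_(x <- s1) F x <= \sum_(x <- s2) F x.
Proof.
move=> u1 u2 s12 F0; rewrite (sum_subseq_filter F u1 u2 s12) big_mkcond.
by apply: ler_sum => x _; case: ifP.
Qed.

Lemma sum_mem_le s1 s2 : uniq s1 -> uniq s2 ->
  \sum_(x <- s1) (x \in s2)%:R <= (size s2)%:R :> R.
Proof.
move=> u1 u2; apply: (@le_trans _ _ (\sum_(x <- [seq x <- s1 | x \in s2]) 1)).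
  by rewrite big_filter [leRHS]big_mkcond; apply: ler_sum => x _; case: ifP.
rewrite big_const_seq count_predT iter_addr_0 ler_nat.
apply: uniq_leq_size; first exact: filter_uniq.
by move=> x; rewrite mem_filter => /andP[].
Qed.

Lemma sum1_size s (c : R) : \sum_(x <- s) c = c * (size s)%:R.
Proof. by rewrite big_const_seq count_predT iter_addr_0 mulr_natr. Qed.

End seqsum.

(** * Stopping times and conditional averages *)

Section stopping.
Variable n : nat.
Local Notation Zn := 'rV[int]_n.
Implicit Types (k q : Zn).

(** The generation tau k of the stopping cell containing k is constant on that cell. *)
Definition stopping (tau : Zn -> nat) :=
  forall k k', anc (tau k) k' = anc (tau k) k -> tau k' = tau k.

Variables (d : nat) (P : nat -> Zn -> bool).
Hypothesis Panc : forall e k k', anc e k = anc e k' -> P e k = P e k'.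

(** The cell of generation stime k is the largest one containing k, below generation d,
    at which P holds. When there is none the value is 0, so that k forms a cell by itself
    and averaging over it changes nothing. *)
Definition stime k : nat := \max_(e < d | P e k) e.

Lemma stime_lt k : (0 < d)%N -> (stime k < d)%N.
Proof.
move=> d0; apply: (@leq_ltn_trans d.-1); last by rewrite prednK.
by apply/bigmax_leqP => i _; have := ltn_ord i; lia.
Qed.

Lemma stime_le k : (stime k <= d)%N.
Proof. by apply/bigmax_leqP => i _; exact: ltnW. Qed.

Lemma stime_ge k e : (e < d)%N -> P e k -> (e <= stime k)%N.
Proof.
by move=> ed Pe; exact: (@leq_bigmax_cond _ _ (fun e : 'I_d => e : nat) (Ordinal ed)).
Qed.

Lemma stimeP k e : (e < d)%N -> P e k -> P (stime k) k.
Proof.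
move=> ed Pe.
have [|i Pi H] := @eq_bigmax_cond _ [pred e : 'I_d | P e k] (fun e => e : nat).
  by apply/card_gt0P; exists (Ordinal ed).
by rewrite /stime H.
Qed.

Lemma stime_gt k e : (stime k < e < d)%N -> ~~ P e k.
Proof.
case/andP => h1 h2; apply/negP => /(stime_ge h2); lia.
Qed.

Lemma stime0 k : (stime k = 0)%N \/ P (stime k) k.
Proof.
have [->|] := eqVneq (stime k) 0%N; [by left|move=> h; right].
have [e Pe|H] := pickP [pred e : 'I_d | P e k]; first exact: stimeP Pe.
by move: h; rewrite /stime big_pred0 ?eqxx.
Qed.

Lemma stime_stopping : stopping stime.
Proof.
move=> k k' H.
have PE e : (stime k <= e)%N -> P e k' = P e k by move=> /anc_eqW /(_ H) /Panc.
apply/eqP; rewrite eqn_leq; apply/andP; split.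
  apply/bigmax_leqP => i Pi; rewrite leqNgt; apply/negP => li.
  by have := @stime_ge k i (ltn_ord i); rewrite -(PE _ (ltnW li)) Pi => /(_ isT); rewrite leqNgt li.
have [->//|Pk] := stime0 k.
have [d0|d0] := posnP d.
  by have := stime_le k; rewrite [X in (_ <= X)%N]d0 leqn0 => /eqP ->.
apply: stime_ge; first exact: stime_lt.
by rewrite PE.
Qed.

End stopping.

Section condexp.
Variables (R : rcfType) (n : nat).
Local Notation Zn := 'rV[int]_n.
Implicit Types (k q : Zn) (F h : Zn -> R) (S : seq Zn).

Definition W (e : nat) : R := (2 ^+ n) ^+ e.

Lemma W_gt0 e : 0 < W e. Proof. by rewrite /W !exprn_gt0. Qed.
Lemma W_neq0 e : W e != 0. Proof. exact: lt0r_neq0 (W_gt0 e). Qed.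
Lemma WS e : W e.+1 = 2 ^+ n * W e. Proof. exact: exprS. Qed.

Lemma size_cellsW e q : (size (cells e q))%:R = W e.
Proof. by rewrite size_cells /W !natrX. Qed.

Definition Kn s : R := ((2 * s + 1) ^ n)%:R.
Lemma Kn_ge1 s : 1 <= Kn s.
Proof. by rewrite /Kn ler1n expn_gt0 addn1. Qed.
Lemma Kn_gt0 s : 0 < Kn s. Proof. exact: lt_le_trans ltr01 (Kn_ge1 s). Qed.

Lemma size_nbhW s e q : (size (nbh s e q))%:R = Kn s * W e.
Proof. by rewrite size_nbh natrM /Kn /W !natrX. Qed.

Definition av F e q : R := (\sum_(k <- cells e q) F k) / W e.

(** Normalised by the size of one cell and not by that of the neighbourhood. *)
Definition nav s F e q : R := (\sum_(k <- nbh s e q) F k) / W e.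

(** The conditional average of F over the stopping cells. *)
Definition Ex (tau : Zn -> nat) F k : R := av F (tau k) (anc (tau k) k).

(** A conditional average integrates like the function itself against functions that are
    constant on the stopping cells. Exchanging a double sum over pairs in a common cell
    avoids choosing representatives of the cells. *)
Lemma Ex_sum tau S F h : stopping tau -> uniq S ->
  (forall k, k \in S -> {subset cells (tau k) (anc (tau k) k) <= S}) ->
  (forall k k', anc (tau k) k' = anc (tau k) k -> h k' = h k) ->
  \sum_(k <- S) Ex tau F k * h k = \sum_(k <- S) F k * h k.
Proof.
move=> st uS SS hh.
pose r k k' := anc (tau k) k' == anc (tau k) k.
have rC k k' : r k k' -> r k' k.
  by move/eqP => H; rewrite /r (st _ _ H) H.
have rCE k k' : r k k' = r k' k by apply/idP/idP => /rC.
have E k : k \in S ->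
    Ex tau F k * h k = \sum_(k' <- S) (r k k')%:R * (F k' * h k' / W (tau k')).
  move=> kS; rewrite /Ex /av (sum_subseq_filter F _ uS (SS k kS)) ?uniq_cells//.
  rewrite mulrAC !mulr_suml big_mkcond /=; apply: eq_bigr => k' _.
  rewrite mem_cells -/(r k k'); case: (boolP (r k k')) => [/eqP rk|_].
    by rewrite (hh _ _ rk) (st _ _ rk) mul1r.
  by rewrite mul0r.
rewrite big_seq (eq_bigr _ E) -big_seq exchange_big /= big_seq [RHS]big_seq.
apply: eq_bigr => k' k'S; rewrite -mulr_suml.
rewrite (_ : \sum_(i <- S) _ = W (tau k')).
  by rewrite mulrC mulfVK // W_neq0.
rewrite -(size_cellsW _ (anc (tau k') k')) -[RHS]mul1r -sum1_size.
rewrite (sum_subseq_filter _ _ uS (SS k' k'S)) ?uniq_cells// [RHS]big_mkcond.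
by apply: eq_bigr => k _; rewrite mem_cells rCE -/(r k' k); case: (r k' k).
Qed.

Lemma av_ge0 F e q : (forall k, 0 <= F k) -> 0 <= av F e q.
Proof. by move=> F0; rewrite divr_ge0 ?sumr_ge0 // ltW // W_gt0. Qed.

Lemma nav_ge0 s F e q : (forall k, 0 <= F k) -> 0 <= nav s F e q.
Proof. by move=> F0; rewrite divr_ge0 ?sumr_ge0 // ltW // W_gt0. Qed.

Lemma le_av F e k : (forall k, 0 <= F k) ->
  av F e (anc e k) <= 2 ^+ n * av F e.+1 (anc e.+1 k).
Proof.
move=> F0; rewrite /av WS; set y := \sum_(k <- cells e.+1 _) _.
have -> : 2 ^+ n * (y / (2 ^+ n * W e)) = y / W e.
  field; rewrite W_neq0 /=; exact/lt0r_neq0/exprn_gt0.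
rewrite ler_pM2r ?invr_gt0 ?W_gt0//; apply: ler_sum_subset => //; last first.
- exact: cellsW.
- exact: uniq_cells.
- exact: uniq_cells.
Qed.

Lemma le_av_nav s F e q k : (forall k, 0 <= F k) -> k \in nbh s e q ->
  av F e (anc e k) <= nav s F e q.
Proof.
move=> F0 kn; rewrite /av /nav ler_pM2r ?invr_gt0 ?W_gt0//; apply: ler_sum_subset => //.
- exact: uniq_cells.
- exact: uniq_nbh.
- exact: cells_nbh.
Qed.

Lemma Ex_abs tau F G k : (forall k, `|F k| <= G k) -> `|Ex tau F k| <= Ex tau G k.
Proof.
move=> FG; rewrite /Ex /av normrM [`|_^-1|]ger0_norm ?invr_ge0 ?(ltW (W_gt0 _))//.
rewrite ler_pM2r ?invr_gt0 ?W_gt0//; apply: le_trans (ler_norm_sum _ _ _) _.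
exact: ler_sum.
Qed.

End condexp.

Section reals.
Variable R : rcfType.

Lemma eq_ler (a b : R) : a = b -> a <= b. Proof. by move->. Qed.

Lemma sqrt_leP (a b : R) : 0 <= b -> a <= b ^+ 2 -> Num.sqrt a <= b.
Proof.
by move=> b0 ab; rewrite -(ger0_norm b0) -sqrtr_sqr ler_wsqrtr.
Qed.

Lemma sum_sqr_le (T : Type) (s : seq T) (P : pred T) (F : T -> R) :
  \sum_(i <- s | P i) F i ^+ 2 <= (\sum_(i <- s | P i) `|F i|) ^+ 2.
Proof.
suff : 0 <= \sum_(i <- s | P i) `|F i| /\
  \sum_(i <- s | P i) F i ^+ 2 <= (\sum_(i <- s | P i) `|F i|) ^+ 2 by case.
elim/big_ind2: _ => [|x y x' y' [x0 xy] [x'0 xy']|i _].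
- by rewrite expr0n.
- by split; [exact: addr_ge0|rewrite sqrrD; nra].
- by rewrite normr_ge0 -normrX ler_norm.
Qed.

(** Splits a into g, to be estimated in mean square, and a - g, to be estimated in mean.
    The parameter m balances the two terms that replace the square root of the sum. *)
Lemma sqrt_sum_le (T : Type) (s : seq T) (P : pred T) (a g : T -> R) (m : R) :
  0 < m ->
  Num.sqrt (\sum_(i <- s | P i) a i ^+ 2) <=
  (\sum_(i <- s | P i) g i ^+ 2) / m + m + 2 * \sum_(i <- s | P i) `|a i - g i|.
Proof.
move=> m0; set X := \sum_(i <- s | P i) g i ^+ 2.
set Y := \sum_(i <- s | P i) `|a i - g i|.
have X0 : 0 <= X by apply: sumr_ge0 => i _; exact: sqr_ge0.
have Y0 : 0 <= Y by apply: sumr_ge0.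
have H : \sum_(i <- s | P i) a i ^+ 2 <= 2 * X + 2 * Y ^+ 2.
  apply: (@le_trans _ _ (2 * X + 2 * \sum_(i <- s | P i) (a i - g i) ^+ 2)).
    rewrite !mulr_sumr -big_split /=; apply: ler_sum => i _.
    have := sqr_ge0 (a i - 2 * g i); nra.
  by rewrite lerD2l ler_pM2l// sum_sqr_le.
have Xm0 : 0 <= X / m by rewrite divr_ge0// ltW.
apply: sqrt_leP.
  by apply: addr_ge0; [apply: addr_ge0 => //; exact: ltW|exact: mulr_ge0].
apply: le_trans H _.
have E : X = (X / m) * m by rewrite mulfVK// lt0r_neq0.
rewrite {1}E; set x := X / m in Xm0 *.
have := sqr_ge0 (x - m); have : 0 <= (x + m) * Y by rewrite mulr_ge0 // addr_ge0 // ltW.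
by nra.
Qed.

Lemma geom_le1 (t d : nat) :
  \sum_(1 <= e < d.+1 | (t < e)%N) (2 ^+ t / 2 ^+ e : R) <= 1.
Proof.
suff : \sum_(1 <= e < d.+1 | (t < e)%N) (2 ^+ t / 2 ^+ e : R) <=
    1 - (if (t < d)%N then 2 ^+ t / 2 ^+ d else 1 ).
  move/le_trans; apply; case: ifP => _; rewrite gerBl//.
elim: d => [|d IH]; first by rewrite big_geq// ltn0 subrr.
rewrite big_mkcond big_nat_recr//= -big_mkcond/=.
apply: (le_trans (lerD IH (lexx _))).
have [td|td|td] := ltngtP t d.
- rewrite ltnS (ltnW td) exprS invfM mulrCA.
  have : (0 : R) <= 2 ^+ t / 2 ^+ d by apply: divr_ge0; exact: exprn_ge0.
  move: (_ / _) => x; lra.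
- by rewrite subrr add0r ltnS leqNgt td subrr.
- rewrite td ltnSn subrr add0r exprS invfM mulrCA divff ?mulr1//; lra.
Qed.

End reals.

(** * A stopped square function estimate *)

Section local_estimate.
Variables (R : rcfType) (n s : nat).
Local Notation Zn := 'rV[int]_n.
Local Notation W := (W R n).
Local Notation Kn := (Kn R n).
Implicit Types (k q : Zn).
Variables (U : Zn -> R).
Hypothesis U0 : forall k, 0 <= U k.

Definition bad (lam : R) (e : nat) k : bool := lam < av U e (anc e k).

Definition hit lam e k : bool := has (bad lam e) (nbh s e (anc e k)).

(** Ensures that a rescaled function of generation e near k meets stopping cells of smaller
    generation only. *)
Definition calm lam d e k : bool :=
  [forall e' : 'I_d, (e <= e')%N ==> ~~ hit lam e' k].

Lemma bad_anc lam e k k' : anc e k = anc e k' -> bad lam e k = bad lam e k'.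
Proof. by rewrite /bad => ->. Qed.

Lemma hit_anc lam e k k' : anc e k = anc e k' -> hit lam e k = hit lam e k'.
Proof. by rewrite /hit => ->. Qed.

(* I, p e q and r e q stand for the averages, over the finest cells, of a function, of its
   product with a function rescaled to the cell q of generation e, and of the latter alone;
   h e q t is a reference value of the rescaled function on each cell of generation t. *)
Variables (L : R) (I : Zn -> R) (p r : nat -> Zn -> Zn -> R).
Variable (h : nat -> Zn -> nat -> Zn -> R) (D : nat).
Hypothesis L0 : 0 <= L.
Hypothesis IU : forall k, `|I k| <= U k.
Hypothesis Hp : forall e q k t, (t <= e)%N ->
  `|p e q k - I k * h e q t (anc t k)| <= L * U k * (2 ^+ t / 2 ^+ e).
Hypothesis Hr : forall e q k t, (t <= e)%N ->
  `|r e q k - h e q t (anc t k)| <= L * (2 ^+ t / 2 ^+ e).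
Hypothesis bessel : forall (c : Zn -> R) d q, (d <= D)%N ->
  \sum_(1 <= e < d.+1) \sum_(q' <- cells (d - e) q)
    W e * (nav s (fun k => c k * r e q' k) e q') ^+ 2
  <= \sum_(k <- nbh s d q) c k ^+ 2.

(** The coefficient of generation e at q; a rescaled function lives on the neighbourhood of q. *)
Definition al e q : R := nav s (p e q) e q.

Definition Cloc : R :=
  4 ^+ n * Kn s + 1 + 2 * (L * Kn s * (1 + 2 ^+ n * Kn s)).

Lemma Cloc_gt0 : 0 < Cloc.
Proof.
have K0 := Kn_gt0 R n s.
rewrite /Cloc -addrA ltr_wpDl ?mulr_ge0 ?exprn_ge0 ?(ltW K0)// ltr_pwDl//.
by rewrite !mulr_ge0// ?(ltW K0)// addr_ge0// mulr_ge0 ?exprn_ge0 ?(ltW K0).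
Qed.

Section fixed_cell.
Variables (d : nat) (q0 : Zn) (lam : R).
Hypothesis dD : (d.+1 <= D)%N.
Hypothesis lam0 : 0 < lam.
Hypothesis Alam : nav s U d.+1 q0 <= lam.

Let tau := stime d.+1 (bad lam).
Let c := Ex tau I.

Let tau_st : stopping tau.
Proof. by apply: stime_stopping => e k k' /bad_anc. Qed.

Let tau_lt k : (tau k < d.+1)%N. Proof. exact: stime_lt. Qed.

Let bound_av k : k \in nbh s d.+1 q0 ->
  av U (tau k) (anc (tau k) k) <= 2 ^+ n * lam.
Proof.
move=> kn; apply: le_trans (le_av _ _ U0) _.
rewrite ler_pM2l ?exprn_gt0//.
have [e|e] := ltnP (tau k).+1 d.+1; last first.
  have -> : (tau k).+1 = d.+1 by apply/eqP; rewrite eqn_leq e tau_lt.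
  exact: le_trans (le_av_nav U0 kn) Alam.
by rewrite leNgt; apply: (@stime_gt _ d.+1 (bad lam)); rewrite ltnSn.
Qed.

Let bound_c k : k \in nbh s d.+1 q0 -> `|c k| <= 2 ^+ n * lam.
Proof. by move=> kn; apply: le_trans (Ex_abs _ _ IU) _; exact: bound_av. Qed.

Let V k := U k + `|c k|.

(** On the stopping cells I - c has mean zero, so it is annihilated by the reference values,
    which are constant there; what remains are the Lipschitz errors of p and of r. *)
Let approx e k : calm lam d.+1 e k -> k \in cells d.+1 q0 -> (0 < e <= d.+1)%N ->
  let q := anc e k in
  `|al e q - nav s (fun k => c k * r e q k) e q| <=
  (L / W e) * \sum_(k' <- nbh s d.+1 q0)
     ((k' \in nbh s e q)%:R * (tau k' < e)%:R * (V k' * (2 ^+ tau k' / 2 ^+ e))).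
Proof.
move=> ca kq /andP[e0 ed] /=; set q := anc e k.
have qE : anc d.+1 k = q0 by apply/eqP; rewrite -mem_cells.
have sub : {subset nbh s e q <= nbh s d.+1 q0}.
  by move=> k' k'n; rewrite -qE; apply: nbhW k'n.
have tau_e k' : k' \in nbh s e q -> (tau k' < e)%N.
  move=> k'n; rewrite ltnNge; apply/negP => et.
  have Pbad e1 k1 k2 : anc e1 k1 = anc e1 k2 -> bad lam e1 k1 = bad lam e1 k2.
    exact: bad_anc.
  have [t0|b] := stime0 d.+1 (bad lam) k'; first by move: et; rewrite /tau t0 leqNgt e0.
  move/forallP/(_ (Ordinal (tau_lt k'))) : ca; rewrite /= et /=.
  by apply/negP; rewrite negbK; apply/hasP; exists k' => //; apply: nbhW k'n.
(* The reference value on the stopping cell of k'. *)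
pose hh k' := h e q (tau k') (anc (tau k') k').
have E : \sum_(k' <- nbh s e q) (I k' - c k') * hh k' = 0.
  under eq_bigr do rewrite mulrBl.
  rewrite sumrB (Ex_sum I tau_st) ?subrr ?uniq_nbh//.
  - move=> k1 k1n k2 /(cellsW (ltnW (tau_e _ k1n))); exact: cells_nbh.
  - by move=> k1 k2 H; rewrite /hh (tau_st H) H.
rewrite /al /nav -mulrBl -sumrB normrM [`|_^-1|]ger0_norm ?invr_ge0 ?(ltW (W_gt0 _ _ _))//.
rewrite [X in _ <= X]mulrAC ler_pM2r ?invr_gt0 ?W_gt0//.
rewrite (_ : \sum_(k <- _) _ = \sum_(k' <- nbh s e q)
    ((p e q k' - I k' * hh k') - c k' * (r e q k' - hh k'))); last first.
  transitivity (\sum_(k' <- nbh s e q) ((p e q k' - I k' * hh k') -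
    c k' * (r e q k' - hh k')) + \sum_(k' <- nbh s e q) (I k' - c k') * hh k').
    by rewrite -big_split; apply: eq_bigr => k' _ /=; ring.
  by rewrite E addr0.
apply: le_trans (ler_norm_sum _ _ _) _.
rewrite (sum_subseq_filter _ (uniq_nbh _ _ _) (uniq_nbh _ _ _) sub) mulr_sumr.
rewrite big_mkcond /=; apply: ler_sum => k' _.
case: ifP => [k'n|_]; last by rewrite !mul0r mulr0.
rewrite (tau_e _ k'n) !mul1r /V.
apply: le_trans (ler_normB _ _) _; rewrite mulrDl [leRHS]mulrDr.
apply: lerD; first by rewrite mulrA; apply: Hp; exact/ltnW/tau_e.
rewrite normrM mulrCA ler_wpM2l//; apply: Hr; exact/ltnW/tau_e.
Qed.

Let count e k' : \sum_(k <- cells d.+1 q0) (k' \in nbh s e (anc e k))%:R <= Kn s * W e.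
Proof.
rewrite -(size_nbhW _ _ _ (anc e k')).
under eq_bigr do rewrite mem_nbhC.
apply: sum_mem_le; [exact: uniq_cells|exact: uniq_nbh].
Qed.

Let sumV : \sum_(k <- nbh s d.+1 q0) V k <= (1 + 2 ^+ n * Kn s) * lam * W d.+1.
Proof.
rewrite big_split /= mulrDl mul1r mulrDl; apply: lerD.
  by rewrite -ler_pdivrMr ?W_gt0.
apply: (@le_trans _ _ (\sum_(k <- nbh s d.+1 q0) 2 ^+ n * lam)).
  by rewrite big_seq [leRHS]big_seq; apply: ler_sum => k; exact: bound_c.
by rewrite sum1_size size_nbhW; apply/eq_ler; ring.
Qed.

(** Calderon-Zygmund decomposition I = c + (I - c) at height lam: c is bounded, so Bessel's
    inequality controls its coefficients in mean square, while those of I - c are summed in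
    absolute value with the geometric decay of the Lipschitz errors. *)
Lemma local_estimateS :
  \sum_(k <- cells d.+1 q0)
     Num.sqrt (\sum_(1 <= e < d.+2 | calm lam d.+1 e k) al e (anc e k) ^+ 2)
  <= Cloc * lam * W d.+1.
Proof.
pose ga e q := nav s (fun k => c k * r e q k) e q.
pose X k := \sum_(1 <= e < d.+2 | calm lam d.+1 e k) ga e (anc e k) ^+ 2.
pose Y k := \sum_(1 <= e < d.+2 | calm lam d.+1 e k)
  `|al e (anc e k) - ga e (anc e k)|.
apply: (@le_trans _ _ (\sum_(k <- cells d.+1 q0) (X k / lam + lam + 2 * Y k))).
  by apply: ler_sum => k _; exact: sqrt_sum_le.
rewrite 2!big_split /= -mulr_suml sum1_size size_cellsW -mulr_sumr.
have HX : \sum_(k <- cells d.+1 q0) X k <= 4 ^+ n * Kn s * lam ^+ 2 * W d.+1.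
  apply: (@le_trans _ _ (\sum_(k <- nbh s d.+1 q0) c k ^+ 2)); last first.
    apply: (@le_trans _ _ (\sum_(k <- nbh s d.+1 q0) (2 ^+ n * lam) ^+ 2)).
      rewrite big_seq [leRHS]big_seq; apply: ler_sum => k kn.
      rewrite -real_normK ?num_real//; apply: lerXn2r; rewrite ?nnegrE ?bound_c//.
      by rewrite mulr_ge0 ?exprn_ge0// ltW.
    rewrite sum1_size size_nbhW exprMn -exprM mulnC exprM.
    by rewrite (_ : 2 ^+ 2 = 4)//; [apply/eq_ler; ring|rewrite expr2 -natrM].
  apply: le_trans (bessel c q0 dD); rewrite /X.
  apply: (@le_trans _ _ (\sum_(k <- cells d.+1 q0) \sum_(1 <= e < d.+2)
     ga e (anc e k) ^+ 2)).
    apply: ler_sum => k _; rewrite big_mkcond; apply: ler_sum => e _.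
    by case: ifP => // _; exact: sqr_ge0.
  rewrite exchange_big /= big_nat [leRHS]big_nat.
  apply: ler_sum => e /andP[e0 ed]; apply/eq_ler.
  transitivity (\sum_(k <- cells d.+1 q0) \sum_(q' <- cells (d.+1 - e) q0)
     (k \in cells e q')%:R * ga e q' ^+ 2).
    rewrite big_seq [RHS]big_seq; apply: eq_bigr => k kq.
    have qE : anc d.+1 k = q0 by apply/eqP; rewrite -mem_cells.
    rewrite (bigD1_seq (anc e k)) ?uniq_cells//=; last first.
      by rewrite mem_cells ancD subnK// qE.
    rewrite mem_cells eqxx mul1r big1_seq ?addr0// => q' /andP[q'k _].
    by rewrite mem_cells eq_sym (negbTE q'k) mul0r.
  rewrite exchange_big /= big_seq [RHS]big_seq; apply: eq_bigr => q' q'q.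
  rewrite -mulr_suml; congr (_ * _).
  rewrite -(size_cellsW R e q') -[RHS]mul1r -sum1_size.
  rewrite (@sum_subseq_filter _ _ (cells e q') (cells d.+1 q0)) ?uniq_cells//.
    by rewrite [RHS]big_mkcond /=; apply: eq_bigr => k _; case: ifP.
  move=> k; rewrite !mem_cells => /eqP ke; move: q'q; rewrite mem_cells -ke ancD.
  by rewrite subnK.
have HY : \sum_(k <- cells d.+1 q0) Y k <= L * Kn s * ((1 + 2 ^+ n * Kn s) * lam * W d.+1).
  apply: (@le_trans _ _ (\sum_(k <- cells d.+1 q0) \sum_(1 <= e < d.+2)
    \sum_(k' <- nbh s d.+1 q0) (L / W e) *
      ((k' \in nbh s e (anc e k))%:R * (tau k' < e)%:R * (V k' * (2 ^+ tau k' / 2 ^+ e))))).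
    rewrite big_seq [leRHS]big_seq; apply: ler_sum => k kq.
    rewrite /Y big_mkcond big_nat [leRHS]big_nat; apply: ler_sum => e ed.
    case: ifP => [ca|_]; first by rewrite -mulr_sumr; apply: approx => //; rewrite -ltnS.
    apply: sumr_ge0 => k' _; rewrite !mulr_ge0 ?invr_ge0 ?exprn_ge0 ?addr_ge0//.
  rewrite exchange_big /=.
  under eq_bigr do rewrite exchange_big /=.
  rewrite exchange_big /=.
  apply: le_trans (ler_wpM2l (mulr_ge0 L0 (ltW (Kn_gt0 R n s))) sumV).
  rewrite mulr_sumr; apply: ler_sum => k' _.
  apply: (@le_trans _ _ (\sum_(1 <= e < d.+2) L * Kn s * V k' *
      ((tau k' < e)%:R * (2 ^+ tau k' / 2 ^+ e)))); last first.
    rewrite -mulr_sumr ler_piMr ?mulr_ge0 ?addr_ge0 ?(ltW (Kn_gt0 _ _ _))//.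
    apply: le_trans (geom_le1 R (tau k') d.+1); rewrite [leRHS]big_mkcond.
    by apply: ler_sum => e _; case: ifP => _; rewrite ?mul1r ?mul0r.
  apply: ler_sum => e _.
  rewrite -mulr_sumr.
  under eq_bigr do rewrite -mulrA mulrC.
  rewrite -mulr_sumr.
  set v := 2 ^+ _ / _; set b := (_ < _)%:R.
  apply: (@le_trans _ _ (L / W e * (b * (V k' * v) * (Kn s * W e)))); last first.
    by apply/eq_ler; field; exact: W_neq0.
  rewrite ler_wpM2l ?divr_ge0 ?(ltW (W_gt0 _ _ _))// ler_wpM2l ?count//.
  by rewrite !mulr_ge0 ?addr_ge0 ?invr_ge0 ?exprn_ge0.
rewrite -[X in X <= _]addrA addrC; apply: (@le_trans _ _
  (lam * W d.+1 + 2 * (L * Kn s * ((1 + 2 ^+ n * Kn s) * lam * W d.+1)) +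
   (4 ^+ n * Kn s * lam ^+ 2 * W d.+1) / lam)).
  apply: lerD; first by rewrite lerD2l ler_pM2l.
  by rewrite ler_pM2r ?invr_gt0.
apply/eq_ler; rewrite /Cloc; field; exact/lt0r_neq0.
Qed.

End fixed_cell.

Lemma local_estimate d q0 lam : (d <= D)%N -> 0 < lam -> nav s U d q0 <= lam ->
  \sum_(k <- cells d q0)
     Num.sqrt (\sum_(1 <= e < d.+1 | calm lam d e k) al e (anc e k) ^+ 2)
  <= Cloc * lam * W d.
Proof.
case: d => [|d] dD lam0 Al; last exact: local_estimateS.
rewrite big1 ?mulr_ge0 ?(ltW Cloc_gt0) ?(ltW lam0) ?(ltW (W_gt0 _ _ _))//.
by move=> k _; rewrite big_geq// sqrtr0.
Qed.

End local_estimate.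

(** * A bilinear bound by induction over stopping cells *)

Section bilinear.
Variables (R : rcfType) (n s : nat).
Local Notation Zn := 'rV[int]_n.
Local Notation W := (W R n).
Local Notation Kn := (Kn R n).
Implicit Types (k q : Zn).
Variables (U G M N : Zn -> R) (a : nat -> Zn -> R) (D : nat) (C0 : R).
Hypothesis U0 : forall k, 0 <= U k.
Hypothesis G0 : forall k, 0 <= G k.
Hypothesis C00 : 0 < C0.
Hypothesis loc : forall d q lam, (d <= D)%N -> 0 < lam -> nav s U d q <= lam ->
  \sum_(k <- cells d q)
     Num.sqrt (\sum_(1 <= e < d.+1 | calm s U lam d e k) a e (anc e k) ^+ 2)
  <= C0 * lam * W d.
Hypothesis MU : forall e k, (e <= D)%N -> nav s U e (anc e k) <= M k.
Hypothesis NG : forall e k, (e <= D)%N -> av G e (anc e k) <= N k.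

Definition Tsq d k : R := Num.sqrt (\sum_(1 <= e < d.+1) a e (anc e k) ^+ 2).

Let Lam : R := 2 * (Kn s + 1).

Definition Cbil : R := 2 ^+ n * 2 * C0 * Lam ^+ 2.

Let Lam_ge1 : 1 <= Lam.
Proof. by have := Kn_gt0 R n s; rewrite /Lam; lra. Qed.

Let Lam_gt0 : 0 < Lam. Proof. exact: lt_le_trans ltr01 Lam_ge1. Qed.

Lemma Cbil_gt0 : 0 < Cbil.
Proof. by rewrite mulr_gt0 ?(exprn_gt0 _ Lam_gt0)// mulr_gt0// mulr_gt0// exprn_gt0. Qed.

Let M0 k : 0 <= M k.
Proof. exact: le_trans (nav_ge0 s 0%N (anc 0 k) U0) (MU k (leq0n _)). Qed.

Let N0 k : 0 <= N k.
Proof. exact: le_trans (av_ge0 0%N (anc 0 k) G0) (NG k (leq0n _)). Qed.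

Let Tsq0 k : Tsq 0 k = 0. Proof. by rewrite /Tsq big_geq// sqrtr0. Qed.

Section fixed_cell.
Variables (d : nat) (q0 : Zn).
Hypothesis d0 : (0 < d)%N.
Hypothesis dD : (d <= D)%N.
Let A := nav s U d q0.
Let g0 := av G d q0.

Let ancd k : k \in cells d q0 -> anc d k = q0.
Proof. by rewrite mem_cells => /eqP. Qed.

(** Letting the height tend to zero in the hypothesis on the stopped square function. *)
Lemma Tsq_zero : A = 0 -> forall k, k \in cells d q0 -> Tsq d k = 0.
Proof.
move=> A0 k kq.
have UU k' : k' \in nbh s d q0 -> U k' = 0.
  move=> k'n; apply/eqP; rewrite eq_le U0 andbT.
  have <- : \sum_(k <- nbh s d q0) U k = 0.
    by move/eqP: A0; rewrite /A /nav mulf_eq0 invr_eq0 (negbTE (W_neq0 _ _ _)) orbF => /eqP.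
  by rewrite (bigD1_seq k') ?uniq_nbh//= lerDl sumr_ge0.
have ca lam e k' : 0 < lam -> k' \in cells d q0 -> calm s U lam d e k'.
  move=> lam0 k'q; apply/forallP => -[e' /= e'd]; apply/implyP => _.
  apply/hasPn => k'' k''n; rewrite /bad -leNgt /av big1_seq ?mul0r ?ltW//.
  move=> y /= yc; apply: UU.
  have {}yc := cellsW (ltnW e'd) yc.
  by apply: cells_nbh yc; rewrite -(ancd k'q); apply: nbhW k''n; exact: ltnW.
apply/eqP; rewrite eq_le sqrtr_ge0 andbT; apply/ler_addgt0Pr => eps eps0.
rewrite add0r.
(* This height makes the bound of the stopped estimate equal to eps. *)
pose lam := eps / (C0 * W d).
have lam0 : 0 < lam by rewrite divr_gt0// mulr_gt0// W_gt0.
have Alam : nav s U d q0 <= lam by rewrite -/A A0 ltW.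
have := loc dD lam0 Alam.
rewrite (_ : C0 * lam * W d = eps); last first.
  by rewrite /lam; field; rewrite W_neq0 lt0r_neq0.
apply: le_trans; rewrite (bigD1_seq k) ?uniq_cells//=.
rewrite -[leLHS]addr0 lerD ?sumr_ge0//.
rewrite /Tsq ler_wsqrtr// [leRHS]big_mkcond; apply: ler_sum => e _.
by rewrite ca.
Qed.

Hypothesis A0 : 0 < A.
Hypothesis g00 : 0 < g0.
Let lam := Lam * A.

Let lam0 : 0 < lam. Proof. exact: mulr_gt0. Qed.

Let high e k : bool := Lam * g0 < av G e (anc e k).
Let stop e k : bool := hit s U lam e k || high e k.
Let sigma := stime d stop.
Let st k : bool := [exists e : 'I_d, stop e k].

Let stop_anc e k k' : anc e k = anc e k' -> stop e k = stop e k'.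
Proof. by move=> H; rewrite /stop (hit_anc _ _ _ H) /high H. Qed.

Let sigma_st : stopping sigma. Proof. exact: stime_stopping stop_anc. Qed.

Let sigma_lt k : (sigma k < d)%N. Proof. exact: stime_lt. Qed.

Let sub_sigma k : k \in cells d q0 ->
  {subset cells (sigma k) (anc (sigma k) k) <= cells d q0}.
Proof. by move=> kq k' /(cellsW (ltnW (sigma_lt k))); rewrite (ancd kq). Qed.

Let stE k : st k = stop (sigma k) k.
Proof.
apply/existsP/idP => [[e]|H]; first exact: stimeP.
by exists (Ordinal (sigma_lt k)).
Qed.

Let st_const k k' : anc (sigma k) k' = anc (sigma k) k -> st k' = st k.
Proof. by move=> H; rewrite !stE (sigma_st H); exact: stop_anc. Qed.

Let sigma0 k : ~~ st k -> sigma k = 0%N.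
Proof. by rewrite stE; case: (stime0 d stop k) => // ->. Qed.

Let T1 k := Num.sqrt (\sum_(1 <= e < d.+1 | (sigma k < e)%N) a e (anc e k) ^+ 2).

Let Tsq_split k : Tsq d k <= T1 k + Tsq (sigma k) k.
Proof.
apply: sqrt_leP; first by rewrite addr_ge0 ?sqrtr_ge0.
have X0 (P : pred nat) m : 0 <= \sum_(1 <= e < m | P e) a e (anc e k) ^+ 2.
  by apply: sumr_ge0 => e _; exact: sqr_ge0.
have E2 : \sum_(1 <= e < d.+1 | ~~ (sigma k < e)%N) a e (anc e k) ^+ 2 =
    \sum_(1 <= e < (sigma k).+1) a e (anc e k) ^+ 2.
  rewrite (big_nat_widen 1 (sigma k).+1 d.+1) ?ltnS 1?ltnW//.
  by apply: eq_bigl => e; rewrite /= -leqNgt ltnS.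
rewrite sqrrD /T1 /Tsq !sqr_sqrtr// (bigID (fun e => sigma k < e)%N)/= E2.
by rewrite -addrA lerD2l lerDr mulrn_wge0 ?mulr_ge0 ?sqrtr_ge0.
Qed.

(** All generations coarser than the stopping cell are calm. *)
Let sumT1 : \sum_(k <- cells d q0) T1 k <= C0 * lam * W d.
Proof.
have Alam : nav s U d q0 <= lam by rewrite -/A ler_peMl// ltW.
apply: le_trans (loc dD lam0 Alam); rewrite big_seq [leRHS]big_seq.
apply: ler_sum => k kq; apply: ler_wsqrtr.
rewrite big_mkcond [leRHS]big_mkcond; apply: ler_sum => e _.
case: ifP => [se|_]; last by case: ifP => // _; exact: sqr_ge0.
rewrite ifT//; apply/forallP => -[e' /= e'd]; apply/implyP => ee'.
have : ~~ stop e' k by apply: (@stime_gt _ d stop); rewrite (leq_trans se ee').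
by rewrite negb_or => /andP[].
Qed.

Let avG k : k \in cells d q0 -> Ex sigma G k <= 2 ^+ n * (Lam * g0).
Proof.
move=> kq; apply: le_trans (le_av _ _ G0) _; rewrite ler_pM2l ?exprn_gt0//.
have [e|e] := ltnP (sigma k).+1 d; last first.
  have -> : (sigma k).+1 = d by apply/eqP; rewrite eqn_leq e sigma_lt.
  by rewrite (ancd kq) -/g0 ler_peMl// ltW.
have : ~~ stop (sigma k).+1 k by apply: (@stime_gt _ d stop); rewrite ltnSn.
by rewrite negb_or -leNgt => /andP[].
Qed.

(** T1 is constant on the stopping cells, so G may be replaced by its conditional average,
    which the stopping rule keeps below a multiple of g0. *)
Let part1 : \sum_(k <- cells d q0) T1 k * G k <=
  2 ^+ n * (Lam * g0) * (C0 * lam * W d).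
Proof.
under eq_bigr do rewrite mulrC.
rewrite -(@Ex_sum _ _ sigma)//; last 2 first.
- exact: uniq_cells.
- move=> k k' H; rewrite /T1 (sigma_st H); congr (Num.sqrt _).
  by apply: eq_bigr => e se; congr (a _ _ ^+ 2); apply: anc_eqW H; exact: ltnW.
apply: (@le_trans _ _ (\sum_(k <- cells d q0) 2 ^+ n * (Lam * g0) * T1 k)).
  rewrite big_seq [leRHS]big_seq; apply: ler_sum => k kq.
  by rewrite ler_wpM2r ?sqrtr_ge0 ?avG.
by rewrite -mulr_sumr ler_wpM2l// mulr_ge0 ?exprn_ge0// mulr_ge0// ltW.
Qed.

Let sum_ge0 F S : (forall k, 0 <= F k) -> 0 <= \sum_(k <- S) F k :> R.
Proof. by move=> F0; apply: sumr_ge0. Qed.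

(** Chebyshev inequality for the largest cells where the average of G is high. *)
Let few_high :
  Lam * \sum_(k <- cells d q0) [exists e : 'I_d, high e k]%:R <= W d.
Proof.
have Panc e k k' : anc e k = anc e k' -> high e k = high e k' by rewrite /high => ->.
pose tau := stime d high.
have tau_lt k : (tau k < d)%N by exact: stime_lt.
rewrite -(ler_pM2l g00) [leRHS](_ : _ = \sum_(k <- cells d q0) G k); last first.
  by rewrite /g0 /av mulfVK ?W_neq0.
rewrite -[leRHS](eq_bigr _ (fun k _ => mulr1 (G k))).
rewrite -(@Ex_sum _ _ tau)//; last 3 first.
- exact: stime_stopping.
- exact: uniq_cells.
- by move=> k kq k' /(cellsW (ltnW (tau_lt k))); rewrite (ancd kq).
rewrite mulrA mulr_sumr; apply: ler_sum => k _; rewrite mulr1.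
have Ex0 : 0 <= Ex tau G k by exact: av_ge0.
case: (boolP [exists _, _]) => [/existsP[e he]|_]; last by rewrite mulr0.
by rewrite mulr1 mulrC ltW//; exact: (stimeP (ltn_ord e) he).
Qed.

(** Each bad cell is responsible for the stopping in the boundedly many cells around it;
    the largest bad cells are few by the Chebyshev inequality. *)
Let few_hit :
  Lam * \sum_(k <- cells d q0) [exists e : 'I_d, hit s U lam e k]%:R <= Kn s * W d.
Proof.
pose tau := stime d (bad U lam).
have tau_lt k : (tau k < d)%N by exact: stime_lt.
have tau_st : stopping tau by apply: stime_stopping => e k k' /bad_anc.
pose b k := [exists e : 'I_d, bad U lam e k].
have bE k : b k = bad U lam (tau k) k.
  apply/existsP/idP => [[e]|H]; first exact: stimeP.
  by exists (Ordinal (tau_lt k)).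
have sumb : Lam * \sum_(k <- nbh s d q0) (b k)%:R <= W d.
  rewrite -(ler_pM2l A0) [leRHS](_ : _ = \sum_(k <- nbh s d q0) U k); last first.
    by rewrite /A /nav mulfVK ?W_neq0.
  rewrite -[leRHS](eq_bigr _ (fun k _ => mulr1 (U k))).
  rewrite -(@Ex_sum _ _ tau)//; last 2 first.
  - exact: uniq_nbh.
  - by move=> k kq k' /(cellsW (ltnW (tau_lt k))); exact: cells_nbh.
  rewrite mulrA mulr_sumr; apply: ler_sum => k _; rewrite mulr1.
  have Ex0 : 0 <= Ex tau U k by exact: av_ge0.
  rewrite bE; case: (boolP (bad _ _ _ _)) => [|_]; last by rewrite mulr0.
  by rewrite mulr1 mulrC => /ltW.
apply: (@le_trans _ _ (Lam * (Kn s * \sum_(k <- nbh s d q0) (b k)%:R))); last first.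
  by rewrite mulrCA ler_wpM2l// ltW// Kn_gt0.
rewrite ler_wpM2l ?(ltW Lam_gt0)//.
(* Each point k' of a largest bad cell gives the reciprocal of its size to the k around it. *)
pose v k k' : R := (b k')%:R / W (tau k') * (k \in nbh s (tau k') (anc (tau k') k'))%:R.
have v0 k k' : 0 <= v k k' by rewrite /v !mulr_ge0// invr_ge0 ltW// W_gt0.
apply: (@le_trans _ _ (\sum_(k <- cells d q0) \sum_(k' <- nbh s d q0) v k k')).
  rewrite big_seq [leRHS]big_seq; apply: ler_sum => k kq.
  case: (boolP [exists _, _]) => [/existsP[e /hasP[k1 k1n b1]]|_]; last exact: sum_ge0.
  have te : (e <= tau k1)%N by exact: stime_ge.
  have sub : {subset cells (tau k1) (anc (tau k1) k1) <= nbh s d q0}.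
    move=> k' /(cellsW (ltnW (tau_lt k1))); apply: cells_nbh.
    by rewrite -(ancd kq); apply: nbhW k1n; exact: ltnW.
  apply: le_trans (ler_sum_subset _ _ sub (v0 k)); rewrite ?uniq_cells ?uniq_nbh//.
  rewrite (_ : \sum_(k' <- _) _ = \sum_(k' <- cells (tau k1) (anc (tau k1) k1)) (W (tau k1))^-1).
    by rewrite sum1_size size_cellsW mulVf// W_neq0.
  rewrite big_seq [RHS]big_seq; apply: eq_bigr => k'; rewrite mem_cells => /eqP k'E.
  rewrite /v bE (tau_st _ _ k'E) k'E (bad_anc _ _ k'E) -bE.
  have -> : b k1 by apply/existsP; exists e.
  by rewrite -mem_nbhC (nbhW te k1n) mul1r mulr1.
rewrite exchange_big mulr_sumr /=; apply: ler_sum => k' _; rewrite /v -mulr_sumr.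
rewrite mulrAC [leRHS]mulrC -mulrA ler_wpM2l// ler_pdivrMr ?W_gt0//.
rewrite -(size_nbhW _ _ _ (anc (tau k') k')).
by apply: sum_mem_le; [exact: uniq_cells|exact: uniq_nbh].
Qed.

(** The factor Lam of the stopping rule is the one that makes this hold. *)
Let few_stop : 2 * \sum_(k <- cells d q0) (st k)%:R <= W d.
Proof.
rewrite -(ler_pM2l (_ : 0 < Kn s + 1)); last by rewrite addr_gt0 ?Kn_gt0.
rewrite mulrA [_ * 2]mulrC -/Lam [leRHS]mulrDl mul1r.
apply: le_trans (lerD few_hit few_high); rewrite -mulrDr ler_wpM2l ?(ltW Lam_gt0)//.
rewrite -big_split; apply: ler_sum => k _ /=.
rewrite -natrD ler_nat; case: (boolP (st k)) => // /existsP[e /orP[h|h]].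
  by rewrite (_ : [exists _, hit _ _ _ _ _] = true)//; apply/existsP; exists e.
by rewrite addnC (_ : [exists _, high _ _] = true)//; apply/existsP; exists e.
Qed.

Hypothesis IH : forall e q, (e < d)%N ->
  \sum_(k <- cells e q) Tsq e k * G k <= Cbil * \sum_(k <- cells e q) M k * N k.

(** The induction hypothesis applied in every stopping cell. *)
Let part2 : \sum_(k <- cells d q0) Tsq (sigma k) k * G k <=
  Cbil * \sum_(k <- cells d q0) M k * N k * (st k)%:R.
Proof.
rewrite (eq_bigr (fun k => Tsq (sigma k) k * G k * (st k)%:R)); last first.
  move=> k _; case: (boolP (st k)) => [|/sigma0 ->]; first by rewrite mulr1.
  by rewrite Tsq0 !mul0r.
have E (F : Zn -> R) : \sum_(k <- cells d q0) F k * (st k)%:R =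
    \sum_(k <- cells d q0) Ex sigma F k * (st k)%:R.
  rewrite Ex_sum ?uniq_cells// => k k' H; by rewrite (st_const H).
rewrite (E (fun k => Tsq (sigma k) k * G k)) (E (fun k => M k * N k)).
rewrite mulr_sumr; apply: ler_sum => k _.
rewrite mulrA ler_wpM2r// /Ex /av mulrA ler_pM2r ?invr_gt0 ?W_gt0//.
apply: le_trans (IH _ (sigma_lt k)); rewrite big_seq [leRHS]big_seq; apply: eq_ler.
by apply: eq_bigr => k'; rewrite mem_cells => /eqP /sigma_st ->.
Qed.

(** The points outside the stopping cells are at least half of the cell, and there M and N
    exceed the averages over the whole cell. *)
Let part3 : A * g0 * W d <= 2 * \sum_(k <- cells d q0) M k * N k * (~~ st k)%:R.
Proof.
have H : A * g0 * \sum_(k <- cells d q0) (~~ st k)%:R <=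
    \sum_(k <- cells d q0) M k * N k * (~~ st k)%:R.
  rewrite mulr_sumr big_seq [leRHS]big_seq; apply: ler_sum => k kq.
  rewrite ler_wpM2r// ler_pM ?(ltW A0) ?(ltW g00)//.
    by rewrite /A -(ancd kq); exact: (MU k dD).
  by rewrite /g0 -(ancd kq); exact: (NG k dD).
apply: le_trans (ler_wpM2l (ler0n _ 2) H); rewrite [leRHS]mulrCA (ler_pM2l (mulr_gt0 A0 g00)).
have E : \sum_(k <- cells d q0) (~~ st k)%:R = W d - \sum_(k <- cells d q0) (st k)%:R.
  rewrite -(size_cellsW R d q0) -[(size _)%:R]mul1r -sum1_size -sumrB.
  by apply: eq_bigr => k _; case: (st k); rewrite ?subrr ?subr0.
rewrite E; have := few_stop; lra.
Qed.

Lemma bilinear_step :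
  \sum_(k <- cells d q0) Tsq d k * G k <= Cbil * \sum_(k <- cells d q0) M k * N k.
Proof.
apply: (@le_trans _ _ (\sum_(k <- cells d q0) (T1 k * G k + Tsq (sigma k) k * G k))).
  by apply: ler_sum => k _; rewrite -mulrDl ler_wpM2r.
rewrite big_split /=; apply: le_trans (lerD part1 part2) _.
rewrite (_ : \sum_(k <- _) M k * N k = \sum_(k <- cells d q0) M k * N k * (~~ st k)%:R +
  \sum_(k <- cells d q0) M k * N k * (st k)%:R); last first.
  rewrite -big_split; apply: eq_bigr => k _ /=.
  by case: (st k); rewrite ?mulr1 ?mulr0 ?addr0 ?add0r.
rewrite mulrDr lerD2r.
have -> : 2 ^+ n * (Lam * g0) * (C0 * lam * W d) =
  (2 ^+ n * C0 * Lam ^+ 2) * (A * g0 * W d) by rewrite /lam; ring.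
have -> : Cbil = (2 ^+ n * C0 * Lam ^+ 2) * 2 by rewrite /Cbil; ring.
rewrite -[leRHS]mulrA ler_wpM2l ?part3// mulr_ge0 ?(exprn_ge0 _ (ltW Lam_gt0))//.
by rewrite mulr_ge0 ?exprn_ge0// ltW.
Qed.

End fixed_cell.

(** The contributions of the successive generations of stopping cells add up because they
    are bounded by integrals of M N over disjoint sets. *)
Theorem discrete_bilinear d q : (d <= D)%N ->
  \sum_(k <- cells d q) Tsq d k * G k <= Cbil * \sum_(k <- cells d q) M k * N k.
Proof.
elim/ltn_ind: d q => d IH q dD.
have R0 : 0 <= Cbil * \sum_(k <- cells d q) M k * N k.
  by rewrite mulr_ge0 ?(ltW Cbil_gt0)// sumr_ge0// => k _; exact: mulr_ge0.
have [d0|d0] := posnP d.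
  by rewrite big1// => k _; rewrite {1}d0 Tsq0 mul0r.
have := nav_ge0 s d q U0; rewrite le_eqVlt => /orP[/eqP/esym A0|A0].
  by rewrite big1_seq// => k /= kq; rewrite (Tsq_zero dD A0 kq) mul0r.
have := av_ge0 d q G0; rewrite le_eqVlt => /orP[/eqP/esym g0|g0].
  rewrite big1_seq// => k /= kq; suff -> : G k = 0 by rewrite mulr0.
  apply/eqP; rewrite eq_le G0 andbT.
  have <- : \sum_(k <- cells d q) G k = 0.
    by move/eqP: g0; rewrite /av mulf_eq0 invr_eq0 (negbTE (W_neq0 _ _ _)) orbF => /eqP.
  by rewrite (bigD1_seq k) ?uniq_cells//= lerDl sumr_ge0.
apply: bilinear_step => // e q' ed; apply: IH => //; exact: leq_trans (ltnW ed) dD.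
Qed.

End bilinear.

(** * Dyadic cells of space *)

Section dyadic.
Variables (R : realType) (n : nat).
Local Notation E := 'rV[R]_n.
Local Notation Zn := 'rV[int]_n.
Local Notation mu := (@lebesgue_rV R n).
Implicit Types (x y : E) (k q : Zn) (j : int).

Lemma pow2_gt0 j : (0 : R) < 2 ^ j. Proof. exact: exprz_gt0. Qed.
Lemma pow2_neq0 j : (2 : R) ^ j != 0. Proof. exact/lt0r_neq0/pow2_gt0. Qed.
Lemma pow2D j j' : (2 : R) ^ (j + j') = 2 ^ j * 2 ^ j'.
Proof. by rewrite expfzDr. Qed.
Lemma pow2N j : (2 : R) ^ (- j) = (2 ^ j)^-1.
Proof. by rewrite -invr_expz. Qed.

Definition cellix j x : Zn := \row_i Num.floor (2 ^ j * x ord0 i).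

(** Unlike the closed cubes of the square functions, these cells form a partition. *)
Definition hcell j k : set E := [set x | cellix j x = k].

Lemma cellixE j x i : cellix j x ord0 i = Num.floor (2 ^ j * x ord0 i).
Proof. by rewrite mxE. Qed.

Lemma cellix_itv j x i :
  (cellix j x ord0 i)%:~R <= 2 ^ j * x ord0 i < (cellix j x ord0 i)%:~R + 1.
Proof. by rewrite cellixE -[1]/(1%:~R) -intrD floor_itv. Qed.

Lemma floor_divz (y : R) (N : int) : 0 < N ->
  Num.floor (y / N%:~R) = (Num.floor y %/ N)%Z.
Proof.
move=> N0; apply: floor_def.
have N0' : 0 < N%:~R :> R by rewrite ltr0z.
have /andP[h1 h2] := floor_itv y.
rewrite ler_pdivlMr// ltr_pdivrMr// -!intrM; apply/andP; split.
  by apply: le_trans h1; rewrite ler_int lez_floor// lt0r_neq0.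
by apply: lt_le_trans h2 _; rewrite ler_int lezD1 ltz_ceil.
Qed.

Lemma cellix_anc j e x : cellix (j - e%:Z) x = anc e (cellix j x).
Proof.
apply: row_ext => i; rewrite !mxE -floor_divz ?exprn_gt0//.
congr (Num.floor _); rewrite pow2D pow2N -exprnP mulrAC; congr (_ / _).
by rewrite rmorphXn.
Qed.

Lemma mem_cells_cellix j e q x : (cellix j x \in cells e q) = (cellix (j - e%:Z) x == q).
Proof. by rewrite mem_cells cellix_anc. Qed.

Let side j (k : int) : set R := [set` `[2 ^ (- j) * k%:~R, 2 ^ (- j) * (k%:~R + 1)[%R].

Lemma hcellE j k : hcell j k = [set x : E | forall i, side j (k ord0 i) (x ord0 i)].
Proof.
have aux x i : side j (k ord0 i) (x ord0 i) <-> cellix j x ord0 i = k ord0 i.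
  rewrite /side/= in_itv/= pow2N ![_^-1 * _]mulrC.
  rewrite ler_pdivrMr ?ltr_pdivlMr ?pow2_gt0// ![x ord0 i * _]mulrC cellixE.
  rewrite -[1]/(1%:~R) -intrD; split=> [H|<-]; first exact: floor_def.
  by rewrite floor_itv.
apply/seteqP; split => x; rewrite /hcell/=; first by move=> H i; apply/aux; rewrite H.
by move=> H; apply: row_ext => i; apply/aux.
Qed.

Lemma measurable_forall (B : 'I_n -> set R) :
  (forall i, measurable (B i)) -> measurable [set x : E | forall i, B i (x ord0 i)].
Proof.
move=> mB.
rewrite (_ : [set _ | _] = \big[setI/setT]_(i < n) [set x : E | B i (x ord0 i)]).
  apply: bigsetI_measurable => i _; rewrite -[X in measurable X]setTI.
  exact: (@measurable_coord R n i measurableT (B i) (mB i)).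
by apply/seteqP; split => x /=; rewrite -bigcap_seq => xB i //=;
  apply: (xB i); rewrite /= mem_index_enum.
Qed.

Lemma measurable_hcell j k : measurable (hcell j k).
Proof. rewrite hcellE; apply: (@measurable_forall (fun i => side j (k ord0 i))) => i; exact: measurable_itv. Qed.

Definition cell_vol j : R := (2 ^ (- j)) ^+ n.

Lemma cell_vol_gt0 j : 0 < cell_vol j. Proof. by rewrite exprn_gt0// pow2_gt0. Qed.

Lemma mu_hcell j k : mu (hcell j k) = (cell_vol j)%:E.
Proof.
rewrite hcellE (@lebesgue_rV_box _ _ (fun i => side j (k ord0 i))); last by move=> i; exact: measurable_itv.
rewrite (eq_bigr (fun=> (2 ^ (- j))%:E)) => [|i _]; last first.
  rewrite lebesgue_measure_itv/= lte_fin ltr_pM2l ?pow2_gt0// ltrDl ltr01.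
  by rewrite -EFinD mulrDr mulr1 [X in X%:E]addrC addKr.
by rewrite prodEFin prodr_const card_ord.
Qed.

Lemma measurable_comp_cellix j d (T : measurableType d) (F : Zn -> T) :
  measurable_fun setT (F \o cellix j).
Proof.
move=> _ A mA; rewrite setTI.
rewrite (_ : _ @^-1` _ = \bigcup_(k in [set k | A (F k)]) hcell j k).
  rewrite bigcup_mkcond; apply: countable_bigcupT_measurable => [|k]; first exact: countableP.
  by case: ifP => // _; exact: measurable_hcell.
apply/seteqP; split => x /=; first by move=> h; exists (cellix j x).
by case=> k /= h; rewrite /hcell/= => ->.
Qed.

Lemma hcell_triv j (D : set Zn) : trivIset D (hcell j).
Proof. by move=> k k' _ _ [x []]; rewrite /hcell/= => ->. Qed.

Definition region j (S : seq Zn) : set E := [set x | cellix j x \in S].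

Lemma regionE j S : region j S = \big[setU/set0]_(k <- S) hcell j k.
Proof.
rewrite -bigcup_seq; apply/seteqP; split => x; rewrite /region/=.
  by move=> h; exists (cellix j x).
by case=> k /= h; rewrite /hcell/= => ->.
Qed.

Lemma measurable_region j S : measurable (region j S).
Proof. by rewrite regionE; apply: bigsetU_measurable => k _; exact: measurable_hcell. Qed.

Lemma region_cells j e q : region j (cells e q) = hcell (j - e%:Z) q.
Proof.
by apply/seteqP; split => x; rewrite /region/= mem_cells_cellix => /eqP.
Qed.

Lemma ge0_integral_region j S (f : E -> \bar R) : uniq S ->
  measurable_fun setT f -> (forall x, (0 <= f x)%E) ->
  (\int[mu]_(x in region j S) f x = \sum_(k <- S) \int[mu]_(x in hcell j k) f x)%E.
Proof.
move=> uS mf f0; rewrite regionE ge0_integral_bigsetU//.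
- by move=> k; exact: measurable_hcell.
- exact: hcell_triv.
- exact: measurable_funTS.
Qed.

Lemma integrable_region j S (f : E -> R) : uniq S -> measurable_fun setT f ->
  (forall k, k \in S -> mu.-integrable (hcell j k) (EFin \o f)) ->
  mu.-integrable (region j S) (EFin \o f).
Proof.
move=> uS mf fS; apply/integrableP; split.
  by apply: measurable_funTS; exact/measurable_EFinP.
rewrite ge0_integral_region//; last by do 2 apply: measurableT_comp => //.
rewrite big_seq; apply: lte_sum_pinfty => k kS.
by have /integrableP[] := fS k kS.
Qed.

Lemma Rintegral_region j S (f : E -> R) : uniq S -> measurable_fun setT f ->
  (forall k, k \in S -> mu.-integrable (hcell j k) (EFin \o f)) ->
  \int[mu]_(x in region j S) f x = \sum_(k <- S) \int[mu]_(x in hcell j k) f x.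
Proof.
move=> uS mf fS; rewrite /Rintegral regionE integral_bigsetU_EFin//; last first.
- by apply: measurable_funTS; exact/measurable_EFinP.
- exact: hcell_triv.
- by move=> k; exact: measurable_hcell.
rewrite big_seq [RHS]big_seq sum_fine// => k kS.
by apply: integrable_fin_num; [exact: measurable_hcell|exact: fS].
Qed.

End dyadic.

(** * Locally integrable functions and test functions *)

Section function_classes.
Variables (R : realType) (n : nat).
Local Notation E := 'rV[R]_n.
Local Notation Zn := 'rV[int]_n.
Local Notation mu := (@lebesgue_rV R n).
Implicit Types (x y : E) (k q : Zn) (j : int) (u v g h : E -> R).

Definition box (r : nat) : set E := [set x | forall i, `|x ord0 i| <= r%:R].

Lemma box_region j r : exists2 S : seq Zn, uniq S & box r `<=` region j S.
Proof.
pose s := (`|Num.floor (2 ^ j * r%:R : R)| + 2)%N.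
exists (nbh s 0 (0 : Zn)); first exact: uniq_nbh.
move=> x bxr; rewrite /region/= mem_nbh; apply/forallP => i.
rewrite anc0 [X in _ - X]mxE subr0.
have /andP[h1 h2] := cellix_itv j x i.
have := bxr i; rewrite ler_norml => /andP[h3 h4].
have p := pow2_gt0 R j.
have /andP[h5 h6] := floor_itv (2 ^ j * r%:R : R).
move: h1 h2 h6; set k := cellix j x ord0 i; set f := Num.floor _ => h1 h2 h6.
have h7 : 2 ^ j * x ord0 i <= 2 ^ j * r%:R by rewrite ler_pM2l.
have h8 : - (2 ^ j * r%:R) <= 2 ^ j * x ord0 i by rewrite -mulrN ler_pM2l.
have a1 : k < f + 1.
  by rewrite -(ltr_int R); apply: le_lt_trans h1 _; apply: le_lt_trans h7 h6.
have a2 : - k < f + 2.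
  rewrite -(ltr_int R) rmorphN rmorphD /=; rewrite rmorphD /= in h6.
  move: h2 h6 h8; rewrite -[2%:~R]/(2 : R) -[1%:~R]/(1 : R); lra.
by rewrite /s -/f; lia.
Qed.

Lemma measurable_box r : measurable (box r).
Proof.
rewrite (_ : box r = [set x | forall i, [set` `[- r%:R, r%:R]%R] (x ord0 i)]).
  by apply: (@measurable_forall R n (fun=> [set` `[- r%:R, r%:R]%R])) => i.
by apply/seteqP; split => x H i; have := H i; rewrite /= in_itv/= ler_norml.
Qed.

Lemma box_sub r r' : (r <= r')%N -> box r `<=` box r'.
Proof. by move=> rr x H i; apply: le_trans (H i) _; rewrite ler_nat. Qed.

Lemma box_exists x : exists r, box r x.
Proof.
exists (\sum_(i < n) (Num.truncn `|x ord0 i|).+1)%N => i.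
apply: (@le_trans _ _ ((Num.truncn `|x ord0 i|).+1%:R)).
  by apply/ltW; exact: truncnS_gt.
by rewrite ler_nat (bigD1 i)//= leq_addr.
Qed.

(** Integrability on dyadic cells, rather than on compact sets, is what sums over cells use. *)
Definition locint u := measurable_fun setT u /\
  forall j k, mu.-integrable (hcell j k) (EFin \o u).

(** The functions that can be paired with every locally integrable function. *)
Definition test_fun g := measurable_fun setT g /\
  exists B r, [/\ 0 <= B, (forall x, `|g x| <= B) &
    forall x, g x != 0 -> box r x].

Lemma test_fun_mea g : test_fun g -> measurable_fun setT g. Proof. by case. Qed.

Lemma locint_region u j (S : seq Zn) : uniq S -> locint u ->
  mu.-integrable (region j S) (EFin \o u).
Proof. by move=> uS [mu_ iu]; apply: integrable_region. Qed.

Lemma integrable_supp (f : E -> R) (A : set E) : measurable A ->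
  (forall x, f x != 0 -> A x) -> mu.-integrable A (EFin \o f) ->
  mu.-integrable setT (EFin \o f).
Proof.
move=> mA fA iA; move: iA; rewrite integrable_mkcond//.
apply: eq_integrable => // x _; rewrite /patch; case: ifPn => //= xA.
apply/eqP; rewrite eq_sym eqe; apply: contraNT xA => /fA; by rewrite inE.
Qed.

Lemma Rintegral_supp (f : E -> R) (A : set E) : measurable A ->
  (forall x, f x != 0 -> A x) -> \int[mu]_x f x = \int[mu]_(x in A) f x.
Proof.
move=> mA fA; rewrite [RHS]Rintegral_mkcond; apply: eq_Rintegral => x _.
rewrite /patch; case: ifPn => // xA.
by apply/eqP; apply: contraNT xA => /fA; rewrite inE.
Qed.

Lemma integral_supp (f : E -> \bar R) (A : set E) : measurable A ->
  (forall x, f x != 0%E -> A x) -> (\int[mu]_x f x = \int[mu]_(x in A) f x)%E.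
Proof.
move=> mA fA; rewrite [RHS]integral_mkcond; apply: eq_integral => x _.
rewrite /patch; case: ifPn => // xA.
by apply/eqP; apply: contraNT xA => /fA; rewrite inE.
Qed.

Lemma integrable_bounded_mul (A : set E) u g B : measurable A -> measurable_fun setT g ->
  (forall x, `|g x| <= B) -> mu.-integrable A (EFin \o u) ->
  mu.-integrable A (EFin \o (fun x => u x * g x)).
Proof.
move=> mA mg gB iu.
have mu_ : measurable_fun A (EFin \o u) by case/integrableP : iu.
have B0 : 0 <= B by apply: le_trans (gB 0).
apply: (@le_integrable _ _ _ _ _ _ _ (fun x => B%:E * (u x)%:E)%E) => //.
- apply/measurable_EFinP/measurable_funM; first exact/measurable_EFinP.
  exact: measurable_funTS.
- move=> x _ /=; rewrite lee_fin !normrM mulrC ler_wpM2r//.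
  by rewrite (ger0_norm B0) gB.
- exact: integrableZl.
Qed.

Lemma integrableM u g : locint u -> test_fun g ->
  mu.-integrable setT (EFin \o (fun x => u x * g x)).
Proof.
move=> lu [mg [B [r [B0 gB gr]]]].
have [S uS rS] := box_region 0 r.
apply: (@integrable_supp _ (region 0 S)) => //.
- exact: measurable_region.
- by move=> x; rewrite mulf_eq0 negb_or => /andP[_ /gr /rS].
- apply: integrable_bounded_mul gB _ => //; first exact: measurable_region.
  exact: locint_region.
Qed.

Lemma locint_cst c : locint (cst c).
Proof.
split => // j k; apply/integrableP; split.
  by apply/measurable_EFinP; exact: measurable_cst.
rewrite (_ : (\int[mu]_(x in hcell j k) _)%E = (\int[mu]_(x in hcell j k) (`|c|)%:E)%E)//.
rewrite integral_cst; last exact: measurable_hcell.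
by rewrite [X in (_ * X)%E]mu_hcell -EFinM ltry.
Qed.

Lemma locintM_bounded u g B : locint u -> measurable_fun setT g ->
  (forall x, `|g x| <= B) -> locint (fun x => u x * g x).
Proof.
move=> [mu_ iu] mg gB; split; first exact: measurable_funM.
by move=> j k; apply: integrable_bounded_mul gB _ => //; exact: measurable_hcell.
Qed.

Lemma test_fun_locint g : test_fun g -> locint g.
Proof.
move=> [mg [B [r [B0 gB gr]]]].
have := locintM_bounded (locint_cst 1) mg gB.
by rewrite (_ : (fun _ => _) = g)//; apply/funext => x; rewrite mul1r.
Qed.

Lemma locint_norm u : locint u -> locint (fun x => `|u x|).
Proof.
move=> [m i]; split; first exact: measurableT_comp.
by move=> j k; have := integrable_abse (i j k).
Qed.

Lemma locintD u v : locint u -> locint v -> locint (fun x => u x + v x).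
Proof.
move=> [m i] [m' i']; split; first exact: measurable_funD.
move=> j k; have := integrableD _ (i j k) (i' j k).
by apply; exact: measurable_hcell.
Qed.

Lemma locintZ c u : locint u -> locint (fun x => c * u x).
Proof.
move=> [m i]; split; first exact: measurable_funM.
move=> j k; have := integrableZl _ c (i j k); apply; exact: measurable_hcell.
Qed.

Lemma test_funM g h : test_fun g -> test_fun h -> test_fun (fun x => g x * h x).
Proof.
move=> [mg [B [r [B0 gB gr]]]] [mh [C [r' [C0 hC hr]]]].
split; first exact: measurable_funM.
exists (B * C), r; split; first exact: mulr_ge0.
  by move=> x; rewrite normrM ler_pM.
by move=> x; rewrite mulf_eq0 negb_or => /andP[/gr].
Qed.

Lemma test_funD g h : test_fun g -> test_fun h -> test_fun (fun x => g x + h x).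
Proof.
move=> [mg [B [r [B0 gB gr]]]] [mh [C [r' [C0 hC hr]]]].
split; first exact: measurable_funD.
exists (B + C), (maxn r r'); split; first exact: addr_ge0.
  by move=> x; apply: le_trans (ler_normD _ _) _; rewrite lerD.
move=> x; have [g0|/gr gx _] := eqVneq (g x) 0.
  by rewrite g0 add0r => /hr; apply: box_sub; exact: leq_maxr.
by apply: box_sub gx; exact: leq_maxl.
Qed.

Lemma test_funZ c g : test_fun g -> test_fun (fun x => c * g x).
Proof.
move=> [mg [B [r [B0 gB gr]]]].
split; first exact: measurable_funM.
exists (`|c| * B), r; split; first exact: mulr_ge0.
  by move=> x; rewrite normrM ler_wpM2l.
by move=> x; rewrite mulf_eq0 negb_or => /andP[_ /gr].
Qed.

Lemma test_fun0 : test_fun (fun=> 0).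
Proof. by split; [exact: measurable_cst|exists 0, 0%N; split => // x; rewrite ?normr0 ?eqxx]. Qed.

Lemma test_funB g h : test_fun g -> test_fun h -> test_fun (fun x => g x - h x).
Proof.
move=> bg bh; have := test_funD bg (test_funZ (-1) bh).
by congr test_fun; apply/funext => x; rewrite mulN1r.
Qed.

Lemma test_fun_norm g : test_fun g -> test_fun (fun x => `|g x|).
Proof.
move=> [mg [B [r [B0 gB gr]]]]; split; first exact: measurableT_comp.
by exists B, r; split => // x; rewrite ?normr_id// normr_eq0 => /gr.
Qed.

Lemma test_fun_sum (T : Type) (s : seq T) (F : T -> E -> R) :
  (forall t, test_fun (F t)) -> test_fun (fun x => \sum_(t <- s) F t x).
Proof.
move=> bF; elim: s => [|t s IH].
  by rewrite (_ : (fun _ => _) = fun=> 0); [exact: test_fun0|apply/funext => x; rewrite big_nil].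
have := test_funD (bF t) IH.
by congr test_fun; apply/funext => x; rewrite big_cons.
Qed.

Definition ip u g : R := \int[mu]_x (u x * g x).

Lemma ipDr u g h : locint u -> test_fun g -> test_fun h ->
  ip u (fun x => g x + h x) = ip u g + ip u h.
Proof.
move=> lu bg bh; rewrite /ip -RintegralD//; try exact: integrableM.
by apply: eq_Rintegral => x _; rewrite mulrDr.
Qed.

Lemma ipZr u g c : locint u -> test_fun g -> ip u (fun x => c * g x) = c * ip u g.
Proof.
move=> lu bg; rewrite /ip -RintegralZl//; try exact: integrableM.
by apply: eq_Rintegral => x _; rewrite mulrCA.
Qed.

Lemma ipBr u g h : locint u -> test_fun g -> test_fun h ->
  ip u (fun x => g x - h x) = ip u g - ip u h.
Proof.
move=> lu bg bh; rewrite /ip -RintegralB//; try exact: integrableM.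
by apply: eq_Rintegral => x _; rewrite mulrBr.
Qed.

Lemma ip0r u : ip u (fun=> 0) = 0.
Proof.
rewrite /ip (_ : (fun _ => _) = cst 0) ?Rintegral_cst ?mul0r//.
by apply/funext => x; rewrite mulr0.
Qed.

Lemma ip_sumr (T : Type) (s : seq T) u (F : T -> E -> R) : locint u ->
  (forall t, test_fun (F t)) ->
  ip u (fun x => \sum_(t <- s) F t x) = \sum_(t <- s) ip u (F t).
Proof.
move=> lu bF; elim: s => [|t s IH].
  by rewrite big_nil -[RHS](ip0r u); congr ip; apply/funext => x; rewrite big_nil.
rewrite big_cons -IH -ipDr//; last exact: test_fun_sum.
by congr ip; apply/funext => x; rewrite big_cons.
Qed.

Lemma ipC g h : ip g h = ip h g.
Proof. by apply: eq_Rintegral => x _; rewrite mulrC. Qed.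

Lemma ipDl u v g : locint u -> locint v -> test_fun g ->
  ip (fun x => u x + v x) g = ip u g + ip v g.
Proof.
move=> lu lv bg; rewrite /ip -RintegralD//; try exact: integrableM.
by apply: eq_Rintegral => x _; rewrite mulrDl.
Qed.

Lemma ipZl u g c : locint u -> test_fun g -> ip (fun x => c * u x) g = c * ip u g.
Proof.
move=> lu bg; rewrite /ip -RintegralZl//; try exact: integrableM.
by apply: eq_Rintegral => x _; rewrite mulrA.
Qed.

Lemma ip_ge0 g : 0 <= ip g g.
Proof. by apply: Rintegral_ge0 => x _; rewrite -expr2 sqr_ge0. Qed.

Lemma ipE u g : locint u -> test_fun g -> ((ip u g)%:E = \int[mu]_x (u x * g x)%:E)%E.
Proof.
by move=> lu bg; rewrite /ip /Rintegral fineK//; apply: integrable_fin_num => //; exact: integrableM.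
Qed.

Lemma ip_abs u g : locint u -> test_fun g -> `|ip u g| <= ip (fun x => `|u x|) (fun x => `|g x|).
Proof.
move=> lu bg; apply: le_trans (le_normr_Rintegral _ _) _ => //; first exact: integrableM.
by apply/eq_ler/eq_Rintegral => x _; rewrite normrM.
Qed.

(** The Cauchy-Schwarz inequality, in the form that is used to choose the weight e. *)
Lemma ip_CS g h (e : R) : 0 < e -> test_fun g -> test_fun h ->
  2 * `|ip g h| <= e * ip g g + e^-1 * ip h h.
Proof.
move=> e0 bg bh.
have lg := test_fun_locint bg; have lh := test_fun_locint bh.
have H (c : R) : 0 <= e * ip g g + 2 * c * ip g h + c ^+ 2 * (e^-1 * ip h h).
  have b : test_fun (fun x => e * g x + c * h x) by apply: test_funD; exact: test_funZ.
  have := ip_ge0 (fun x => e * g x + c * h x).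
  rewrite ipDr; [|exact: test_fun_locint|exact: test_funZ|exact: test_funZ].
  rewrite !ipDl; try exact: test_funZ; try (by apply: locintZ).
  rewrite !ipZl; try exact: test_funZ; try (by apply: locintZ); try exact: test_fun_locint.
  rewrite !ipZr// [ip h g]ipC => H.
  have : 0 <= e^-1 * (e * (e * ip g g) + c * (e * ip g h) + (e * (c * ip g h) + c * (c * ip h h))).
    by rewrite mulr_ge0 ?invr_ge0 ?(ltW e0)//.
  rewrite (_ : e^-1 * _ = e * ip g g + 2 * c * ip g h + c ^+ 2 * (e^-1 * ip h h))//.
  by field; exact: lt0r_neq0.
have := H 1; have := H (-1); rewrite expr1n sqrrN expr1n !mul1r.
by case: (ger0P (ip g h)) => s; lra.
Qed.

End function_classes.

(** * Lipschitz bounds for continuously differentiable functions of bounded support *)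

Section lipschitz.
Variables (R : realType) (n : nat).
Local Notation E := 'rV[R]_n.
Implicit Types (x y z : E) (f : E -> R).
Local Notation e_ i := (delta_mx ord0 i : E).

Lemma compact_box r : compact (@box R n r).
Proof.
rewrite (_ : box r = [set v : E | forall i, [set` `[- r%:R, r%:R]%R] (v ord0 i)]).
  by apply: (@rV_compact R n (fun=> [set` `[- r%:R, r%:R]%R])) => i; exact: segment_compact.
by apply/seteqP; split => x H i; have := H i; rewrite /= in_itv/= ler_norml.
Qed.

Lemma continuous_bounded_box f r : continuous f ->
  exists2 M, 0 <= M & forall x, box r x -> `|f x| <= M.
Proof.
move=> cf.
have box0 : @box R n r !=set0 by exists 0 => i; rewrite mxE normr0.
have [|c cr H] := @EVT_max_rV R n (fun x => `|f x|) (box r) box0 (compact_box (r := r)).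
  apply: continuous_subspaceT => x.
  by apply: (@continuous_comp _ _ _ f Num.norm); [exact: cf|exact: norm_continuous].
by exists `|f c| => // x xr; apply: H; rewrite inE.
Qed.

Lemma is_derive_line f z i s : derivable f (z + s *: e_ i) (e_ i) ->
  is_derive s 1 (fun t => f (z + t *: e_ i)) ('D_(e_ i) f (z + s *: e_ i)).
Proof.
move=> df.
have E : (fun h : R => h^-1 *: (((fun t => f (z + t *: e_ i)) \o shift s) (h *: (1 : R)) - f (z + s *: e_ i)))
   = (fun h => h^-1 *: ((f \o shift (z + s *: e_ i)) (h *: e_ i) - f (z + s *: e_ i))).
  apply/funext => h /=; congr (_ *: (f _ - _)).
  by rewrite -[h *: 1]/(h * 1) mulr1 scalerDl addrCA.
apply: DeriveDef.
  by rewrite /derivable E.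
by rewrite /derive E.
Qed.

Lemma derive_line_bound f z i M t : (forall x, derivable f x (e_ i)) ->
  (forall x, `|'D_(e_ i) f x| <= M) -> 0 <= t ->
  `|f (z + t *: e_ i) - f z| <= M * t.
Proof.
move=> df fM; rewrite le_eqVlt => /orP[/eqP <-|t0].
  by rewrite scale0r addr0 subrr normr0 mulr0.
pose g (s : R) := f (z + s *: e_ i).
have dg (s : R) : is_derive s 1 g ('D_(e_ i) f (z + s *: e_ i)) by exact: is_derive_line.
have [|c _] := @MVT R g (fun s => 'D_(e_ i) f (z + s *: e_ i)) 0 t t0 (fun s _ => dg s).
  by apply: derivable_within_continuous => s _; have [] := dg s.
rewrite /g scale0r addr0 subr0 => ->.
by rewrite normrM ler_pM// gtr0_norm.
Qed.

Lemma derive_zero f i x r : (forall y, f y != 0 -> box r y) -> ~ box r x ->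
  'D_(e_ i) f x = 0.
Proof.
move=> fr xr; rewrite -(@derive_cst R E R 0 x (e_ i)).
apply: near_eq_derive.
have : open (~` @box R n r).
  rewrite openC; apply: compact_closed; [exact: norm_hausdorff|exact: compact_box].
rewrite openE => /(_ x xr); apply: filterS => y yr.
by apply/eqP; apply/negPn/negP => /fr.
Qed.

(** One moves along the coordinate axes, one at a time; the partial derivatives are bounded
    because they are continuous and vanish outside a box. *)
Lemma lip_of_C1 K f r : class_C K.+1 f -> (forall y, f y != 0 -> box r y) ->
  exists2 L, 0 <= L & forall x y (d : R), 0 <= d ->
    (forall i, `|x ord0 i - y ord0 i| <= d) -> `|f x - f y| <= L * d.
Proof.
move=> /= [cf C1] fr.
have Mi i : exists M, 0 <= M /\ forall x, `|'D_(e_ i) f x| <= M.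
  have [_ Ci] := C1 i.
  have ci : continuous (fun x => 'D_(e_ i) f x) by case: K C1 Ci => [|K] C1 [].
  have [M M0 H] := continuous_bounded_box r ci; exists M; split => // x.
  have [xr|xr] := pselect (box r x); first exact: H.
  by rewrite (derive_zero _ fr xr) normr0.
pose M i := projT1 (cid (Mi i)).
have M0 i : 0 <= M i by rewrite /M; case: cid => ? [].
have MD i x : `|'D_(e_ i) f x| <= M i by rewrite /M; case: cid => ? [].
exists (\sum_i M i); first exact: sumr_ge0.
have step z i t : `|f (z + t *: e_ i) - f z| <= M i * `|t|.
  have di x : derivable f x (e_ i) by have [] := C1 i.
  have [t0|t0] := leP 0 t.
    by have := derive_line_bound z di (MD i) t0; rewrite (ger0_norm t0).
  rewrite (ltr0_norm t0); have := derive_line_bound (z + t *: e_ i) di (MD i) (_ : 0 <= - t).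
  rewrite oppr_ge0 ltW// => /(_ isT).
  by rewrite -addrA -scalerDl subrr scale0r addr0 distrC.
move=> x y d d0 xy.
pose z (k : nat) : E := \row_i (if (i < k)%N then y ord0 i else x ord0 i).
have zE (i : 'I_n) : z i.+1 = z i + (y ord0 i - x ord0 i) *: e_ i.
  apply: row_ext => j; rewrite !mxE eqxx /=.
  have [->|ji] := eqVneq j i; first by rewrite ltnSn ltnn mulr1 addrC subrK.
  by rewrite mulr0 addr0 ltnS leq_eqVlt val_eqE (negbTE ji).
have zn : z n = y by apply: row_ext => i; rewrite mxE ltn_ord.
have z0 : z 0%N = x by apply: row_ext => i; rewrite mxE ltn0.
rewrite distrC -{1}zn -{1}z0.
rewrite -(telescope_sumr (fun k => f (z k)) (leq0n n)) big_mkord mulr_suml.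
apply: le_trans (ler_norm_sum _ _ _) _; apply: ler_sum => i _.
rewrite zE; apply: le_trans (step _ _ _) _.
by rewrite ler_wpM2l// distrC.
Qed.

End lipschitz.

(** * Coefficients against rescaled Lipschitz functions *)

Section generators.
Variables (R : realType) (n : nat).
Local Notation E := 'rV[R]_n.
Local Notation Zn := 'rV[int]_n.
Local Notation mu := (@lebesgue_rV R n).
Implicit Types (x y z : E) (psi u g : E -> R) (j : int) (q k : Zn).

(** The dilate of the wavelet system without its normalising factor. *)
Definition rescaled psi j q x : R := psi (2 ^ j *: x - \row_i (q ord0 i)%:~R).

(** All that the bilinear estimate uses of a wavelet, besides the inequality of Bessel. *)
Definition lip_gen (s0 : nat) (L : R) psi :=
  [/\ 0 <= L,
      forall x y (d : R), 0 <= d ->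
        (forall i, `|x ord0 i - y ord0 i| <= d) -> `|psi x - psi y| <= L * d &
      forall y, psi y != 0 -> box s0 y].

Lemma cellix_dist j x i : `|x ord0 i - 2 ^ (- j) * (cellix j x ord0 i)%:~R| <= 2 ^ (- j).
Proof.
have /andP[h1 h2] := cellix_itv j x i; rewrite pow2N.
have p := pow2_gt0 R j.
rewrite -(ler_pM2l p) mulfV ?pow2_neq0// -{1}(gtr0_norm p) -normrM.
by rewrite mulrBr mulrA mulfV ?pow2_neq0// mul1r ger0_norm; lra.
Qed.

Lemma pow2_cvg0 : (fun m : nat => (2 : R) ^ (- m%:Z)) @ \oo --> (0 : R).
Proof.
rewrite (_ : (fun _ => _) = (fun m => 1 * (2^-1 : R) ^+ m)).
  by apply: cvg_geometric; rewrite ger0_norm// invf_lt1// ltr1n.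
by apply/funext => m; rewrite pow2N -exprnP mul1r exprVn.
Qed.

Lemma lip_gen_mea s0 L psi : lip_gen s0 L psi -> measurable_fun setT psi.
Proof.
move=> [L0 lip _].
pose h (m : nat) x := psi (2 ^ (- m%:Z) *: \row_i (cellix m%:Z x ord0 i)%:~R).
apply: (@measurable_fun_cvg _ _ _ _ h).
  move=> m; exact: (@measurable_comp_cellix R n m%:Z _ _
    (fun k => psi (2 ^ (- m%:Z) *: \row_i (k ord0 i)%:~R))).
move=> x _; apply/cvgrPdist_le => /= e e0.
have := pow2_cvg0; move/cvgrPdist_le => /(_ (e / (L + 1))).
have L1 : 0 < L + 1 by rewrite ltr_wpDl.
rewrite divr_gt0// => /(_ isT); apply: filterS => m.
rewrite sub0r normrN gtr0_norm ?pow2_gt0// => H.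
apply: le_trans (lip _ _ (2 ^ (- m%:Z)) _ _) _.
- exact/ltW/pow2_gt0.
- by move=> i; rewrite 2!mxE; exact: cellix_dist.
apply: (@le_trans _ _ ((L + 1) * (e / (L + 1)))).
  by apply: ler_pM => //; rewrite lerDl.
by rewrite mulrC mulfVK// lt0r_neq0.
Qed.

(** In positive dimension psi vanishes at a point outside the box. *)
Lemma lip_gen_bounded s0 L psi : (0 < n)%N -> lip_gen s0 L psi ->
  forall x, `|psi x| <= L * (2 * s0%:R + 1).
Proof.
move=> n0 [L0 lip sup] x.
have [->|/sup xs] := eqVneq (psi x) 0.
  by rewrite normr0 mulr_ge0// addr_ge0// mulr_ge0.
pose z : E := const_mx (s0%:R + 1).
have -> : psi x = psi x - psi z.
  suff -> : psi z = 0 by rewrite subr0.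
  apply/eqP/negPn/negP => /sup /(_ (Ordinal n0)); rewrite mxE ger0_norm ?addr_ge0//.
  by rewrite gerDl leNgt ltr01.
apply: lip; first by rewrite addr_ge0// mulr_ge0.
move=> i; rewrite mxE; have := xs i; rewrite !ler_norml; lra.
Qed.

Lemma rescaled_mea psi j q : measurable_fun setT psi -> measurable_fun setT (rescaled psi j q).
Proof.
move=> mp.
apply: (measurableT_comp mp).
apply: measurable_fun_rVP => i.
rewrite (_ : (fun _ => _) = (fun x : E => 2 ^ j * x ord0 i - (q ord0 i)%:~R)); last first.
  by apply/funext => x; rewrite !mxE.
apply: measurable_funB => //; apply: measurable_funM => //; exact: measurable_coord.
Qed.

Lemma rescaled_supp s0 L psi j q x : lip_gen s0 L psi -> rescaled psi j q x != 0 ->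
  cellix j x \in nbh s0.+1 0 q.
Proof.
move=> [_ _ sup] /sup H; rewrite mem_nbh; apply/forallP => i.
rewrite anc0; have := H i; rewrite !mxE => Hi.
have := cellix_itv j x i; rewrite -/(cellix j x ord0 i); set a := cellix j x ord0 i => /andP[h1 h2].
have -> : Num.floor (2 ^ j * x ord0 i) = a by rewrite /a cellixE.
move: Hi; rewrite ler_norml => /andP[h3 h4].
have a1 : a - q ord0 i < s0.+1%:Z.
  rewrite -(ltr_int R) rmorphB /= -[(Posz s0.+1)%:~R]/(s0.+1%:R : R) -natr1.
  lra.
have a2 : - (a - q ord0 i) < s0.+2%:Z.
  rewrite -(ltr_int R) rmorphN rmorphB /= -[(Posz s0.+2)%:~R]/(s0.+2%:R : R) -!natr1.
  lra.
by lia.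
Qed.

Lemma cellix_nbh0 j q x s : (cellix j x \in nbh s 0 q) ->
  forall i, `|2 ^ j * x ord0 i - (q ord0 i)%:~R| <= s%:R + 1.
Proof.
rewrite mem_nbh => /forallP H i; have := H i; rewrite anc0 => {}H.
have /andP[h1 h2] := cellix_itv j x i.
move: H; rewrite -(ler_int R) intr_norm rmorphB /= -[(Posz s)%:~R]/(s%:R : R).
by rewrite !ler_norml; lra.
Qed.

Lemma rescaled_test_fun s0 L psi j q : (0 < n)%N -> lip_gen s0 L psi -> test_fun (rescaled psi j q).
Proof.
move=> n0 gp; split; first exact: rescaled_mea (lip_gen_mea gp).
have [L0 lip sup] := gp.
pose M : R := 2 ^ (- j) * (\sum_i `|(q ord0 i)%:~R| + s0%:R).
exists (L * (2 * s0%:R + 1)), (Num.truncn M).+1; split.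
- by rewrite mulr_ge0// addr_ge0// mulr_ge0.
- by move=> x; apply: (lip_gen_bounded n0 gp).
move=> x /sup H i; apply: (@le_trans _ _ M); last exact/ltW/truncnS_gt.
have p := pow2_gt0 R j.
rewrite /M pow2N -(ler_pM2l p) mulrA mulfV ?pow2_neq0// mul1r.
have := H i; rewrite !mxE => {}H.
rewrite -{1}(gtr0_norm p) -normrM.
have -> : 2 ^ j * x ord0 i = (q ord0 i)%:~R + (2 ^ j * x ord0 i - (q ord0 i)%:~R).
  by rewrite addrCA subrr addr0.
apply: le_trans (ler_normD _ _) _; apply: lerD => //.
by rewrite (bigD1 i)//= lerDl sumr_ge0.
Qed.

(** The coefficient against the dilate normalised in L^2, times the height of chi: its square
    is the value on the cell of the corresponding term of the square function. *)
Definition ncoef psi u j q : R := (cell_vol R n j)^-1 * ip u (rescaled psi j q).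

Lemma cell_vol_neq0 j : cell_vol R n j != 0. Proof. exact/lt0r_neq0/cell_vol_gt0. Qed.

Lemma cell_volB j (e : nat) : cell_vol R n (j - e%:Z) = cell_vol R n j * W R n e.
Proof.
rewrite /cell_vol /W opprB addrC pow2D exprMn; congr (_ * _).
by rewrite -exprnP -!exprM mulnC.
Qed.

Lemma L2_factor_sqr j : L2_factor n j ^+ 2 = (cell_vol R n j)^-1 :> R.
Proof.
rewrite /L2_factor -powR_mulrn ?powR_ge0// -powRrM divfK// powRrM powR_intmul//.
by rewrite powR_mulrn ?ltW ?pow2_gt0// /cell_vol pow2N exprVn invrK.
Qed.

Lemma ip_dilateE psi u j q : locint u -> test_fun (rescaled psi j q) ->
  ip u (dilate psi j q) = L2_factor n j * ip u (rescaled psi j q).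
Proof. by move=> lu br; rewrite -ipZr. Qed.

Lemma ncoefE psi u j q : locint u -> test_fun (rescaled psi j q) ->
  ncoef psi u j q = L2_factor n j * ip u (dilate psi j q).
Proof.
by move=> lu br; rewrite ip_dilateE// mulrA -expr2 L2_factor_sqr.
Qed.

Lemma ncoef_sqr psi u j q : locint u -> test_fun (rescaled psi j q) ->
  cell_vol R n j * ncoef psi u j q ^+ 2 = ip u (dilate psi j q) ^+ 2.
Proof.
by move=> lu br; rewrite ncoefE// exprMn L2_factor_sqr mulrA mulfV ?cell_vol_neq0// mul1r.
Qed.

End generators.

(** * The bilinear bound over one cell *)

Section averages.
Variables (R : realType) (n : nat).
Local Notation E := 'rV[R]_n.
Local Notation Zn := 'rV[int]_n.
Local Notation mu := (@lebesgue_rV R n).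
Implicit Types (x y z : E) (psi u g : E -> R) (j : int) (q k : Zn).

Definition avg s j u x : R :=
  (cell_vol R n j)^-1 * \int[mu]_(y in region j (nbh s 0 (cellix j x))) `|u y|.

Definition cell_avg (m : int) u k : R := (cell_vol R n m)^-1 * \int[mu]_(y in hcell m k) u y.

Lemma region_nbh m (e : nat) s q :
  region m (nbh s e q) = region (m - e%:Z) (nbh s 0 q) :> set E.
Proof.
by apply/seteqP; split => x; rewrite /region/= !mem_nbh anc0 cellix_anc.
Qed.

Lemma nav_region m (e : nat) s q u : locint u ->
  nav s (cell_avg m u) e q =
  (cell_vol R n (m - e%:Z))^-1 * \int[mu]_(y in region (m - e%:Z) (nbh s 0 q)) u y.
Proof.
move=> lu; rewrite -region_nbh (Rintegral_region (uniq_nbh _ _ _) lu.1); last first.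
  by move=> k _; apply: lu.2.
by rewrite /nav /cell_avg -mulr_sumr cell_volB invfM mulrAC.
Qed.

Lemma cell_avg_ge0 m u k : (forall x, 0 <= u x) -> 0 <= cell_avg m u k.
Proof.
move=> u0; rewrite mulr_ge0 ?invr_ge0 ?(ltW (cell_vol_gt0 _ _ _))//.
by apply: Rintegral_ge0.
Qed.

Lemma cell_avg_abs m u k : locint u -> `|cell_avg m u k| <= cell_avg m (fun x => `|u x|) k.
Proof.
move=> lu; rewrite normrM (@ger0_norm _ (_^-1)) ?invr_ge0 ?(ltW (cell_vol_gt0 _ _ _))//.
rewrite ler_wpM2l ?invr_ge0 ?(ltW (cell_vol_gt0 _ _ _))//.
by apply: le_normr_Rintegral; [exact: measurable_hcell|exact: lu.2].
Qed.

Lemma cell_avg1 m k : cell_avg m (fun=> 1) k = 1.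
Proof.
rewrite /cell_avg Rintegral_cst; last exact: measurable_hcell.
by rewrite [X in fine X]mu_hcell /= mul1r mulVf// cell_vol_neq0.
Qed.

(** The value of the rescaled function at the corner of the cell of generation t and index pi. *)
Definition href psi m (e : nat) q (t : nat) (pi : Zn) : R :=
  psi (2 ^ (m - e%:Z) *: (2 ^ (- (m - t%:Z)) *: \row_i (pi ord0 i)%:~R) -
       \row_i (q ord0 i)%:~R).

Lemma rescaled_near s0 L psi m e q t x k : lip_gen s0 L psi -> hcell m k x ->
  `|rescaled psi (m - e%:Z) q x - href psi m e q t (anc t k)| <= L * (2 ^+ t / 2 ^+ e).
Proof.
move=> [L0 lip _] xk; apply: lip; first by rewrite divr_ge0 ?exprn_ge0.
move=> i; rewrite /hcell/= in xk.
rewrite -xk -cellix_anc.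
have H := cellix_dist (m - t%:Z) x i.
move: H; move: (cellix (m - t%:Z) x) => c H.
rewrite !mxE opprD addrACA subrr addr0 -mulrBr normrM gtr0_norm ?pow2_gt0//.
rewrite (_ : 2 ^+ t / 2 ^+ e = 2 ^ (m - e%:Z) * 2 ^ (- (m - t%:Z))); last first.
  rewrite -pow2D (_ : _ + _ = t%:Z - e%:Z); last by ring.
  by rewrite pow2D pow2N.
by rewrite ler_pM2l ?pow2_gt0.
Qed.

Lemma cell_avg_rescaled s0 L psi m e q t u k : (0 < n)%N -> lip_gen s0 L psi -> locint u ->
  `|cell_avg m (fun x => u x * rescaled psi (m - e%:Z) q x) k
    - cell_avg m u k * href psi m e q t (anc t k)|
  <= L * cell_avg m (fun x => `|u x|) k * (2 ^+ t / 2 ^+ e).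
Proof.
move=> n0 gp lu; set h := href _ _ _ _ _ _; set r := rescaled _ _ _.
have mh := @measurable_hcell R n m k.
have [mr [B [_ [_ rB _]]]] : test_fun r by exact: rescaled_test_fun gp.
have i1 : mu.-integrable (hcell m k) (EFin \o (fun x => u x * r x)).
  by apply: integrable_bounded_mul rB _ => //; exact: lu.2.
have i2 : mu.-integrable (hcell m k) (EFin \o (fun x => u x * h)).
  by apply: (@integrable_bounded_mul _ _ _ _ (fun=> h) `|h|) => //; exact: lu.2.
have i3 : mu.-integrable (hcell m k) (EFin \o (fun x => `|u x|)).
  exact: (locint_norm lu).2.
rewrite /cell_avg -!mulrA [X in _ - _ * X]mulrC -(RintegralZl _ mh (lu.2 m k)).
have -> : \int[mu]_(x in hcell m k) (h * u x) = \int[mu]_(x in hcell m k) (u x * h).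
  by apply: eq_Rintegral => x _; rewrite mulrC.
rewrite -mulrBr -RintegralB// normrM (@ger0_norm _ (_^-1)) ?invr_ge0 ?(ltW (cell_vol_gt0 _ _ _))//.
rewrite mulrCA ler_wpM2l ?invr_ge0 ?(ltW (cell_vol_gt0 _ _ _))//.
have i4 : mu.-integrable (hcell m k) (EFin \o (fun x => u x * r x - u x * h)).
  by have := integrableB mh i1 i2.
apply: le_trans (le_normr_Rintegral mh i4) _.
set rr : R := 2 ^+ t / 2 ^+ e.
have i5 : mu.-integrable (hcell m k) (EFin \o (fun x => `|u x| * (L * rr))).
  by have := integrableZr mh (L * rr) i3.
apply: (@le_trans _ _ (\int[mu]_(x in hcell m k) (`|u x| * (L * rr)))); last first.
  by rewrite (RintegralZr _ mh i3); apply/eq_ler; ring.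
apply: le_Rintegral => //; first by have := integrable_abse i4.
move=> x xk; rewrite -mulrBr normrM ler_wpM2l//.
by apply: rescaled_near gp xk.
Qed.

End averages.

Section cell_estimate.
Variables (R : realType) (n : nat).
Local Notation E := 'rV[R]_n.
Local Notation Zn := 'rV[int]_n.
Local Notation mu := (@lebesgue_rV R n).
Local Notation cell_vol := (cell_vol R n).
Local Notation W := (W R n).
Implicit Types (x y z : E) (j : int) (q k : Zn).
Variables (s0 : nat) (L : R) (psi : E -> R) (J : int).
Hypothesis n0 : (0 < n)%N.
Hypothesis gp : lip_gen s0 L psi.
Let s := s0.+1.

Definition bessel_from := forall v, test_fun v -> forall S : seq (nat * Zn), uniq S ->
  \sum_(a <- S) cell_vol (J + a.1%:Z) * ncoef psi v (J + a.1%:Z) a.2 ^+ 2 <= ip v v.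

Hypothesis HB : bessel_from.

Lemma ncoef_nav m (e : nat) q u : locint u ->
  ncoef psi u (m - e%:Z) q =
  nav s (cell_avg m (fun x => u x * rescaled psi (m - e%:Z) q x)) e q.
Proof.
move=> lu; have br := rescaled_test_fun (m - e%:Z) q n0 gp.
have [mr [B [_ [_ rB _]]]] := br.
rewrite nav_region; last exact: locintM_bounded rB.
rewrite /ncoef /ip; congr (_ * _); apply: Rintegral_supp; first exact: measurable_region.
move=> x; rewrite mulf_eq0 negb_or => /andP[_ xr].
exact: rescaled_supp gp xr.
Qed.

Section fixed_levels.
Variables (p0 D : nat).
Let m := J + (p0 + D)%N%:Z.

Let level (e : nat) : (e <= D)%N -> m - e%:Z = J + (p0 + (D - e))%N%:Z.
Proof. by move=> eD; rewrite /m; lia. Qed.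

Let r e q k := cell_avg m (rescaled psi (m - e%:Z) q : E -> R) k.

(** The inequality of Bessel for the step function with value c on the finest cells of the
    neighbourhood: its coefficients are the discrete neighbourhood averages of c r. *)
Lemma discrete_bessel (c : Zn -> R) d q : (d <= D)%N ->
  \sum_(1 <= e < d.+1) \sum_(q' <- cells (d - e) q)
    W e * (nav s (fun k => c k * r e q' k) e q') ^+ 2
  <= \sum_(k <- nbh s d q) c k ^+ 2.
Proof.
move=> dD.
pose v x := if cellix m x \in nbh s d q then c (cellix m x) else 0.
have mv : measurable_fun setT v.
  exact: (@measurable_comp_cellix R n m _ _ (fun k => if k \in nbh s d q then c k else 0)).
have lu1 := @locint_cst R n 1.
pose B := \sum_(k <- nbh s d q) `|c k|.
have vB x : `|v x| <= B.
  rewrite /v; case: ifP => [xn|_]; last by rewrite normr0 sumr_ge0.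
  by rewrite /B (bigD1_seq _ xn) ?uniq_nbh//= lerDl sumr_ge0.
have [r' r'P] : exists r', forall x, cellix m x \in nbh s d q -> box r' x.
  exists (\sum_(k <- nbh s d q) (\sum_(i < n)
    (Num.truncn (2 ^ (- m) * `|(k ord0 i)%:~R| + 2 ^ (- m) : R)).+1))%N => x xn i.
  apply: (@le_trans _ _ (2 ^ (- m) * `|(cellix m x ord0 i)%:~R| + 2 ^ (- m))).
    rewrite -[X in `|X|](subrK (2 ^ (- m) * (cellix m x ord0 i)%:~R)).
    apply: le_trans (ler_normD _ _) _; rewrite addrC; apply: lerD; last exact: cellix_dist.
    by rewrite normrM gtr0_norm ?pow2_gt0.
  apply: le_trans (ltW (truncnS_gt _)) _.
  by rewrite ler_nat (bigD1_seq _ xn) ?uniq_nbh//= (bigD1 i)//= -addnA leq_addr.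
have bv : test_fun v.
  split => //; exists B, r'; split => //; first exact: sumr_ge0.
  by move=> x; rewrite /v; case: ifP => [/r'P//|]; rewrite eqxx.
have vE (e : nat) q' : q' \in cells (d - e) q -> (e <= d)%N ->
    ncoef psi v (m - e%:Z) q' = nav s (fun k => c k * r e q' k) e q'.
  move=> q'q ed; rewrite ncoef_nav; last exact: test_fun_locint.
  rewrite /nav; congr (_ / _); rewrite big_seq [RHS]big_seq; apply: eq_bigr => k kn.
  rewrite /r /cell_avg mulrCA; congr (_ * _).
  have [mr [C [_ [_ rC _]]]] := rescaled_test_fun (m - e%:Z) q' n0 gp.
  rewrite -RintegralZl; [|exact: measurable_hcell|]; last first.
    exact: (test_fun_locint (rescaled_test_fun _ _ n0 gp)).2.
  apply: eq_Rintegral => x; rewrite inE /hcell/= => xk; congr (_ * _).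
  rewrite /v xk ifT//.
  have <- : anc (d - e) q' = q by apply/eqP; rewrite -mem_cells.
  pose q2 : Zn := \row_i (2 ^+ e * q' ord0 i).
  have q2E : anc e q2 = q'.
    by apply: row_ext => i; rewrite !mxE mulrC mulzK// expf_neq0.
  by rewrite -q2E ancD subnK//; apply: nbhW ed _; rewrite q2E.
have ipv : ip v v = cell_vol m * \sum_(k <- nbh s d q) c k ^+ 2.
  rewrite /ip (@Rintegral_supp _ _ _ (region m (nbh s d q))); last 2 first.
  - exact: measurable_region.
  - by move=> x; rewrite /v /region/=; case: ifP => //; rewrite mul0r eqxx.
  rewrite Rintegral_region ?uniq_nbh//; last 2 first.
  - exact: measurable_funM.
  - by move=> k _; apply: (test_fun_locint (test_funM bv bv)).2.
  rewrite mulr_sumr big_seq [RHS]big_seq; apply: eq_bigr => k kn.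
  transitivity (\int[mu]_(x in hcell m k) (c k ^+ 2)).
    by apply: eq_Rintegral => x; rewrite inE /hcell/= => xk; rewrite /v xk kn expr2.
  rewrite Rintegral_cst; last exact: measurable_hcell.
  by rewrite [X in fine X]mu_hcell /= mulrC.
rewrite -(ler_pM2l (cell_vol_gt0 R n m)) -ipv.
pose S := [seq ((p0 + (D - e))%N, q') | e <- index_iota 1 d.+1, q' <- cells (d - e) q].
have uS : uniq S.
  apply: allpairs_uniq_dep; first exact: iota_uniq.
    by move=> e _; exact: uniq_cells.
  move=> [e1 q1] [e2 q2] /allpairsPdep[x1 [y1 [x1i y1i ->]]] /allpairsPdep[x2 [y2 [x2i y2i ->]]] /=.
  move: x1i x2i; rewrite !mem_index_iota => x1i x2i [E1 ->].
  by congr (existT _ _ _); lia.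
apply: le_trans (HB bv uS).
rewrite big_allpairs_dep /= mulr_sumr; apply/eq_ler.
apply: eq_big_nat => e /andP[e0 ed]; rewrite mulr_sumr big_seq [RHS]big_seq.
apply: eq_bigr => q' q'q.
have eD : (e <= D)%N by rewrite (leq_trans _ dD).
by rewrite -(level eD) -vE// mulrA cell_volB.
Qed.

Variable u : E -> R.
Hypothesis lu : locint u.

Let U := cell_avg m (fun x => `|u x|).
Let p e q := cell_avg m (fun x => u x * rescaled psi (m - e%:Z) q x).

Let U_ge0 k : 0 <= U k. Proof. by apply: cell_avg_ge0. Qed.

(** Here the finest cells have generation 0 and correspond to the level m; the Lipschitz
    continuity of psi provides the reference values. *)
Lemma local_cell_estimate d q lam : (d <= D)%N -> 0 < lam -> nav s U d q <= lam ->
  \sum_(k <- cells d q)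
     Num.sqrt (\sum_(1 <= e < d.+1 | calm s U lam d e k) al s p e (anc e k) ^+ 2)
  <= Cloc n s L * lam * W d.
Proof.
move=> dD lam0 Al; have [L0 _ _] := gp.
apply: (@local_estimate R n s U U_ge0 L (cell_avg m u) p r (href psi m) D) => //.
- by move=> k; exact: (cell_avg_abs m k lu).
- by move=> e q' k t _; exact: (cell_avg_rescaled _ _ _ _ _ n0 gp lu).
- move=> e q' k t _.
  have := cell_avg_rescaled m e q' t k n0 gp (locint_cst n 1).
  rewrite cell_avg1 mul1r (_ : (fun _ : E => `|_|) = fun=> 1) ?cell_avg1 ?mulr1; last first.
    by apply/funext => x; rewrite normr1.
  rewrite /r (_ : (fun x => cst 1 x * _) = rescaled psi (m - e%:Z) q')//.
  by apply/funext => x; rewrite mul1r.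
- exact: discrete_bessel.
Qed.

Definition sqfun_trunc x : R :=
  Num.sqrt (\sum_(i < D) ncoef psi u (J + (p0 + i)%N%:Z) (cellix (J + (p0 + i)%N%:Z) x) ^+ 2).

Lemma sqfun_truncE x : sqfun_trunc x = Tsq (al s p) D (cellix m x).
Proof.
rewrite /sqfun_trunc /Tsq; congr Num.sqrt.
rewrite big_add1 /= -(big_mkord xpredT (fun i => ncoef psi u (J + (p0 + i)%N%:Z)
  (cellix (J + (p0 + i)%N%:Z) x) ^+ 2)) big_nat_rev /=.
by apply: eq_big_nat => i /andP[_ iD]; rewrite add0n /al -(ncoef_nav _ _ _ lu) -cellix_anc (level iD).
Qed.

Lemma measurable_sqfun_trunc : measurable_fun setT sqfun_trunc.
Proof.
rewrite (_ : sqfun_trunc = Tsq (al s p) D \o cellix m); last by apply/funext => x; exact: sqfun_truncE.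
exact: measurable_comp_cellix.
Qed.

Lemma nav_avg (e : nat) v x : locint v ->
  nav s (cell_avg m (fun x => `|v x|)) e (anc e (cellix m x)) = avg s (m - e%:Z) v x.
Proof.
by move=> lv; rewrite nav_region; [rewrite /avg cellix_anc|exact: locint_norm].
Qed.

Variables (g : E -> R) (Mu Mg : E -> \bar R).
Hypotheses (lg : locint g) (g0 : forall x, 0 <= g x).
Hypotheses (mMu : measurable_fun setT Mu) (mMg : measurable_fun setT Mg).
Hypothesis HMu : forall (i : nat) x, ((avg s (J + (p0 + i)%N%:Z) u x)%:E <= Mu x)%E.
Hypothesis HMg : forall (i : nat) x, ((avg s (J + (p0 + i)%N%:Z) g x)%:E <= Mg x)%E.

Definition Ccell : R := Cbil n s (Cloc n s L).

(** The discrete bilinear bound asks for majorants that are functions of the finest cell,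
    whereas Mu and Mg vary inside the cells. *)
Let maxav (v : E -> R) k : R :=
  \big[Num.max/0]_(e < D.+1) nav s (cell_avg m (fun x => `|v x|)) e (anc e k).

Let maxav_ge0 v k : 0 <= maxav v k.
Proof. exact: bigmax_ge_id. Qed.

Let maxav_ge v e k : (e <= D)%N -> nav s (cell_avg m (fun x => `|v x|)) e (anc e k) <= maxav v k.
Proof. by move=> eD; apply: (le_bigmax _ _ (Ordinal (eD : (e < D.+1)%N))). Qed.

Let maxav_le v (Mv : E -> \bar R) x : locint v ->
  (forall (i : nat) x, ((avg s (J + (p0 + i)%N%:Z) v x)%:E <= Mv x)%E) ->
  ((maxav v (cellix m x))%:E <= Mv x)%E.
Proof.
move=> lv Mvx; rewrite /maxav; elim/big_ind: _ => [|a b ha hb|e _].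
- apply: le_trans (Mvx 0%N x); rewrite lee_fin mulr_ge0 ?invr_ge0 ?(ltW (cell_vol_gt0 _ _ _))//.
  by apply: Rintegral_ge0.
- by rewrite /Num.max; case: ifP.
- by rewrite nav_avg// level -1?ltnS//; exact: Mvx.
Qed.

(** Both integrands are constant on the finest cells, once g is replaced by its averages
    there and Mu and Mg by the largest of the averages that they dominate. *)
Lemma cell_bilinear q :
  (\int[mu]_(x in hcell (J + p0%:Z) q) (sqfun_trunc x * g x)%:E
   <= Ccell%:E * \int[mu]_(x in hcell (J + p0%:Z) q) (Mu x * Mg x))%E.
Proof.
have Mu0 x : (0 <= Mu x)%E by apply: le_trans (maxav_le x lu HMu); rewrite lee_fin.
have Mg0 x : (0 <= Mg x)%E by apply: le_trans (maxav_le x lg HMg); rewrite lee_fin.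
have -> : hcell (J + p0%:Z) q = region m (cells D q) :> set E.
  by rewrite region_cells /m; congr hcell; lia.
have T0 x : 0 <= sqfun_trunc x by exact: sqrtr_ge0.
rewrite ge0_integral_region ?uniq_cells//; last 2 first.
- by apply/measurable_EFinP/measurable_funM; [exact: measurable_sqfun_trunc|exact: lg.1].
- by move=> x; rewrite lee_fin mulr_ge0.
rewrite ge0_integral_region ?uniq_cells//; last 2 first.
- exact: emeasurable_funM.
- by move=> x; exact: mule_ge0.
have cell_vol0 := cell_vol_gt0 R n m.
have E1 k : (\int[mu]_(x in hcell m k) (sqfun_trunc x * g x)%:E =
    (cell_vol m * (Tsq (al s p) D k * cell_avg m g k))%:E)%E.
  have mh := @measurable_hcell R n m k.
  rewrite (_ : cell_vol m * _ = \int[mu]_(x in hcell m k) (Tsq (al s p) D k * g x)); last first.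
    rewrite RintegralZl//; last exact: lg.2.
    by rewrite /cell_avg; field; exact: lt0r_neq0.
  rewrite /Rintegral fineK; last first.
    apply: integrable_fin_num => //; have := integrableZl mh (Tsq (al s p) D k) (lg.2 m k).
    exact: eq_integrable.
  by apply: eq_integral => x; rewrite inE /hcell/= => xk; rewrite sqfun_truncE xk.
have E2 k : ((cell_vol m * (maxav u k * maxav g k))%:E <= \int[mu]_(x in hcell m k) (Mu x * Mg x))%E.
  have mh := @measurable_hcell R n m k.
  have -> : ((cell_vol m * (maxav u k * maxav g k))%:E =
      \int[mu]_(x in hcell m k) (maxav u k * maxav g k)%:E)%E.
    by rewrite integral_cst// [X in (_ * X)%E]mu_hcell -EFinM mulrC.
  apply: ge0_le_integral => //.
  - by move=> x _; rewrite lee_fin mulr_ge0 ?maxav_ge0.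
  - by apply: measurable_funTS; exact: emeasurable_funM.
  - move=> x; rewrite /hcell/= => xk; rewrite -xk EFinM; apply: lee_pmul; rewrite ?lee_fin//.
      exact: maxav_le.
    exact: maxav_le.
rewrite (eq_bigr _ (fun k _ => E1 k)) sumEFin.
apply: (@le_trans _ _ (Ccell%:E * \sum_(k <- cells D q) (cell_vol m * (maxav u k * maxav g k))%:E)%E).
  rewrite sumEFin -EFinM lee_fin -!mulr_sumr mulrCA ler_pM2l//.
  have [L0 _ _] := gp.
  apply: (@discrete_bilinear R n s U (cell_avg m g) (maxav u) (maxav g) (al s p) D (Cloc n s L)) => //.
  - by move=> k; exact: cell_avg_ge0.
  - exact: Cloc_gt0.
  - exact: local_cell_estimate.
  - by move=> e k; exact: maxav_ge.
  - move=> e k eD.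
    have Eg : cell_avg m g = cell_avg m (fun x => `|g x|).
      by congr cell_avg; apply/funext => x; rewrite ger0_norm.
    apply: le_trans (maxav_ge g k eD); rewrite -Eg; apply: le_av_nav.
      by move=> k'; exact: cell_avg_ge0.
    by rewrite mem_nbh; apply/forallP => i; rewrite subrr normr0.
rewrite lee_pmul2l//; first by apply: lee_sum => k _; exact: E2.
by rewrite lte_fin Cbil_gt0// Cloc_gt0//; case: gp.
Qed.

End fixed_levels.
End cell_estimate.

(** * The local maximal function *)

Section maximal.
Variables (R : realType) (n : nat).
Local Notation E := 'rV[R]_n.
Local Notation Zn := 'rV[int]_n.
Local Notation mu := (@lebesgue_rV R n).
Implicit Types (x y z : E) (u g : E -> R) (j : int) (q k : Zn).

Lemma cmod_real (a : R) : cmod (Complex a 0) = `|a|.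
Proof. by rewrite /cmod /= expr0n addr0 sqrtr_sqr. Qed.

Lemma cmodf_real u : cmodf (real_fun u) = EFin \o (fun x => `|u x|).
Proof. by apply/funext => x; rewrite /cmodf /real_fun cmod_real. Qed.

Lemma measurable_sum_sqr : measurable_fun setT (fun p : E * E =>
  enorm (p.2 - p.1)).
Proof.
apply: (@measurableT_comp _ _ _ _ _ _ (@Num.sqrt R)).
  by apply: continuous_measurable_fun; exact: sqrt_continuous.
apply: measurable_sum => i; apply: measurable_funX.
rewrite (_ : (fun _ => _) = (fun p : E * E => p.2 ord0 i - p.1 ord0 i)); last first.
  by apply/funext => p; rewrite !mxE.
apply: measurable_funB.
  by apply: (measurableT_comp (@measurable_coord R n i)).
by apply: (measurableT_comp (@measurable_coord R n i)).
Qed.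

Lemma measurable_near_diag (r : R) :
  measurable [set p : E * E | enorm (p.2 - p.1) < r].
Proof.
have := measurable_sum_sqr measurableT (measurable_itv `]-oo, r[%R).
rewrite setTI; congr (measurable _); apply/seteqP; split => p /=; by rewrite in_itv.
Qed.

Lemma measurable_eball x (r : R) : measurable (eball x r).
Proof.
have := measurable_xsection x (measurable_near_diag r).
congr (measurable _); apply/seteqP; split => y; rewrite /xsection/= inE//.
Qed.

Definition ballint u (r : R) x : \bar R := (\int[mu]_(y in eball x r) `|u y|%:E)%E.

(** Tonelli, applied to the indicator function of a neighbourhood of the diagonal. *)
Lemma measurable_ballint u r : measurable_fun setT u -> measurable_fun setT (ballint u r).
Proof.
move=> mu_.
pose f (p : E * E) : \bar R := (`|u p.2| * \1_[set p : E * E | enorm (p.2 - p.1) < r] p)%:E.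
have mf : measurable_fun setT f.
  apply/measurable_EFinP; apply: measurable_funM.
    by apply: measurableT_comp => //; exact: measurableT_comp.
  by apply: measurable_indic; exact: measurable_near_diag.
have f0 p : (0 <= f p)%E by rewrite lee_fin mulr_ge0.
have := @measurable_fun_fubini_tonelli_F _ _ E E R mu f mf f0.
congr measurable_fun; apply/funext => x; rewrite /fubini_F /ballint [RHS]integral_mkcond.
apply: eq_integral => y _; rewrite /f/= patchE indicE.
rewrite (_ : ((x, y) \in _) = (y \in eball x r)); last first.
  by apply/idP/idP; rewrite !inE.
by case: ifP => _; rewrite ?mulr1 ?mulr0.
Qed.

Lemma eball_bigcup x (r : R) : 0 < r ->
  eball x r = \bigcup_k eball x (r - r / k.+2%:R).
Proof.
move=> r0; apply/seteqP; split => y; rewrite /eball/=; last first.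
  move=> [k _ /= H]; apply: lt_le_trans H _.
  by rewrite gerBl divr_ge0 ?ltW.
set d := enorm _ => dr.
have dr0 : 0 < (r - d) / r by rewrite divr_gt0// subr_gt0.
exists (Num.truncn ((r - d) / r)^-1) => //=; rewrite -/d.
set N := Num.truncn _.
have : ((r - d) / r)^-1 < N.+2%:R.
  by apply: lt_trans (truncnS_gt _) _; rewrite ltr_nat.
rewrite invf_plt ?posrE// => H.
move: H; rewrite ltr_pdivlMr// mulrC; move: (r / _) => w; lra.
Qed.

Lemma eball_sub x (r r' : R) : r <= r' -> eball x r `<=` eball x r'.
Proof. by move=> rr y; rewrite /eball/= => /lt_le_trans; apply. Qed.

Lemma le_ballint u (r r' : R) x : measurable_fun setT u -> r <= r' ->
  (ballint u r x <= ballint u r' x)%E.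
Proof.
move=> mu_ rr; apply: ge0_subset_integral => //.
- exact: measurable_eball.
- exact: measurable_eball.
- by apply: measurable_funTS; apply/measurable_EFinP; exact: measurableT_comp.
- exact: eball_sub.
Qed.

(** Left continuity in the radius, which makes rational radii sufficient. *)
Lemma ballint_approx u (r : R) x (a : \bar R) : measurable_fun setT u -> 0 < r ->
  (a < ballint u r x)%E -> exists2 r', 0 < r' < r & (a < ballint u r' x)%E.
Proof.
move=> mu_ r0.
have mono : nondecreasing_seq (fun k : nat => eball x (r - r / k.+2%:R)).
  move=> k l kl; rewrite subsetEset; apply: eball_sub.
  by rewrite lerD2l lerN2 ler_pM2l// lef_pV2 ?posrE// ler_nat !ltnS.
have := @ge0_nondecreasing_set_cvg_integral _ E R _ (fun y => `|u y|%:E) mu mono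
  (fun i => measurable_eball _ _)
  (fun i => measurable_funTS ((measurable_EFinP _ _).2 (measurableT_comp (@normr_measurable R setT) mu_)))
  (fun i y _ => normr_ge0 (u y)).
rewrite -eball_bigcup// => cv ar.
have [k ak] : exists k : nat, (a < ballint u (r - r / k.+2%:R) x)%E.
  apply: contrapT => /forallNP H.
  have : (ballint u r x <= a)%E.
    rewrite /ballint -(cvg_lim _ cv)//; apply: lime_le; first by apply/cvg_ex; exists (ballint u r x).
    by apply: nearW => k; rewrite leNgt; apply/negP/H.
  by rewrite leNgt ar.
exists (r - r / k.+2%:R) => //; apply/andP; split.
  by rewrite subr_gt0 ltr_pdivrMr// ltr_pMr// ltr1n.
by rewrite gtrBl divr_gt0.
Qed.

Lemma MlocE u x : Mloc (real_fun u) x =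
  ereal_sup [set ((r ^+ n)^-1%:E * ballint u r x)%E | r in [set r : R | 0 < r < 1]].
Proof.
rewrite /Mloc; congr (ereal_sup _); apply: eq_imagel => r _; congr (_ * _)%E.
by apply: eq_integral => y _; rewrite cmodf_real.
Qed.

Lemma Mloc_ge0 u x : (0 <= Mloc (real_fun u) x)%E.
Proof.
rewrite MlocE; apply: (@le_trans _ _ ((((2^-1 : R) ^+ n)^-1%:E * ballint u 2^-1 x)%E)).
  by rewrite mule_ge0// ?integral_ge0// lee_fin invr_ge0 exprn_ge0.
by apply: ereal_sup_ubound; exists 2^-1 => //=; apply/andP; split; lra.
Qed.

(** By left continuity in the radius, this is a supremum over rational radii. *)
Lemma measurable_Mloc u : measurable_fun setT u ->
  measurable_fun setT (Mloc (real_fun u)).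
Proof.
move=> mu_.
pose up (i : nat) : option rat := unpickle i.
pose h (i : nat) x : \bar R := if up i is Some q then
  let r := ratr q : R in
  if 0 < r < 1 then ((r ^+ n)^-1%:E * ballint u r x)%E else 0%E else 0%E.
have h0 i x : (0 <= h i x)%E.
  rewrite /h; case: (up i) => // q; case: ifP => // /andP[q0 _].
  by rewrite mule_ge0// ?integral_ge0// lee_fin invr_ge0 exprn_ge0// ltW.
have mh i : measurable_fun setT (h i).
  rewrite /h; case: (up i) => [q|]; last exact: measurable_cst.
  rewrite /=; case: (0 < (ratr q : R) < 1); last exact: measurable_cst.
  by apply: measurable_funeM; exact: measurable_ballint.
suff -> : Mloc (real_fun u) = (fun x => esups (h ^~ x) 0) by exact: measurable_fun_esups.
apply/funext => x; rewrite MlocE /esups /sdrop/=; apply/eqP; rewrite eq_le; apply/andP; split.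
- apply: ge_ereal_sup => _ [r /= /andP[r0 r1] <-].
  rewrite leNgt; apply/negP; set S := ereal_sup _ => SM.
  have rn0 : 0 < r ^+ n by rewrite exprn_gt0.
  have S0 : (0 <= S)%E by apply: le_trans (h0 0%N x) _; apply: ereal_sup_ubound; exists 0%N.
  have : ((r ^+ n)%:E * S < ballint u r x)%E.
    by rewrite -lte_pdivlMl// mulrC.
  case/(ballint_approx mu_ r0) => r' /andP[r'0 r'r] H.
  have [q] := rat_in_itvoo r'r; rewrite in_itv/= => /andP[r'q qr].
  have q0 : 0 < ratr q :> R by exact: lt_trans r'0 r'q.
  have : ((ratr q ^+ n)^-1%:E * ballint u (ratr q) x <= S)%E.
    apply: ereal_sup_ubound; exists (pickle q) => //.
    by rewrite /h /up pickleK q0 (lt_trans qr r1).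
  rewrite lee_pdivrMl ?exprn_gt0//; apply/negP; rewrite -ltNge.
  apply: le_lt_trans (lt_le_trans H (le_ballint _ mu_ (ltW r'q))).
  apply: lee_wpmul2r => //; rewrite lee_fin lerXn2r ?nnegrE ?(ltW q0) ?(ltW r0)//.
  exact: ltW.
- apply: ge_ereal_sup => _ [i _ <-]; rewrite /h.
  have := Mloc_ge0 u x; rewrite MlocE => M0.
  case: (up i) => // q; case: ifP => // qr.
  by apply: ereal_sup_ubound; exists (ratr q).
Qed.

Lemma enorm_le x (d : R) : (forall i, `|x ord0 i| <= d) -> 0 <= d -> enorm x <= n%:R * d.
Proof.
move=> xd d0; apply: sqrt_leP; first exact: mulr_ge0.
apply: (@le_trans _ _ (\sum_(i < n) d ^+ 2)).
  by apply: ler_sum => i _; rewrite -real_normK ?num_real// lerXn2r ?nnegrE.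
rewrite sumr_const card_ord -[leLHS]mulr_natl exprMn ler_wpM2r ?sqr_ge0//.
by rewrite -natrX ler_nat -mulnn; case: (n) => // k; rewrite leq_pmulr.
Qed.

(** The cells around x lie in the ball at x of radius cM s times their side, in the Euclidean
    norm. *)
Definition cM s : nat := (n * s.+2 + 1)%N.

(** The cells are small enough for that ball to have radius less than 1. *)
Lemma avg_le_Mloc s j u x : locint u -> (cM s)%:R < (2 : R) ^ j ->
  ((avg s j u x)%:E <= ((cM s)%:R ^+ n)%:E * Mloc (real_fun u) x)%E.
Proof.
move=> lu big; set c := (cM s)%:R : R.
have c0 : 0 < c by rewrite ltr0n /cM addn1.
have p := pow2_gt0 R j.
pose r := c / 2 ^ j.
have r0 : 0 < r by rewrite divr_gt0.
have r1 : r < 1 by rewrite ltr_pdivrMr// mul1r.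
have sub : region j (nbh s 0 (cellix j x)) `<=` eball x r.
  move=> y yr; rewrite /eball/=.
  apply: le_lt_trans (@enorm_le _ (s.+2%:R / 2 ^ j) _ _) _.
  - move=> i; rewrite 2!mxE ler_pdivlMr// -[X in _ * X](gtr0_norm p) -normrM mulrC mulrBr.
    have H := cellix_nbh0 yr i.
    have /andP[h1 h2] := cellix_itv j x i.
    move: H; rewrite !ler_norml -[s.+2%:R]natr1 -[s.+1%:R]natr1; lra.
  - by rewrite divr_ge0// ltW.
  - by rewrite mulrA ltr_pM2r ?invr_gt0// /c /cM natrD natrM ltrDl.
have mr := measurable_region j (nbh s 0 (cellix j x)) (R := R) (n := n).
have mnu : measurable_fun setT (fun y => `|u y|%:E).
  by apply/measurable_EFinP; apply: measurableT_comp lu.1.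
have -> : (avg s j u x)%:E = ((cell_vol R n j)^-1%:E *
    \int[mu]_(y in region j (nbh s 0 (cellix j x))) `|u y|%:E)%E.
  rewrite /avg EFinM /Rintegral fineK//; apply: integrable_fin_num => //.
  exact: (locint_region j (uniq_nbh _ _ _) (locint_norm lu)).
apply: (@le_trans _ _ ((cell_vol R n j)^-1%:E * ballint u r x)%E).
  apply: lee_wpmul2l; first by rewrite lee_fin invr_ge0 ltW// cell_vol_gt0.
  apply: ge0_subset_integral => //; first exact: measurable_eball.
  exact: measurable_funTS.
rewrite (_ : (cell_vol R n j)^-1 = c ^+ n * (r ^+ n)^-1); last first.
  rewrite /cell_vol /r pow2N expr_div_n exprVn invrK invf_div mulrA mulrC mulrA.
  by rewrite mulVf ?mul1r//; exact/lt0r_neq0/exprn_gt0.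
rewrite EFinM -muleA; apply: lee_wpmul2l; first by rewrite lee_fin exprn_ge0// ltW.
by rewrite MlocE; apply: ereal_sup_ubound; exists r => //=; rewrite r0.
Qed.

End maximal.

(** * Averages over neighbouring cells *)

Section averaging.
Variables (R : realType) (n : nat).
Local Notation E := 'rV[R]_n.
Local Notation Zn := 'rV[int]_n.
Local Notation mu := (@lebesgue_rV R n).
Implicit Types (x y z : E) (u v g : E -> R) (j : int) (q k : Zn).

Lemma measurable_avg s j u : measurable_fun setT (avg s j u).
Proof.
exact: (@measurable_comp_cellix R n j _ _ (fun k => (cell_vol R n j)^-1 *
  \int[mu]_(y in region j (nbh s 0 k)) `|u y|)).
Qed.

Lemma avg_ge0 s j u x : 0 <= avg s j u x.
Proof.
by rewrite mulr_ge0 ?invr_ge0 ?(ltW (cell_vol_gt0 _ _ _))//; apply: Rintegral_ge0.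
Qed.

Lemma box_hcell j k : exists r, hcell j k `<=` @box R n r.
Proof.
exists (\sum_(i < n)
    (Num.truncn (2 ^ (- j) * `|(k ord0 i)%:~R| + 2 ^ (- j) : R)).+1)%N => x xk i.
rewrite /hcell/= in xk.
apply: (@le_trans _ _ (2 ^ (- j) * `|(cellix j x ord0 i)%:~R| + 2 ^ (- j))).
  rewrite -[X in `|X|](subrK (2 ^ (- j) * (cellix j x ord0 i)%:~R)).
  apply: le_trans (ler_normD _ _) _; rewrite addrC; apply: lerD; last exact: cellix_dist.
  by rewrite normrM gtr0_norm ?pow2_gt0.
apply: le_trans (ltW (truncnS_gt _)) _.
by rewrite xk ler_nat (bigD1 i)//= leq_addr.
Qed.

Lemma locint_step j (F : Zn -> R) : locint (fun x : E => F (cellix j x)).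
Proof.
have mF : measurable_fun setT (fun x : E => F (cellix j x)).
  exact: (@measurable_comp_cellix R n j _ _ F).
split => // j' k'.
have [r rP] := box_hcell j' k'; have [S uS SP] := @box_region R n j r.
apply: (@integrableS _ _ _ _ (region j S)) => //.
- exact: measurable_region.
- exact: measurable_hcell.
- by move=> x /rP /SP.
apply: integrable_region => // k _.
apply: (eq_integrable (measurable_hcell j k) (EFin \o cst (F k))).
  by move=> x; rewrite inE /hcell/= => ->.
exact: (locint_cst n (F k)).2.
Qed.

Lemma locint_avg s j u : locint (avg s j u).
Proof.
exact: (locint_step j (fun k => (cell_vol R n j)^-1 *
  \int[mu]_(y in region j (nbh s 0 k)) `|u y|)).
Qed.

Lemma avg_sum s j u x : locint u ->
  avg s j u x = (cell_vol R n j)^-1 * \sum_(k <- nbh s 0 (cellix j x)) \int[mu]_(y in hcell j k) `|u y|.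
Proof.
move=> lu; have [m i] := locint_norm lu.
by rewrite /avg (Rintegral_region (uniq_nbh _ _ _) m)// => k _; exact: i.
Qed.

Lemma nbh0_trans t (k k' q : Zn) : k \in nbh 1 0 q -> k' \in nbh t 0 k ->
  k' \in nbh t.+1 0 q.
Proof.
rewrite !mem_nbh !anc0 => /forallP h1 /forallP h2; apply/forallP => i.
by have := h1 i; have := h2 i; lia.
Qed.

Lemma nbh0_sub t (k q : Zn) : k \in nbh t 0 q -> k \in nbh t.+1 0 q.
Proof.
rewrite !mem_nbh => /forallP h; apply/forallP => i.
by have := h i; lia.
Qed.

(** A neighbourhood of width t + 1 is reached by a step of width 1 and one of width t. *)
Lemma avg_avg t j u x : locint u -> avg t.+1 j u x <= avg 1 j (avg t j u) x.
Proof.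
move=> lu; rewrite (avg_sum _ _ _ lu) (avg_sum _ _ _ (locint_avg t j u)).
rewrite ler_wpM2l ?invr_ge0 ?(ltW (cell_vol_gt0 _ _ _))//; set q := cellix j x.
pose a k := \int[mu]_(y in hcell j k) `|u y|.
have a0 k : 0 <= a k by apply: Rintegral_ge0.
have E1 k : \int[mu]_(y in hcell j k) `|avg t j u y| = \sum_(k' <- nbh t 0 k) a k'.
  transitivity (\int[mu]_(y in hcell j k) ((cell_vol R n j)^-1 * \sum_(k' <- nbh t 0 k) a k')).
    apply: eq_Rintegral => y; rewrite inE /hcell/= => yk.
    by rewrite ger0_norm ?avg_ge0// (avg_sum _ _ _ lu) yk.
  rewrite Rintegral_cst; last exact: measurable_hcell.
  by rewrite [X in fine X]mu_hcell /= mulrAC mulVf ?mul1r// cell_vol_neq0.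
rewrite (eq_bigr _ (fun k _ => E1 k)).
apply: (@le_trans _ _ (\sum_(k <- nbh 1 0 q) \sum_(k' <- nbh t.+1 0 q)
    (k' \in nbh t 0 k)%:R * a k')); last first.
  rewrite big_seq [leRHS]big_seq; apply: ler_sum => k kq.
  rewrite (@sum_subseq_filter _ _ (nbh t 0 k) (nbh t.+1 0 q)) ?uniq_nbh//.
    rewrite [leRHS]big_mkcond; apply: ler_sum => k' _.
    by case: ifP => _; rewrite ?mul1r ?mul0r.
  by move=> k'; exact: nbh0_trans.
rewrite exchange_big /= big_seq [leRHS]big_seq; apply: ler_sum => k' k'q.
rewrite -mulr_suml -[leLHS]mul1r ler_wpM2r ?a0//.
(* One step from q towards k' in every coordinate. *)
pose k : Zn := \row_i (q ord0 i + (if k' ord0 i > q ord0 i then 1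
  else if k' ord0 i < q ord0 i then -1 else 0)).
have k1 : k \in nbh 1 0 q.
  rewrite mem_nbh anc0; apply/forallP => i; rewrite mxE.
  by case: ifP => _; [|case: ifP => _]; lia.
have k2 : k' \in nbh t 0 k.
  move: k'q; rewrite !mem_nbh anc0 => /forallP H; apply/forallP => i.
  have := H i; rewrite [k ord0 i]mxE; move: (k' ord0 i) (q ord0 i) => a1 b1.
  by case: (ltP b1 a1) => h1; [|case: (ltP a1 b1) => h2]; lia.
by rewrite (bigD1_seq _ k1) ?uniq_nbh//= k2 lerDl sumr_ge0.
Qed.

(* N is to be the norm or its Koethe dual. *)
Variable N : (E -> \bar R) -> \bar R.
Hypothesis N0 : forall f, nonneg_measurable f -> (0 <= N f)%E.
Hypothesis Nmono : forall f g : E -> \bar R, nonneg_measurable f -> nonneg_measurable g ->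
  (forall x, (g x <= f x)%E) -> (N g <= N f)%E.
Hypothesis Nscale : forall f (a : R), nonneg_measurable f -> 0 <= a ->
  (N (fun x => a%:E * f x) <= a%:E * N f)%E.
Hypothesis NM : Mloc_bounded N.

Definition eabs u : E -> \bar R := fun x => `|u x|%:E.

Lemma eabs_nnm u : measurable_fun setT u -> nonneg_measurable (eabs u).
Proof.
move=> m; split; last by move=> x; rewrite lee_fin.
by apply/measurable_EFinP; exact: measurableT_comp.
Qed.

Lemma Mloc_nnm u : measurable_fun setT u -> nonneg_measurable (Mloc (real_fun u)).
Proof. by move=> m; split; [exact: measurable_Mloc|move=> x; exact: Mloc_ge0]. Qed.

Lemma Mloc_real_bounded : exists2 C : R, 0 <= C & forall u, measurable_fun setT u ->
  (N (eabs u) < +oo)%E -> (N (Mloc (real_fun u)) <= C%:E * N (eabs u))%E.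
Proof.
have [C H] := NM; exists `|C| => // u m fin.
have E1 : cmodf (real_fun u) = eabs u by rewrite cmodf_real.
have : inX N (real_fun u).
  split; last by rewrite /Xnorm E1.
  by split => //=; exact: measurable_cst.
move=> /H; rewrite /Xnorm E1 => /le_trans; apply.
by apply: lee_wpmul2r; [exact/N0/eabs_nnm|rewrite lee_fin ler_norm].
Qed.

(** For large t the neighbourhood is too large to lie in a ball of radius 1, but iterated
    averages of width 1 reach it, and each of them is dominated by the maximal function. *)
Lemma avg_bounded j t : (cM n 1)%:R < (2 : R) ^ j ->
  exists2 C : R, 0 <= C & forall u, locint u ->
  (N (eabs u) < +oo)%E -> (N (eabs (avg t j u)) <= C%:E * N (eabs u))%E.
Proof.
move=> big; have [C C0 H] := Mloc_real_bounded.
pose c : R := (cM n 1)%:R ^+ n.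
have c0 : 0 <= c by rewrite exprn_ge0.
have one u : locint u -> (N (eabs u) < +oo)%E ->
    (N (eabs (avg 1 j u)) <= (c * C)%:E * N (eabs u))%E.
  move=> lu fin; apply: (@le_trans _ _ (c%:E * N (Mloc (real_fun u)))%E); last first.
    by rewrite EFinM -muleA; apply: lee_wpmul2l; [rewrite lee_fin|exact: H lu.1 fin].
  have nM := Mloc_nnm lu.1.
  apply: le_trans (Nscale nM c0); apply: Nmono.
  - split; first by apply: measurable_funeM; exact: nM.1.
    by move=> x; rewrite mule_ge0// ?nM.2.
  - apply: eabs_nnm; exact: measurable_avg.
  - by move=> x; rewrite /eabs ger0_norm ?avg_ge0//; exact: avg_le_Mloc.
suff [C' C'0 H'] : exists2 C : R, 0 <= C & forall u, locint u ->
  (N (eabs u) < +oo)%E -> (N (eabs (avg t.+1 j u)) <= C%:E * N (eabs u))%E.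
  exists C' => // u lu fin; apply: le_trans (H' u lu fin).
  apply: Nmono; [apply: eabs_nnm; exact: measurable_avg|apply: eabs_nnm; exact: measurable_avg|].
  move=> x; rewrite /eabs !ger0_norm ?avg_ge0// lee_fin !(avg_sum _ _ _ lu).
  rewrite ler_wpM2l ?invr_ge0 ?(ltW (cell_vol_gt0 _ _ _))//.
  apply: ler_sum_subset; rewrite ?uniq_nbh//.
    by move=> k; exact: nbh0_sub.
  by move=> k; apply: Rintegral_ge0.
elim: t => [|t [C' C'0 IH]]; first by exists (c * C) => //; exact: mulr_ge0.
exists (c * C * C'); first by rewrite !mulr_ge0.
move=> u lu fin; have la := locint_avg t.+1 j u.
have fa : (N (eabs (avg t.+1 j u)) < +oo)%E.
  apply: le_lt_trans (IH u lu fin) _; rewrite lte_mul_pinfty ?lee_fin//.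
apply: (@le_trans _ _ (N (eabs (avg 1 j (avg t.+1 j u))))).
  apply: Nmono; [apply: eabs_nnm; exact: measurable_avg|apply: eabs_nnm; exact: measurable_avg|].
  by move=> x; rewrite /eabs !ger0_norm ?avg_ge0// lee_fin avg_avg.
apply: le_trans (one _ la fa) _.
have -> : ((c * C * C')%:E = (c * C)%:E * C'%:E)%E by rewrite EFinM.
rewrite -muleA.
by apply: lee_wpmul2l; [rewrite lee_fin mulr_ge0|exact: IH].
Qed.

End averaging.

(** * Truncation, the Koethe dual and the Hoelder inequality *)

Section truncation.
Variables (R : realType) (n : nat).
Local Notation E := 'rV[R]_n.
Local Notation mu := (@lebesgue_rV R n).
Implicit Types (x y z : E) (u v g : E -> R) (f F : E -> \bar R) (N : nat).

Definition trunc_at N f x : R := fine (mine (f x) N%:R%:E) * \1_(box N) x.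

Lemma trunc_at_min N f x : (0 <= f x)%E -> (fine (mine (f x) N%:R%:E))%:E = mine (f x) N%:R%:E.
Proof.
move=> f0; rewrite fineK//; rewrite ge0_fin_numE.
  by rewrite gt_min ltry orbT.
by rewrite le_min f0 lee_fin ler0n.
Qed.

Lemma trunc_at_ge0 N f x : (0 <= f x)%E -> 0 <= trunc_at N f x.
Proof. by move=> f0; rewrite /trunc_at mulr_ge0// -lee_fin trunc_at_min// le_min f0 lee_fin ler0n. Qed.

Lemma trunc_at_le N f x : (0 <= f x)%E -> ((trunc_at N f x)%:E <= f x)%E.
Proof.
move=> f0; rewrite /trunc_at indicE; case: (_ \in _); last by rewrite mulr0.
by rewrite mulr1 trunc_at_min// ge_min lexx.
Qed.

Lemma trunc_at_test_fun N f : nonneg_measurable f -> test_fun (trunc_at N f).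
Proof.
move=> [mf f0]; split.
  apply: measurable_funM; last by apply: measurable_indic; exact: measurable_box.
  apply: measurableT_comp => //; apply: measurable_mine => //.
exists N%:R, N; split => //.
  move=> x; rewrite ger0_norm ?trunc_at_ge0// /trunc_at indicE.
  case: (_ \in _); last by rewrite mulr0.
  by rewrite mulr1 -lee_fin trunc_at_min// ge_min lexx orbT.
move=> x; rewrite /trunc_at indicE; case: (boolP (x \in _)); last by rewrite mulr0 eqxx.
by rewrite inE.
Qed.

Lemma trunc_at_mono f x : (0 <= f x)%E -> nondecreasing_seq (fun N => (trunc_at N f x)%:E).
Proof.
move=> f0 N M NM; rewrite lee_fin.
have [xN|xN] := boolP (x \in box N); last first.
  by rewrite {1}/trunc_at indicE (negbTE xN) mulr0 trunc_at_ge0.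
have xM : x \in box M by move: xN; rewrite !inE; exact: box_sub.
rewrite /trunc_at !indicE xN xM !mulr1 -lee_fin !trunc_at_min//.
by rewrite le_min !ge_min lexx/= lee_fin ler_nat NM orbT.
Qed.

Lemma trunc_at_cvg f x : (0 <= f x)%E -> (trunc_at N f x)%:E @[N --> \oo] --> f x.
Proof.
move=> f0; have [r xr] := box_exists x.
have xb : \forall N \near \oo, (trunc_at N f x)%:E = mine (f x) N%:R%:E.
  exists r => // N /= rN; rewrite /trunc_at indicE mem_set ?mulr1 ?trunc_at_min//.
  exact: box_sub xr.
case fx : (f x) => [a| |]; last by move: f0; rewrite fx.
  apply: cvg_near_cst.
  have [k ak] : exists k : nat, a <= k%:R.
    by exists (Num.truncn a).+1; exact/ltW/truncnS_gt.
  near=> N; have -> : (trunc_at N f x)%:E = mine (f x) N%:R%:E by near: N.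
  rewrite fx; apply/min_idPl; rewrite lee_fin (le_trans ak)// ler_nat.
  by near: N; exists k.
apply/cvgeyPge => A; near=> N.
have -> : (trunc_at N f x)%:E = mine (f x) N%:R%:E by near: N.
rewrite fx le_min leey/= lee_fin; near: N.
exists (Num.truncn A).+1 => // N /= AN; apply: le_trans (ltW (truncnS_gt A)) _.
by rewrite ler_nat.
Unshelve. all: by end_near. Qed.

Lemma integral_trunc_at_cvg f F : nonneg_measurable f -> nonneg_measurable F ->
  (\int[mu]_x ((trunc_at N f x)%:E * F x))%E @[N --> \oo] --> (\int[mu]_x (f x * F x))%E.
Proof.
move=> [mf f0] [mF F0].
have E1 : (\int[mu]_x (f x * F x) = \int[mu]_x (limn (fun N => (trunc_at N f x)%:E * F x)))%E.
  apply: eq_integral => x _; apply/esym/cvg_lim => //.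
  have [F00|F00] := eqVneq (F x) 0%E.
    by rewrite F00 mule0; under eq_fun do rewrite mule0; exact: cvg_cst.
  have [fx0|fx0] := eqVneq (f x) 0%E.
    rewrite fx0 mul0e; apply: cvg_near_cst; apply: nearW => N.
    suff -> : (trunc_at N f x)%:E = 0%E by rewrite mul0e.
    apply/eqP; rewrite eq_le; have := trunc_at_le N (f0 x); rewrite fx0 => ->.
    by rewrite lee_fin trunc_at_ge0.
  apply: cvgeM; [|exact: trunc_at_cvg|exact: cvg_cst].
  by move: (f0 x) (F0 x) fx0 F00; case: (f x) => [a| |]; case: (F x) => [b| |].
rewrite E1; apply: cvg_monotone_convergence => //.
- move=> N; apply: emeasurable_funM => //; apply/measurable_EFinP.
  exact: test_fun_mea (trunc_at_test_fun N (conj mf f0)).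
- by move=> N x _; rewrite mule_ge0// lee_fin trunc_at_ge0.
- move=> x _ N M NM; apply: lee_wpmul2r => //; exact: trunc_at_mono.
Qed.

Lemma integral_trunc_at_le f F (a : \bar R) : nonneg_measurable f -> nonneg_measurable F ->
  (forall N, (\int[mu]_x ((trunc_at N f x)%:E * F x) <= a)%E) ->
  (\int[mu]_x (f x * F x) <= a)%E.
Proof.
move=> nf nF H; have cv := integral_trunc_at_cvg nf nF.
rewrite -(cvg_lim _ cv)//; apply: lime_le; first by apply/cvg_ex; eexists; exact: cv.
exact: nearW.
Qed.

End truncation.

Section koethe.
Variables (R : realType) (n : nat).
Local Notation E := 'rV[R]_n.
Local Notation Zn := 'rV[int]_n.
Local Notation mu := (@lebesgue_rV R n).
Implicit Types (x y z : E) (u v : E -> R) (j : int).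
Variable rho : (E -> \bar R) -> \bar R.
Hypothesis Hr : ball_Banach_norm rho.
Local Notation kd := (Koethe_dual rho).

Lemma rho_mono (f g : E -> \bar R) : nonneg_measurable f -> nonneg_measurable g ->
  (forall x, (g x <= f x)%E) -> (rho g <= rho f)%E.
Proof. by move=> nf ng gf; apply: (bbn_mono Hr) => //; apply: aeW => x. Qed.

Lemma rho_scale (f : E -> \bar R) (a : R) : nonneg_measurable f -> 0 <= a ->
  (rho (fun x => a%:E * f x) <= a%:E * rho f)%E.
Proof. by move=> nf a0; rewrite (bbn_scale Hr). Qed.

Lemma nnm_scale (f : E -> \bar R) (a : R) : nonneg_measurable f -> 0 <= a ->
  nonneg_measurable (fun x => a%:E * f x)%E.
Proof.
move=> [mf f0] a0; split; first exact: measurable_funeM.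
by move=> x; rewrite mule_ge0// lee_fin.
Qed.

Lemma nnm_mul (f g : E -> \bar R) : nonneg_measurable f -> nonneg_measurable g ->
  nonneg_measurable (fun x => f x * g x)%E.
Proof.
move=> [mf f0] [mg g0]; split; first exact: emeasurable_funM.
by move=> x; rewrite mule_ge0.
Qed.

Lemma nnm_add (f g : E -> \bar R) : nonneg_measurable f -> nonneg_measurable g ->
  nonneg_measurable (fun x => f x + g x)%E.
Proof.
move=> [mf f0] [mg g0]; split; first exact: emeasurable_funD.
by move=> x; rewrite adde_ge0.
Qed.

Lemma kd_ge u (g : E -> \bar R) : measurable_fun setT u -> (rho (eabs u) <= 1)%E ->
  (\int[mu]_x (eabs u x * g x) <= kd g)%E.
Proof.
move=> mu_ r1; apply: ereal_sup_ubound; exists (real_fun u).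
  split; last by rewrite /Xnorm cmodf_real.
  split; first by split => //; exact: measurable_cst.
  by rewrite /Xnorm cmodf_real; apply: le_lt_trans r1 _; exact: ltry.
by apply: eq_integral => x _; rewrite cmodf_real.
Qed.

Lemma eabs0 : eabs (fun _ : E => 0) = (fun x => 0%E).
Proof. by apply/funext => x; rewrite /eabs normr0. Qed.

Lemma rho0 : rho (fun=> 0%E) = 0%E.
Proof.
apply/(bbn_eq0 Hr); last by apply: aeW.
by split => //; exact: measurable_cst.
Qed.

Lemma kd_ge0 (g : E -> \bar R) : (0 <= kd g)%E.
Proof.
have := @kd_ge (fun=> 0) g; rewrite eabs0 rho0 => /(_ (measurable_cst _)).
rewrite lee01 => /(_ isT); apply: le_trans.
rewrite (_ : (fun x => (0 * g x)%E) = cst 0%E) ?integral0//.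
by apply/funext => x; rewrite mul0e.
Qed.

Lemma nnm_cmodf (f : E -> R[i]) : cmeasurable f -> nonneg_measurable (cmodf f).
Proof.
move=> [mr mi]; split; last by move=> x; rewrite lee_fin /cmod; case: (f x) => a b; rewrite sqrtr_ge0.
apply/measurable_EFinP.
rewrite (_ : (fun _ => _) = (fun x => Num.sqrt (complex.Re (f x) ^+ 2 + complex.Im (f x) ^+ 2))).
  apply: (@measurableT_comp _ _ _ _ _ _ (@Num.sqrt R)).
    by apply: continuous_measurable_fun; exact: sqrt_continuous.
  by apply: measurable_funD; exact: measurable_funX.
by apply/funext => x; rewrite /cmod; case: (f x).
Qed.

Lemma kd_mono (f g : E -> \bar R) : nonneg_measurable f -> nonneg_measurable g ->
  (forall x, (g x <= f x)%E) -> (kd g <= kd f)%E.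
Proof.
move=> nf ng gf; apply: ge_ereal_sup => _ [h [hX h1] <-].
apply: le_trans (ereal_sup_ubound _); last by exists h.
have nh := nnm_cmodf hX.1.
apply: ge0_le_integral => //.
- by move=> x _; rewrite mule_ge0// ?nh.2 ?ng.2.
- exact: (nnm_mul nh ng).1.
- exact: (nnm_mul nh nf).1.
- by move=> x _; apply: lee_wpmul2l => //; exact: nh.2.
Qed.

Lemma kd_scale (f : E -> \bar R) (a : R) : nonneg_measurable f -> 0 <= a ->
  (kd (fun x => a%:E * f x) <= a%:E * kd f)%E.
Proof.
move=> nf a0; apply: ge_ereal_sup => _ [h [hX h1] <-].
have nh := nnm_cmodf hX.1.
under eq_integral do rewrite muleCA.
rewrite ge0_integralZl//; first last.
- by move=> x _; exact: (nnm_mul nh nf).2.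
- exact: (nnm_mul nh nf).1.
by apply: lee_wpmul2l; rewrite ?lee_fin//; apply: ereal_sup_ubound; exists h.
Qed.

(** The truncations of f are admissible in the definition of the dual norm once divided by c;
    working with an upper bound c > 0 in place of the norm avoids dividing by zero. *)
Lemma hoelder (f g : E -> \bar R) (c : R) : nonneg_measurable f -> nonneg_measurable g ->
  0 < c -> (rho f <= c%:E)%E -> (\int[mu]_x (f x * g x) <= c%:E * kd g)%E.
Proof.
move=> nf ng c0 fc; apply: integral_trunc_at_le => // N.
have bt := trunc_at_test_fun N nf.
pose v x := c^-1 * trunc_at N f x.
have mv : measurable_fun setT v by apply: measurable_funM => //; exact: test_fun_mea.
have v0 x : 0 <= v x by rewrite mulr_ge0 ?invr_ge0 ?(ltW c0)// trunc_at_ge0// nf.2.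
have rv : (rho (eabs v) <= 1)%E.
  have -> : eabs v = (fun x => (c^-1)%:E * eabs (trunc_at N f) x)%E.
    by apply/funext => x; rewrite /eabs /v normrM gtr0_norm ?invr_gt0// EFinM.
  apply: le_trans (rho_scale (eabs_nnm bt.1) _) _; first by rewrite invr_ge0 ltW.
  rewrite lee_pdivrMl// mule1; apply: le_trans fc; apply: rho_mono => //.
    exact: eabs_nnm bt.1.
  by move=> x; rewrite /eabs ger0_norm ?trunc_at_ge0 ?trunc_at_le ?nf.2.
have H := kd_ge g mv rv.
rewrite -lee_pdivrMl//; apply: le_trans H.
rewrite -ge0_integralZl//; first last.
- by rewrite lee_fin invr_ge0 ltW.
- by move=> x _; rewrite mule_ge0 ?ng.2// lee_fin trunc_at_ge0// nf.2.
- by apply: emeasurable_funM; [apply/measurable_EFinP; exact: bt.1|exact: ng.1].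
rewrite le_eqVlt; apply/orP; left; apply/eqP/eq_integral => x _.
by rewrite /eabs ger0_norm// muleA -EFinM.
Qed.

Lemma box_eball r : box r `<=` eball (0 : E) (n%:R * r%:R + 1).
Proof.
move=> x xr; rewrite /eball/= subr0; apply: (@le_lt_trans _ _ (n%:R * r%:R)).
  by apply: enorm_le.
by rewrite ltrDl.
Qed.

Lemma integral_box_le r : exists2 C : R, 0 <= C & forall f, nonneg_measurable f ->
  (\int[mu]_(x in box r) f x <= C%:E * rho f)%E.
Proof.
have r0 : (0 : R) < n%:R * r%:R + 1 by rewrite ltr_wpDl// mulr_ge0.
have [C HC] := bbn_L1 Hr (0 : E) r0; exists `|C| => // f nf.
apply: (@le_trans _ _ (C%:E * rho f)%E); last first.
  by apply: lee_wpmul2r; [exact: (bbn_ge0 Hr nf)|rewrite lee_fin ler_norm].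
apply: le_trans (HC f nf); rewrite integral_mkcond; apply: ge0_le_integral => //.
- by move=> x _; apply: erestrict_ge0 => // y _; exact: nf.2.
- apply/(measurable_restrictT f) => //; first exact: measurable_box.
  exact: measurable_funTS nf.1.
- apply: emeasurable_funM; last exact: nf.1.
  by apply/measurable_EFinP; apply: measurable_indic; exact: measurable_eball.
- move=> x _; rewrite patchE indicE; case: ifPn => [|_].
    by rewrite inE => xr; rewrite mem_set ?mul1e//; exact: box_eball.
  by rewrite mule_ge0 ?nf.2// lee_fin.
Qed.

(** A box lies in a ball, where the norm dominates the integral. *)
Lemma rho_locint u : measurable_fun setT u -> (rho (eabs u) < +oo)%E -> locint u.
Proof.
move=> mu_ fin; split => // j k; have [r rP] := box_hcell R j k.
have [C C0 HC] := integral_box_le r; have nu := eabs_nnm mu_.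
apply/integrableP; split; first by apply: measurable_funTS; exact/measurable_EFinP.
apply: (@le_lt_trans _ _ (\int[mu]_(x in box r) eabs u x)%E).
  apply: ge0_subset_integral => //.
  - exact: measurable_hcell.
  - exact: measurable_box.
  - exact: measurable_funTS nu.1.
apply: le_lt_trans (HC _ nu) _; rewrite lte_mul_pinfty ?lee_fin//.
Qed.

(** The norm dominates the integral over a box that contains the support of g. *)
Lemma kd_test_fun g : test_fun g -> (kd (eabs g) < +oo)%E.
Proof.
move=> [mg [B [r [B0 gB gr]]]]; have [C C0 HC] := integral_box_le r.
apply: (@le_lt_trans _ _ (B * C)%:E); last exact: ltry.
apply: ge_ereal_sup => _ [h [hX h1] <-]; have nh := nnm_cmodf hX.1.
rewrite (@integral_supp _ _ _ (box r)); last 2 first.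
- exact: measurable_box.
- move=> x H; apply: gr; apply: contraNneq H => g0.
  by rewrite /eabs g0 normr0 mule0.
apply: (@le_trans _ _ (\int[mu]_(x in box r) (B%:E * cmodf h x))%E).
  apply: ge0_le_integral => //; first exact: measurable_box.
  - by move=> x _; exact: (nnm_mul nh (eabs_nnm mg)).2.
  - by apply: measurable_funTS; exact: (nnm_mul nh (eabs_nnm mg)).1.
  - by apply: measurable_funTS; exact: (nnm_scale nh B0).1.
  - by move=> x _; rewrite muleC; apply: lee_wpmul2r; rewrite ?nh.2// lee_fin.
rewrite ge0_integralZl//; first last.
- by move=> x _; exact: nh.2.
- exact: measurable_funTS nh.1.
- exact: measurable_box.
rewrite EFinM; apply: lee_wpmul2l; rewrite ?lee_fin//.
apply: le_trans (HC _ nh) _; rewrite -[leRHS]mule1; apply: lee_wpmul2l; rewrite ?lee_fin//.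
Qed.

End koethe.

(** * The Lorentz-Luxemburg theorem *)

Section ip_more.
Variables (R : realType) (n : nat).
Local Notation E := 'rV[R]_n.
Local Notation mu := (@lebesgue_rV R n).
Implicit Types (x y z : E) (f g h : E -> R).

Lemma ip_BB f g h k : test_fun f -> test_fun g -> test_fun h -> test_fun k ->
  ip (fun x => f x - g x) (fun x => h x - k x) = ip f h - ip f k - ip g h + ip g k.
Proof.
move=> bf bg bh bk.
have lf := test_fun_locint bf; have lg := test_fun_locint bg.
rewrite ipC ipBr//; [|exact/test_fun_locint/test_funB].
by rewrite [ip _ f]ipC [ip _ g]ipC !ipBr//; ring.
Qed.

Lemma ip_le_sqr f g : test_fun f -> test_fun g -> (forall x, f x ^+ 2 <= g x ^+ 2) ->
  ip f f <= ip g g.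
Proof.
move=> bf bg fg; apply: le_Rintegral => //.
- exact: integrableM (test_fun_locint bf) bf.
- exact: integrableM (test_fun_locint bg) bg.
- by move=> x _; rewrite -!expr2.
Qed.

Lemma expNz (a : R) (k : nat) : a ^ (- k%:Z) = (a ^+ k)^-1.
Proof. by rewrite -invr_expz -exprnP. Qed.

(** A limit argument in the form that is used with geometric rates. *)
Lemma small_le (a b C : R) : (forall k : nat, a <= b + C * 2 ^ (- k%:Z)) -> a <= b.
Proof.
move=> H; apply/ler_addgt0Pr => e e0.
have C0 : 0 < `|C| + 1 by rewrite ltr_wpDl.
have := @pow2_cvg0 R; move/cvgrPdist_le => /(_ (e / (`|C| + 1))).
rewrite divr_gt0// => /(_ isT)[k _ /(_ k (leqnn k))].
rewrite sub0r normrN gtr0_norm ?pow2_gt0// => Hk.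
apply: le_trans (H k) _; rewrite lerD2l.
apply: (@le_trans _ _ ((`|C| + 1) * (e / (`|C| + 1)))).
  apply: (@le_trans _ _ ((`|C| + 1) * 2 ^ (- k%:Z))); last by rewrite ler_pM2l.
  rewrite ler_pM2r ?pow2_gt0//; have := ler_norm C; lra.
by rewrite mulrC mulfVK// lt0r_neq0.
Qed.

End ip_more.

Section lorentz_luxemburg.
Variables (R : realType) (n : nat).
Local Notation E := 'rV[R]_n.
Local Notation mu := (@lebesgue_rV R n).
Implicit Types (x y z : E) (u v p q : E -> R).
Variable rho : (E -> \bar R) -> \bar R.
Hypothesis Hr : ball_Banach_norm rho.
Local Notation kd := (Koethe_dual rho).

Section bounded.
Variables (h : E -> R) (c : R).
Hypothesis bh : test_fun h.
Hypothesis h0 : forall x, 0 <= h x.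
Hypothesis c0 : 0 < c.

(* The competitors: minorants of h in the ball of radius c. *)
Let K p := [/\ measurable_fun setT p, forall x, 0 <= p x <= h x &
  (rho (eabs p) <= c%:E)%E].

Let K_test_fun p : K p -> test_fun p.
Proof.
move=> [mp ph _]; have [mh [B [r [B0 hB hr]]]] := bh; split => //.
exists B, r; split => // x.
  have /andP[p0 px] := ph x; rewrite ger0_norm//; apply: le_trans px _.
  by have := hB x; rewrite ger0_norm.
move=> px; apply: hr; apply: contraNneq px => hx0.
by have := ph x; rewrite hx0; move/le_anti => <-.
Qed.

Lemma rho_comb u v (a b : R) : measurable_fun setT u -> measurable_fun setT v ->
  0 <= a -> 0 <= b -> a + b = 1 -> (rho (eabs u) <= c%:E)%E -> (rho (eabs v) <= c%:E)%E ->
  (rho (eabs (fun x => a * u x + b * v x)%R) <= c%:E)%E.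
Proof.
move=> mu_ mv a0 b0 ab uc vc.
have nu := eabs_nnm mu_; have nv := eabs_nnm mv.
have na := nnm_scale nu a0; have nb := nnm_scale nv b0.
apply: (@le_trans _ _ (rho (fun x => a%:E * eabs u x + b%:E * eabs v x))%E).
  apply: rho_mono => //; first exact: nnm_add.
    by apply: eabs_nnm; apply: measurable_funD; exact: measurable_funM.
  move=> x; rewrite /eabs -!EFinM -EFinD lee_fin.
  by apply: le_trans (ler_normD _ _) _; rewrite !normrM (ger0_norm a0) (ger0_norm b0).
apply: le_trans (bbn_triangle Hr na nb) _.
rewrite -[c]mul1r -ab mulrDl EFinD !EFinM; apply: leeD.
  by apply: le_trans (rho_scale Hr nu a0) _; apply: lee_wpmul2l.
by apply: le_trans (rho_scale Hr nv b0) _; apply: lee_wpmul2l.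
Qed.

Let Q p := ip (fun x => h x - p x) (fun x => h x - p x).

Let QE p : test_fun p -> Q p = ip h h - 2 * ip h p + ip p p.
Proof. by move=> bp; rewrite /Q ip_BB// [ip p h]ipC; ring. Qed.

Let m := inf [set Q p | p in K].

Let K0 : K (fun=> 0).
Proof.
split; first exact: measurable_cst.
  by move=> x; rewrite lexx h0.
by rewrite eabs0 (rho0 Hr) lee_fin ltW.
Qed.

Let has_infQ : has_inf [set Q p | p in K].
Proof.
split; first by exists (Q (fun=> 0)); exists (fun=> 0) => //; exact: K0.
by exists 0 => _ [p _ <-]; exact: ip_ge0.
Qed.

Let m_le p : K p -> m <= Q p.
Proof. by move=> Kp; apply: ge_inf; [exact: has_infQ.2|exists p]. Qed.

(** The parallelogram identity at the midpoint, which lies in the convex set K. *)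
Let par p q : K p -> K q ->
  ip (fun x => p x - q x) (fun x => p x - q x) <= 2 * (Q p + Q q) - 4 * m.
Proof.
move=> Kp Kq; have bp := K_test_fun Kp; have bq := K_test_fun Kq.
have Kpq : K (fun x => 2^-1 * p x + 2^-1 * q x).
  have [mp p1 p2] := Kp; have [mq q1 q2] := Kq; split.
  - by apply: measurable_funD; exact: measurable_funM.
  - by move=> x; have := p1 x; have := q1 x; lra.
  - by apply: rho_comb => //; lra.
have := m_le Kpq; rewrite !QE//; last exact: K_test_fun.
rewrite ip_BB// [ip q p]ipC.
have lp := test_fun_locint bp; have lq := test_fun_locint bq; have lh := test_fun_locint bh.
have b1 := test_funZ 2^-1 bp; have b2 := test_funZ 2^-1 bq.
have -> : ip h (fun x => 2^-1 * p x + 2^-1 * q x) = 2^-1 * ip h p + 2^-1 * ip h q.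
  by rewrite ipDr// !ipZr.
have -> : ip (fun x => 2^-1 * p x + 2^-1 * q x) (fun x => 2^-1 * p x + 2^-1 * q x) =
   4^-1 * (ip p p + 2 * ip p q + ip q q).
  rewrite ipDr//; last exact/test_fun_locint/test_funD.
  rewrite !ipDl//; try exact: test_fun_locint.
  rewrite !ipZl// !ipZr// [ip q p]ipC; lra.
lra.
Qed.

(** A minimizing sequence with geometric rate is Cauchy in L^2, hence in L^1 on the box. Its
    lower limit is the candidate, because the norm passes to increasing limits: the infima
    of the tails lie below members of the sequence, so they have norm at most c. *)
Lemma exists_minimizer : exists2 p, K p & Q p <= m.
Proof.
have /choice[p Hp] : forall k : nat, exists p, K p /\ Q p < m + 4 ^ (- k%:Z).
  move=> k; have e0 : (0 : R) < 4 ^ (- k%:Z) by rewrite exprz_gt0.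
  by have [_ [p Kp <-] H] := inf_adherent e0 has_infQ; exists p.
have Kp k := (Hp k).1; have Qp k := (Hp k).2; have bp k := K_test_fun (Kp k).
have four k : (4 : R) ^ (- k%:Z) = 2 ^ (- k%:Z) * 2 ^ (- k%:Z).
  by rewrite -expfzMl; congr (_ ^ _); rewrite -natrM.
have four_mono k : (4 : R) ^ (- k.+1%:Z) <= 4 ^ (- k%:Z).
  by rewrite !expNz lef_pV2 ?posrE ?exprn_gt0// exprS ler_peMl// ?exprn_ge0// ler1n.
have [mh [B [r [B0 hB hr]]]] := bh.
pose chi1 : E -> R := \1_(box r).
have bchi : test_fun chi1.
  split; first by apply: measurable_indic; exact: measurable_box.
  exists 1, r; split => // x; first by rewrite /chi1 indicE; case: (_ \in _); rewrite ?normr1 ?normr0.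
  by rewrite /chi1 indicE; case: (boolP (_ \in _)); rewrite ?inE// eqxx.
have chi0 x : 0 <= chi1 x by rewrite /chi1 indicE.
have px k x : 0 <= p k x <= h x by have [_ + _] := Kp k.
have psupp k x : ~ box r x -> p k x = 0.
  move=> xr; have := px k x; suff -> : h x = 0 by move/le_anti.
  by apply/eqP/negPn/negP => /hr.
pose w k x := `|p k x - p k.+1 x|.
have bw k : test_fun (w k) by apply: test_fun_norm; exact: test_funB.
have lw k := test_fun_locint (bw k).
pose A : R := 2 + ip chi1 chi1.
have A0 : 0 <= A by rewrite addr_ge0// ip_ge0.
have wchi k x : w k x * chi1 x = w k x.
  have [xr|xr] := pselect (box r x); first by rewrite /chi1 indicE mem_set// mulr1.
  by rewrite /w !psupp// subrr normr0 mul0r.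
have Iw k : ip (w k) chi1 <= A * 2 ^ (- k%:Z).
  have p2 := pow2_gt0 R k%:Z.
  have := ip_CS p2 (bw k) bchi.
  have W1 : ip (w k) (w k) <= 4 * 4 ^ (- k%:Z).
    have -> : ip (w k) (w k) = ip (fun x => p k x - p k.+1 x) (fun x => p k x - p k.+1 x).
      by apply: eq_Rintegral => x _; rewrite -normrM -expr2 ger0_norm// sqr_ge0.
    apply: le_trans (par (Kp k) (Kp k.+1)) _.
    have := Qp k; have := Qp k.+1; have := four_mono k; lra.
  rewrite -pow2N => H.
  have : 2 * ip (w k) chi1 <= 2 * (A * 2 ^ (- k%:Z)); last by rewrite ler_pM2l.
  have := ler_norm (ip (w k) chi1).
  have : 2 ^ k%:Z * ip (w k) (w k) <= 4 * 2 ^ (- k%:Z).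
    apply: (@le_trans _ _ (2 ^ k%:Z * (4 * 4 ^ (- k%:Z)))); first by rewrite ler_pM2l.
    rewrite four pow2N; set t := 2 ^ k%:Z.
    have -> : t * (4 * (t^-1 * t^-1)) = 4 * ((t * t^-1) * t^-1) by ring.
    by rewrite mulfV ?pow2_neq0// mul1r.
  rewrite /A; have := ip_ge0 chi1; have := pow2_gt0 R (- k%:Z).
  move: H; set a := ip chi1 chi1; set t := 2 ^ (- k%:Z) => H t0 a0.
  have : 0 <= t * a by rewrite mulr_ge0// ltW.
  lra.
(* The Fatou property concerns increasing sequences, hence the infima of the tails. *)
pose F k x : \bar R := einfs (fun l => (p l x)%:E) k.
have F_le k l x : (k <= l)%N -> (F k x <= (p l x)%:E)%E.
  by move=> kl; apply: ereal_inf_lbound; exists l.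
have F_ge k x (a : \bar R) : (forall l, (k <= l)%N -> (a <= (p l x)%:E)%E) -> (a <= F k x)%E.
  by move=> H; apply: le_ereal_inf_tmp => _ [l /= kl <-]; exact: H.
have F0 k x : (0 <= F k x)%E.
  by apply: F_ge => l _; rewrite lee_fin; have /andP[] := px l x.
have mF k : measurable_fun setT (F k).
  by apply: measurable_fun_einfs => l; apply/measurable_EFinP; have [] := Kp l.
have ndF x : nondecreasing_seq (F ^~ x) by exact: nondecreasing_einfs.
pose P x : \bar R := limn (F ^~ x).
have cvF x : F k x @[k --> \oo] --> P x by exact: ereal_nondecreasing_is_cvgn.
have P_ge k x : (F k x <= P x)%E.
  have -> : P x = ereal_sup (range (F ^~ x)).
    by apply/cvg_lim => //; exact: ereal_nondecreasing_cvgn (ndF x).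
  by apply: ereal_sup_ubound; exists k.
have P_le x (a : \bar R) : (forall k, (F k x <= a)%E) -> (P x <= a)%E.
  by move=> H; apply: lime_le; [exact: ereal_nondecreasing_is_cvgn|exact: nearW].
have mP : measurable_fun setT P by apply: (emeasurable_fun_cvg F).
have P0 x : (0 <= P x)%E by apply: le_trans (F0 0%N x) _.
have Ph x : (P x <= (h x)%:E)%E.
  apply: P_le => k; apply: le_trans (F_le k k x (leqnn k)) _.
  by rewrite lee_fin; have /andP[] := px k x.
have Pfin x : P x \is a fin_num.
  by rewrite ge0_fin_numE//; apply: le_lt_trans (Ph x) _; exact: ltry.
pose pp x := fine (P x).
have ppE x : (pp x)%:E = P x by rewrite fineK.
have Kpp : K pp.
  split.
  - exact: measurableT_comp.
  - by move=> x; rewrite -!lee_fin ppE P0 Ph.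
  - have -> : eabs pp = P.
      by apply/funext => x; rewrite /eabs ger0_norm ?ppE// fine_ge0.
    have [|_ cv] := @bbn_Fatou _ _ _ Hr F P (fun k => conj (mF k) (F0 k)) (conj mP P0).
      by apply: aeW => x.
    rewrite -(cvg_lim _ cv)//; apply: lime_le; first by apply/cvg_ex; exists (rho P).
    apply: nearW => k; have [mpk _ pc] := Kp k; apply: le_trans pc.
    apply: (rho_mono Hr) => //; first exact: eabs_nnm.
    by move=> x; rewrite /eabs ger0_norm ?F_le//; have /andP[] := px k x.
exists pp => //.
have bpp := K_test_fun Kpp.
pose s k x : \bar R := (\sum_(0 <= i <oo) (w (k + i)%N x)%:E)%E.
have w0 i x : (0 <= (w i x)%:E)%E by rewrite lee_fin /w normr_ge0.
have s_ge k l x : (`|p k x - p (k + l)%N x|%:E <= s k x)%E.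
  apply: (@le_trans _ _ (\sum_(0 <= i < l) (w (k + i)%N x)%:E)%E); last first.
    by apply: nneseries_lim_ge.
  rewrite sumEFin lee_fin; elim: l => [|l IH].
    by rewrite addn0 subrr normr0 big_geq.
  rewrite big_nat_recr//= addnS.
  have -> : p k x - p (k + l).+1 x = (p k x - p (k + l)%N x) +
    (p (k + l)%N x - p (k + l).+1 x) by ring.
  by apply: le_trans (ler_normD _ _) _; rewrite lerD.
have near_pp k x : (`|pp x - p k x|%:E <= s k x)%E.
  case sx : (s k x) => [S| |]; last first.
  - by have := s_ge k 0%N x; rewrite sx leeNy_eq.
  - by rewrite leey.
  have H l : (k <= l)%N -> `|p k x - p l x| <= S.
    by move=> kl; have := s_ge k (l - k)%N x; rewrite subnKC// sx lee_fin.
  rewrite lee_fin ler_distl -!lee_fin ppE; apply/andP; split.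
    apply: le_trans (P_ge k x); apply: F_ge => l /H.
    by rewrite lee_fin ler_norml; lra.
  apply: P_le => l; apply: le_trans (F_le l (maxn k l) x (leq_maxr _ _)) _.
  by have := H (maxn k l) (leq_maxl _ _); rewrite lee_fin ler_norml; lra.
have L1 k : ip (fun x => `|pp x - p k x|) chi1 <= 2 * A * 2 ^ (- k%:Z).
  have bd : test_fun (fun x => `|pp x - p k x|) by apply: test_fun_norm; exact: test_funB.
  have ld := test_fun_locint bd.
  rewrite -lee_fin ipE//.
  apply: (@le_trans _ _ (\int[mu]_x s k x)%E).
    apply: ge0_le_integral => //.
    - by move=> x _; rewrite lee_fin mulr_ge0.
    - by apply/measurable_EFinP; apply: measurable_funM; [exact: bd.1|exact: bchi.1].
    - by apply: ge0_emeasurable_sum => // i _; apply/measurable_EFinP; exact: (bw _).1.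
    - move=> x _; apply: le_trans (near_pp k x); rewrite lee_fin ler_piMr//.
      by rewrite /chi1 indicE; case: (_ \in _).
  rewrite integral_nneseries//; last by move=> i; apply/measurable_EFinP; exact: (bw _).1.
  have Iw' i : (\int[mu]_x (w i x)%:E <= (A * 2 ^ (- i%:Z))%:E)%E.
    apply: le_trans (_ : _ <= (ip (w i) chi1)%:E)%E _; last by rewrite lee_fin.
    by rewrite ipE//; under [leRHS]eq_integral do rewrite wchi.
  apply: lime_le; first by apply: is_cvg_nneseries => i _ _; exact: integral_ge0.
  apply: nearW => N.
  apply: (@le_trans _ _ (\sum_(0 <= i < N) (A * 2 ^ (- (k + i)%N%:Z))%:E)%E).
    exact: lee_sum.
  rewrite sumEFin lee_fin.
  suff : \sum_(0 <= i < N) A * 2 ^ (- (k + i)%N%:Z) <=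
      2 * A * 2 ^ (- k%:Z) - 2 * A * 2 ^ (- (k + N)%N%:Z).
    move/le_trans; apply; rewrite gerBl; apply: mulr_ge0; first exact: mulr_ge0.
    by apply: ltW; exact: pow2_gt0.
  elim: N => [|N IH]; first by rewrite big_geq// addn0 subrr.
  rewrite big_nat_recr//=; apply: (le_trans (lerD IH (lexx _))).
  have -> : (2 : R) ^ (- (k + N.+1)%N%:Z) = 2^-1 * 2 ^ (- (k + N)%N%:Z).
    by rewrite addnS !expNz exprS invfM.
  move: (2 ^ _) (2 ^ _) => a b; lra.
apply: (@small_le _ _ _ (1 + 4 * B * A)) => k.
have Qd : Q pp <= Q (p k) + 2 * B * ip (fun x => `|pp x - p k x|) chi1.
  have bd : test_fun (fun x => `|pp x - p k x|) by apply: test_fun_norm; exact: test_funB.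
  have ld := test_fun_locint bd.
  have b1 := test_funB bh bpp; have b2 := test_funB bh (bp k).
  have l1 := test_fun_locint b1; have l2 := test_fun_locint b2.
  have -> : Q (p k) + 2 * B * ip (fun x => `|pp x - p k x|) chi1 =
    \int[mu]_x ((h x - p k x) * (h x - p k x) + 2 * B * (`|pp x - p k x| * chi1 x)).
    rewrite RintegralD//; last 2 first.
    - exact: integrableM l2 b2.
    - by have := integrableZl measurableT (2 * B) (integrableM ld bchi).
    rewrite RintegralZl//; exact: integrableM.
  apply: le_Rintegral => //; first exact: integrableM l1 b1.
    have := integrableD measurableT (integrableM l2 b2)
      (integrableZl measurableT (2 * B) (integrableM ld bchi)).
    exact: eq_integrable.
  move=> x _.
  have [xr|xr] := pselect (box r x); last first.
    have pk0 := psupp k x xr.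
    have hx0 : h x = 0 by apply/eqP/negPn/negP => /hr.
    have pp0 : pp x = 0.
      by have [_ + _] := Kpp => /(_ x); rewrite hx0 => /le_anti.
    by rewrite pk0 hx0 pp0 !subrr normr0 !mul0r mulr0 addr0.
  rewrite /chi1 indicE mem_set// mulr1.
  have [_ + _] := Kpp => /(_ x) /andP[a1 a2]; have /andP[a3 a4] := px k x.
  have := hB x; rewrite ger0_norm// => a5.
  have -> : (h x - pp x) * (h x - pp x) = (h x - p k x) * (h x - p k x) +
     (p k x - pp x) * ((h x - pp x) + (h x - p k x)) by ring.
  rewrite lerD2l [leRHS]mulrC; apply: le_trans (ler_norm _) _; rewrite normrM distrC.
  rewrite ler_wpM2l// ger0_norm; lra.
apply: le_trans Qd _.
have f4 : (4 : R) ^ (- k%:Z) <= 2 ^ (- k%:Z).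
  by rewrite !expNz lef_pV2 ?posrE ?exprn_gt0// lerXn2r ?nnegrE// ler_nat.
have := Qp k; have := ler_wpM2l (_ : 0 <= 2 * B) (L1 k).
rewrite mulr_ge0// => /(_ isT).
have -> : 2 * B * (2 * A * 2 ^ (- k%:Z)) = 4 * B * A * 2 ^ (- k%:Z) by ring.
rewrite mulrDl mul1r; lra.
Qed.

Lemma ip0_ae g : test_fun g -> ip g g <= 0 -> {ae mu, forall x, g x = 0}.
Proof.
move=> bg g0; have [mg _] := bg.
have : (\int[mu]_x `|(g x ^+ 2)%:E| = 0)%E.
  apply/eqP; rewrite eq_le; apply/andP; split; last by apply: integral_ge0.
  apply: le_trans (_ : _ <= (ip g g)%:E)%E _; last by rewrite lee_fin.
  rewrite ipE//; last exact: test_fun_locint.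
  rewrite le_eqVlt; apply/orP; left; apply/eqP/eq_integral => x _ /=.
  by rewrite ger0_norm ?sqr_ge0// expr2.
move/ae_eq_integral_abs => H.
have /H : measurable_fun setT (fun x => (g x ^+ 2)%:E).
  by apply/measurable_EFinP; exact: measurable_funX.
move=> /(_ measurableT); apply: filterS => x /(_ I) /= [] /eqP.
by rewrite sqrf_eq0 => /eqP.
Qed.

(** Let p be the point closest to h, in L^2, among the functions between 0 and h of norm at
    most c, and g = h - p. Minimality gives <g, v> <= <g, p> for all v >= 0 of norm at most c,
    that is c kd g <= <g, p>. As <h, g> <= c kd g by assumption, <g, g> <= 0 and h = p. *)
Lemma LL_bounded : (forall g, test_fun g -> (forall x, 0 <= g x) ->
    (\int[mu]_x (eabs h x * eabs g x) <= c%:E * kd (eabs g))%E) ->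
  (rho (eabs h) <= c%:E)%E.
Proof.
move=> H; have [p Kp Qp] := exists_minimizer; have bp := K_test_fun Kp.
have [mp ph pc] := Kp.
pose g x := h x - p x.
have bg : test_fun g by exact: test_funB.
have g0 x : 0 <= g x by rewrite subr_ge0; have /andP[] := ph x.
have lg := test_fun_locint bg.
have vari v : test_fun v -> (forall x, 0 <= v x) -> (rho (eabs v) <= c%:E)%E ->
    ip g v <= ip g p.
  move=> bv v0 vc; pose d x := v x - p x.
  have bd : test_fun d by exact: test_funB.
  suff : 2 * ip g d <= 0.
    by rewrite /d ipBr//; lra.
  apply: (@small_le _ _ _ (ip d d)) => k; rewrite add0r.
  have e0 := pow2_gt0 R (- k%:Z).
  have e1 : (2 : R) ^ (- k%:Z) <= 1.
    by rewrite expNz invf_le1 ?exprn_gt0// exprn_ege1// ler1n.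
  move: (2 ^ (- k%:Z)) e0 e1 => e e0 e1.
  pose z x := (1 - e) * p x + e * v x.
  have mz : measurable_fun setT z by apply: measurable_funD; apply: measurable_funM => //; exact: bv.1.
  have z0 x : 0 <= z x.
    rewrite addr_ge0// mulr_ge0//; [by rewrite subr_ge0| |exact: ltW].
    by have /andP[] := ph x.
  (* Cutting z at h keeps it in the ball and only brings it closer to h. *)
  pose pe x := Num.min (h x) (z x).
  have mpe : measurable_fun setT pe by apply: measurable_minr => //; exact: bh.1.
  have pe0 x : 0 <= pe x by rewrite le_min h0 z0.
  have Kpe : K pe.
    split => //; first by move=> x; rewrite pe0 ge_min lexx.
    apply: (@le_trans _ _ (rho (eabs z))).
      apply: rho_mono => //; [exact: eabs_nnm|exact: eabs_nnm|].
      by move=> x; rewrite /eabs !ger0_norm// lee_fin ge_min lexx orbT.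
    apply: rho_comb => //; [exact: bv.1|by rewrite subr_ge0|exact: ltW|by rewrite subrK].
  have := le_trans Qp (m_le Kpe).
  have bpe := K_test_fun Kpe.
  have bed : test_fun (fun x => e * d x) by exact: test_funZ.
  have led := test_fun_locint bed; have ld := test_fun_locint bd.
  move=> /le_trans /(_ (@ip_le_sqr _ _ _ (fun x => g x - e * d x) (test_funB bh bpe) (test_funB bg bed) _)).
  have pw x : (h x - pe x) ^+ 2 <= (g x - e * d x) ^+ 2.
    have -> : g x - e * d x = h x - z x by rewrite /g /d /z; ring.
    rewrite /pe minEle; case: ifP => hz; last by [].
    by rewrite subrr expr0n sqr_ge0.
  move=> /(_ pw); rewrite -/(Q p) (ip_BB bg bed bg bed).
  rewrite [ip (fun x => e * d x) g]ipC !ipZr// !ipZl// -[Q p]/(ip g g) => Hm.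
  have : e * (2 * ip g d) <= e * (ip d d * e) by lra.
  by rewrite ler_pM2l.
have kdg : (c%:E * kd (eabs g) <= (ip g p)%:E)%E.
  rewrite -lee_pdivlMl// -EFinM; apply: ge_ereal_sup => _ [f [fX f1] <-].
  have nf := nnm_cmodf fX.1.
  apply: integral_trunc_at_le => //; first exact: eabs_nnm bg.1.
  move=> N; have bt := trunc_at_test_fun N nf.
  have t0 x : 0 <= trunc_at N (cmodf f) x by rewrite trunc_at_ge0// nf.2.
  have bct : test_fun (fun x => c * trunc_at N (cmodf f) x) by exact: test_funZ.
  have := vari _ bct (fun x => mulr_ge0 (ltW c0) (t0 x)).
  have -> : eabs (fun x => c * trunc_at N (cmodf f) x) = (fun x => c%:E * eabs (trunc_at N (cmodf f)) x)%E.
    by apply/funext => x; rewrite /eabs normrM gtr0_norm// EFinM.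
  have rt : (rho (fun x => c%:E * eabs (trunc_at N (cmodf f)) x) <= c%:E)%E.
    apply: le_trans (rho_scale Hr (eabs_nnm bt.1) (ltW c0)) _.
    rewrite -[leRHS]mule1; apply: lee_wpmul2l; first by rewrite lee_fin ltW.
    apply: le_trans f1; apply: rho_mono => //; first exact: eabs_nnm bt.1.
    by move=> x; rewrite /eabs ger0_norm// trunc_at_le// nf.2.
  move=> /(_ rt); rewrite ipZr// -ler_pdivlMl// -lee_fin ipE//; apply: le_trans.
  rewrite le_eqVlt; apply/orP; left; apply/eqP/eq_integral => x _.
  by rewrite /eabs (ger0_norm (g0 x)) -EFinM mulrC.
have := le_trans (H g bg g0) kdg.
have -> : (\int[mu]_x (eabs h x * eabs g x) = (ip h g)%:E)%E.
  rewrite ipE//; last exact: test_fun_locint.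
  by apply: eq_integral => x _; rewrite /eabs !ger0_norm.
rewrite lee_fin => Hhg.
have : ip g g <= 0.
  have -> : ip g g = ip g h - ip g p by rewrite -ipBr.
  by rewrite subr_le0 [ip g h]ipC.
move/(ip0_ae bg) => ae0.
apply: le_trans pc; apply: (bbn_mono Hr); [exact: eabs_nnm|exact: eabs_nnm bh.1|].
by apply: filterS ae0 => x; rewrite /g /eabs => /eqP; rewrite subr_eq0 => /eqP ->.
Qed.

End bounded.

(** The truncations of f inherit the hypothesis, and the norm passes to increasing limits. *)
Theorem lorentz_luxemburg (f : E -> \bar R) (c : R) : nonneg_measurable f -> 0 < c ->
  (forall g, test_fun g -> (forall x, 0 <= g x) ->
    (\int[mu]_x (f x * eabs g x) <= c%:E * kd (eabs g))%E) ->
  (rho f <= c%:E)%E.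
Proof.
move=> nf c0 H.
have t0 N x : 0 <= trunc_at N f x by rewrite trunc_at_ge0// nf.2.
have enT N : eabs (trunc_at N f) = fun x => (trunc_at N f x)%:E.
  by apply/funext => x; rewrite /eabs ger0_norm.
have rt N : (rho (fun x => (trunc_at N f x)%:E) <= c%:E)%E.
  rewrite -enT; apply: LL_bounded => //; first exact: trunc_at_test_fun.
  move=> g bg g0; apply: le_trans (H g bg g0).
  have ng := eabs_nnm bg.1; have nt := eabs_nnm (trunc_at_test_fun N nf).1.
  apply: ge0_le_integral => //.
  - by move=> x _; exact: (nnm_mul nt ng).2.
  - exact: (nnm_mul nt ng).1.
  - exact: (nnm_mul nf ng).1.
  - move=> x _; apply: lee_wpmul2r; first exact: ng.2.
    by rewrite enT; apply: trunc_at_le; exact: nf.2.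
have nt N : nonneg_measurable (fun x => (trunc_at N f x)%:E).
  by rewrite -enT; apply: eabs_nnm; exact: (trunc_at_test_fun N nf).1.
have [|_ cv] := @bbn_Fatou _ _ _ Hr (fun N x => (trunc_at N f x)%:E) f nt nf.
  by apply: aeW => x; split; [exact: trunc_at_mono (nf.2 x)|exact: trunc_at_cvg (nf.2 x)].
rewrite -(cvg_lim _ cv)//; apply: lime_le; first by apply/cvg_ex; exists (rho f).
exact: nearW.
Qed.

End lorentz_luxemburg.

(** * The bilinear bound over the whole space *)

Section sqrte_lemmas.
Variable R : realType.
Implicit Types a b : \bar R.

Lemma le_sqrte a b : (a <= b)%E -> (sqrte a <= sqrte b)%E.
Proof.
case: a => [r| |]; case: b => [s| |] //=; rewrite ?lee_fin ?leey// => H.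
exact: ler_wsqrtr.
Qed.

Lemma sqrteD_le a b : (0 <= a)%E -> (0 <= b)%E -> (sqrte (a + b) <= sqrte a + sqrte b)%E.
Proof.
case: a => [r| |]; case: b => [s| |] //=; rewrite ?lee_fin ?leey// => r0 s0.
apply: sqrt_leP; first by rewrite addr_ge0.
by rewrite sqrrD !sqr_sqrtr// addrAC lerDl mulrn_wge0// mulr_ge0.
Qed.

Lemma sqrte_sum_le (I : Type) (s : seq I) (F : I -> \bar R) : (forall i, (0 <= F i)%E) ->
  (sqrte (\sum_(i <- s) F i) <= \sum_(i <- s) sqrte (F i))%E.
Proof.
move=> F0; elim: s => [|i s IH]; first by rewrite !big_nil /= sqrtr0.
rewrite !big_cons; apply: le_trans (sqrteD_le _ _) _ => //; first exact: sume_ge0.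
exact: leeD2l.
Qed.

End sqrte_lemmas.

Section generator_norms.
Variables (R : realType) (n : nat).
Local Notation E := 'rV[R]_n.
Local Notation Zn := 'rV[int]_n.
Local Notation mu := (@lebesgue_rV R n).
Implicit Types (x y z : E) (u v g : E -> R) (j : int) (q k : Zn).

Lemma nbh_fine s e k k' : k \in nbh s e (anc e k') -> k \in nbh (s.+1 * 2 ^ e) 0 k'.
Proof.
rewrite !mem_nbh => /forallP H; apply/forallP => i; rewrite anc0.
have := H i; rewrite !mxE.
have N0 : (0 : int) < 2 ^+ e by exact: exprn_gt0.
have NE : (2 ^ e)%N%:Z = 2 ^+ e :> int by rewrite -[LHS]natz natrX.
rewrite PoszM NE; move: (k ord0 i) (k' ord0 i) N0; move: (2 ^+ e) => N a b N0.
have := divz_eq a N; have := divz_eq b N.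
have := modz_ge0 a (lt0r_neq0 N0); have := modz_ge0 b (lt0r_neq0 N0).
have := ltz_pmod a N0; have := ltz_pmod b N0.
move: (a %/ N)%Z (b %/ N)%Z (a %% N)%Z (b %% N)%Z => qa qb ra rb.
move=> h1 h2 h3 h4 -> ->; rewrite !ler_norml => /andP[h5 h6].
have : (qa - qb) * N <= s%:Z * N by rewrite ler_wpM2r// ltW.
have : - s%:Z * N <= (qa - qb) * N by rewrite ler_wpM2r// ltW.
rewrite -[s.+1]addn1 PoszD !mulrDl !mulNr mul1r => h7 h8; apply/andP; split; lia.
Qed.

Section one_generator.
Variables (s0 : nat) (L : R) (psi : E -> R) (J : int) (p0 : nat).
Hypothesis n0 : (0 < n)%N.
Hypothesis gp : lip_gen s0 L psi.
Let s := s0.+1.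
Let J' := J + p0%:Z.
Let B : R := L * (2 * s0%:R + 1).
Let t0 : nat := (s.+1 * 2 ^ p0)%N.

Let B0 : 0 <= B.
Proof. by have [L0 _ _] := gp; rewrite mulr_ge0// addr_ge0// mulr_ge0. Qed.

Lemma region_coarse (i : nat) x : (i <= p0)%N ->
  region (J + i%:Z) (nbh s 0 (cellix (J + i%:Z) x)) `<=` (region J' (nbh t0 0 (cellix J' x)) : set E).
Proof.
move=> ile y; have E1 : J + i%:Z = J' - (p0 - i)%N%:Z by rewrite /J'; lia.
rewrite E1 -region_nbh /region/= cellix_anc => /nbh_fine; rewrite !mem_nbh => /forallP H.
apply/forallP => a; apply: le_trans (H a) _.
by rewrite lez_nat leq_mul2l leq_pexp2l ?orbT// leq_subr.
Qed.

(** At the first p0 levels a single average over cells of level J + p0 dominates the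
    coefficients; the balls around those coarse cells may have radius above 1. *)
Lemma ncoef_coarse (i : nat) u x : (i <= p0)%N -> locint u ->
  `|ncoef psi u (J + i%:Z) (cellix (J + i%:Z) x)| <= B * avg t0 J' u x.
Proof.
move=> ile lu; set j := J + i%:Z; set q := cellix j x.
have br := rescaled_test_fun j q n0 gp; have [mr _] := br.
have lu' := locint_norm lu.
have rB y : `|rescaled psi j q y| <= B by exact: (lip_gen_bounded n0 gp).
rewrite /ncoef normrM (@ger0_norm _ (_^-1)) ?invr_ge0 ?(ltW (cell_vol_gt0 _ _ _))//.
have wtle : (cell_vol R n j)^-1 <= (cell_vol R n J')^-1.
  rewrite lef_pV2 ?posrE ?cell_vol_gt0// (_ : j = J' - (p0 - i)%N%:Z); last by rewrite /j /J'; lia.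
  by rewrite cell_volB ler_peMr ?(ltW (cell_vol_gt0 _ _ _))// /W !exprn_ege1// ler1n.
have I0 : 0 <= \int[mu]_(y in region J' (nbh t0 0 (cellix J' x))) `|u y| by apply: Rintegral_ge0.
rewrite /avg mulrCA; apply: ler_pM => //; first by rewrite invr_ge0 ltW// cell_vol_gt0.
have mR := measurable_region J' (nbh t0 0 (cellix J' x)) (R := R) (n := n).
have iu : mu.-integrable (region J' (nbh t0 0 (cellix J' x))) (EFin \o u).
  exact: locint_region (uniq_nbh _ _ _) lu.
have iu' : mu.-integrable (region J' (nbh t0 0 (cellix J' x))) (EFin \o (fun y => `|u y|)).
  exact: locint_region (uniq_nbh _ _ _) lu'.
rewrite /ip (@Rintegral_supp _ _ _ (region J' (nbh t0 0 (cellix J' x))))//; last first.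
  move=> y; rewrite mulf_eq0 negb_or => /andP[_ /(rescaled_supp gp) yr].
  by apply: (region_coarse ile).
have i2 : mu.-integrable (region J' (nbh t0 0 (cellix J' x))) (EFin \o (fun y => u y * rescaled psi j q y)).
  exact: integrable_bounded_mul rB iu.
apply: le_trans (le_normr_Rintegral mR i2) _.
rewrite -RintegralZl//; apply: le_Rintegral => //.
- by have := integrable_abse i2.
- by have := integrableZl mR B iu'.
- by move=> y _; rewrite normrM mulrC ler_wpM2r.
Qed.

Hypothesis p0_big : (cM n s)%:R < (2 : R) ^ (J + p0%:Z).
Hypothesis HB : bessel_from psi J.

(** Each level contributes through the one half-open cell that contains x. *)
Definition sqfun u x : \bar R :=
  (\sum_(0 <= i <oo) (ncoef psi u (J + i%:Z) (cellix (J + i%:Z) x) ^+ 2)%:E)%E.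

Let tail u (D : nat) x : R := sqfun_trunc psi J p0 D u x.

Let tail_mono u x : nondecreasing_seq (fun D => (tail u D x)%:E).
Proof.
move=> D D' DD'; rewrite lee_fin /tail /sqfun_trunc ler_wsqrtr//.
rewrite -!(big_mkord xpredT (fun i => ncoef psi u (J + (p0 + i)%N%:Z)
  (cellix (J + (p0 + i)%N%:Z) x) ^+ 2)) (big_cat_nat (n := D) (p := D'))//= lerDl.
by apply: sumr_ge0 => i _; exact: sqr_ge0.
Qed.

Let sqfun_split u x : (sqrte (sqfun u x) <=
  \sum_(i < p0) `|ncoef psi u (J + i%:Z) (cellix (J + i%:Z) x)|%:E +
  limn (fun D => (tail u D x)%:E))%E.
Proof.
pose c i := ncoef psi u (J + i%:Z) (cellix (J + i%:Z) x).
set Lim := limn _.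
set S := (\sum_(i < p0) _)%E.
have S0 : (0 <= S)%E by apply: sume_ge0 => i _; rewrite lee_fin.
have Lub D : ((tail u D x)%:E <= Lim)%E.
  have -> : Lim = ereal_sup (range (fun D => (tail u D x)%:E)).
    by apply/cvg_lim => //; exact: ereal_nondecreasing_cvgn (tail_mono u x).
  by apply: ereal_sup_ubound; exists D.
have Lim0 : (0 <= Lim)%E by apply: le_trans (Lub 0%N); rewrite lee_fin sqrtr_ge0.
have H D : (sqrte (\sum_(0 <= i < p0 + D) (c i ^+ 2)%:E) <= S + Lim)%E.
  rewrite (big_cat_nat (n := p0) (p := p0 + D)) ?leq_addr//=.
  apply: le_trans (sqrteD_le _ _) _; try by (apply: sume_ge0 => i _; rewrite lee_fin sqr_ge0).
  apply: leeD.
    apply: le_trans (sqrte_sum_le _ _) _; first by move=> i; rewrite lee_fin sqr_ge0.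
    rewrite big_mkord; apply: lee_sum => i _ /=.
    by rewrite sqrtr_sqr.
  rewrite sumEFin /=; apply: le_trans (Lub D); rewrite lee_fin /tail /sqfun_trunc ler_wsqrtr//.
  rewrite -{1}[p0]add0n big_addn addKn big_mkord.
  by apply/eq_ler/eq_bigr => i _; rewrite addnC.
case E1 : (S + Lim)%E => [r| |]; last 2 first.
- by rewrite leey.
- by have := adde_ge0 S0 Lim0; rewrite E1.
have r0 : 0 <= r by rewrite -lee_fin -E1 adde_ge0.
suff : (sqfun u x <= (r ^+ 2)%:E)%E.
  by move/le_sqrte; rewrite /= sqrtr_sqr ger0_norm.
apply: lime_le; first by apply: is_cvg_nneseries => i _ _; rewrite lee_fin sqr_ge0.
apply: nearW => D.
apply: (@le_trans _ _ (\sum_(0 <= i < p0 + D) (c i ^+ 2)%:E)%E).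
  rewrite (big_cat_nat (n := D) (p := p0 + D)) ?leq_addl//= leeDl//.
  by apply: sume_ge0 => i _; rewrite lee_fin sqr_ge0.
have := H D; rewrite E1 sumEFin /= !lee_fin => H'.
have P0 : 0 <= \sum_(0 <= i < p0 + D) c i ^+ 2 by apply: sumr_ge0 => i _; exact: sqr_ge0.
by rewrite -[leLHS](sqr_sqrtr P0) lerXn2r// nnegrE.
Qed.

Lemma measurable_sqfun u : measurable_fun setT (sqfun u).
Proof.
apply: ge0_emeasurable_sum => [i x _ _|i _]; first by rewrite lee_fin sqr_ge0.
apply/measurable_EFinP.
exact: (@measurable_comp_cellix R n (J + i%:Z) _ _ (fun k => ncoef psi u (J + i%:Z) k ^+ 2)).
Qed.

Lemma sqfun_ge0 u x : (0 <= sqfun u x)%E.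
Proof. by apply: nneseries_ge0 => i _ _; rewrite lee_fin sqr_ge0. Qed.

Lemma measurable_sqrte (f : E -> \bar R) : (forall x, (0 <= f x)%E) ->
  measurable_fun setT f -> measurable_fun setT (fun x => sqrte (f x)).
Proof.
move=> f0 mf.
rewrite (_ : (fun x => sqrte (f x)) = (fun x => poweR (f x) 2^-1)).
  exact: (measurableT_comp (measurable_poweR _) mf).
by apply/funext => x; rewrite poweR12_sqrt.
Qed.

(** The common majorant of the averages over the neighbourhoods of all fine levels. *)
Definition cMloc u x : \bar R := (((cM n s)%:R ^+ n : R)%:E * Mloc (real_fun u) x)%E.

Lemma cMloc_nnm u : measurable_fun setT u -> nonneg_measurable (cMloc u).
Proof. by move=> m; apply: nnm_scale; [exact: Mloc_nnm|rewrite exprn_ge0]. Qed.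

Lemma avg_le_cMloc (i : nat) u x : locint u ->
  ((avg s (J + (p0 + i)%N%:Z) u x)%:E <= cMloc u x)%E.
Proof.
move=> lu; apply: avg_le_Mloc => //; apply: lt_le_trans p0_big _.
rewrite PoszD addrA [leRHS]pow2D ler_peMr//; first exact/ltW/pow2_gt0.
by rewrite -exprnP exprn_ege1// ler1n.
Qed.

Lemma measurable_tail u D : locint u -> measurable_fun setT (tail u D).
Proof. by move=> lu; exact: (measurable_sqfun_trunc J n0 gp p0 D lu). Qed.

(** Monotone convergence, both in the number of levels and in the number of cells of level
    J + p0 taken into account. *)
Let tail_bilinear u g : locint u -> locint g -> (forall x, 0 <= g x) ->
  (\int[mu]_x (limn (fun D => (tail u D x)%:E) * (g x)%:E) <=
   (Ccell n s0 L)%:E * \int[mu]_x (cMloc u x * cMloc g x))%E.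
Proof.
move=> lu lg g0.
pose rg (D : nat) : set E := region J' (nbh D 0 (0 : Zn)).
have rgm D : measurable (rg D) by exact: measurable_region.
pose f (D : nat) x : \bar R := (tail u D x * g x * \1_(rg D) x)%:E.
have tail0 D x : 0 <= tail u D x by exact: sqrtr_ge0.
have f0 D x : (0 <= f D x)%E by rewrite lee_fin !mulr_ge0.
have mf D : measurable_fun setT (f D).
  apply/measurable_EFinP; apply: measurable_funM; last exact: measurable_indic.
  by apply: measurable_funM; [exact: measurable_tail|exact: lg.1].
have rgS D D' x : (D <= D')%N -> x \in rg D -> x \in rg D'.
  move=> DD'; rewrite !inE /rg /region/= !mem_nbh => /forallP H; apply/forallP => i.
  by apply: le_trans (H i) _; rewrite lez_nat.
have ndf x : nondecreasing_seq (f ^~ x).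
  move=> D D' DD'; rewrite lee_fin; apply: ler_pM; rewrite ?mulr_ge0//.
    by rewrite ler_wpM2r// -lee_fin; exact: tail_mono.
  rewrite !indicE; case: (boolP (x \in rg D)) => [xD|_]; last by rewrite ler0n.
  by rewrite (rgS _ _ _ DD' xD).
have lim_f x : limn (f ^~ x) = (limn (fun D => (tail u D x)%:E) * (g x)%:E)%E.
  apply/cvg_lim => //.
  have near1 : \forall D \near \oo, f D x = ((tail u D x)%:E * (g x)%:E)%E.
    exists (\sum_(i < n) `|cellix J' x ord0 i|)%N => // D /= HD.
    rewrite /f indicE mem_set ?mulr1//.
    rewrite /rg /region/= mem_nbh anc0; apply/forallP => i; rewrite [X in _ - X]mxE subr0.
    rewrite -abszE lez_nat; apply: leq_trans HD.
    by rewrite (bigD1 i)//= leq_addr.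
  have [g00|g00] := eqVneq (g x) 0.
    rewrite g00 mule0; apply: cvg_near_cst; apply: filterS near1 => D ->.
    by rewrite g00 mule0.
  apply: (@cvg_trans _ ((tail u D x)%:E * (g x)%:E @[D --> \oo])%E).
    by apply: near_eq_cvg; apply: filterS near1 => D ->.
  apply: cvgeM; last exact: cvg_cst.
    case: (limn _) => [r| |] //=.
  exact: ereal_nondecreasing_is_cvgn (tail_mono u x).
have mMu := cMloc_nnm lu.1; have mMg := cMloc_nnm lg.1.
rewrite (eq_integral _ _ (fun x _ => esym (lim_f x))).
have cv := @cvg_monotone_convergence _ E R mu setT measurableT f mf
  (fun D x _ => f0 D x) (fun x _ => ndf x).
rewrite -(cvg_lim _ cv)//; apply: lime_le.
  by apply/cvg_ex; eexists; exact: cv.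
apply: nearW => D.
have -> : (\int[mu]_x f D x = \int[mu]_(x in rg D) (tail u D x * g x)%:E)%E.
  rewrite [RHS]integral_mkcond; apply: eq_integral => x _.
  by rewrite patchE /f indicE; case: ifP => _; rewrite ?mulr1 ?mulr0.
rewrite ge0_integral_region ?uniq_nbh//; last 2 first.
- by apply/measurable_EFinP/measurable_funM; [exact: measurable_tail|exact: lg.1].
- by move=> x; rewrite lee_fin mulr_ge0.
have C0 : 0 <= Ccell n s0 L.
  by apply/ltW/Cbil_gt0/Cloc_gt0; case: gp.
apply: (@le_trans _ _ ((Ccell n s0 L)%:E * \int[mu]_(x in rg D) (cMloc u x * cMloc g x))%E).
  rewrite ge0_integral_region ?uniq_nbh//; last 2 first.
  - exact: (nnm_mul mMu mMg).1.
  - exact: (nnm_mul mMu mMg).2.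
  rewrite ge0_sume_distrr; last first.
    by move=> k _; apply: integral_ge0 => x _; exact: (nnm_mul mMu mMg).2.
  apply: lee_sum => k _.
  apply: (cell_bilinear n0 gp HB D lu lg g0 mMu.1 mMg.1).
  - by move=> i x; exact: avg_le_cMloc.
  - by move=> i x; exact: avg_le_cMloc.
apply: lee_wpmul2l; first by rewrite lee_fin.
apply: ge0_subset_integral => //; first exact: (nnm_mul mMu mMg).1.
by move=> x _; exact: (nnm_mul mMu mMg).2.
Qed.

Lemma lip_gen_bilinear u g : locint u -> locint g -> (forall x, 0 <= g x) ->
  (\int[mu]_x (sqrte (sqfun u x) * (g x)%:E) <=
   (p0%:R * B)%:E * \int[mu]_x (avg t0 J' u x * g x)%:E +
   (Ccell n s0 L)%:E * \int[mu]_x (cMloc u x * cMloc g x))%E.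
Proof.
move=> lu lg g0.
pose c (i : nat) x := ncoef psi u (J + i%:Z) (cellix (J + i%:Z) x).
have mlim : measurable_fun setT (fun x => limn (fun D => (tail u D x)%:E)).
  apply: (emeasurable_fun_cvg (fun D x => (tail u D x)%:E)).
    by move=> D; apply/measurable_EFinP; exact: measurable_tail.
  by move=> x _; exact: ereal_nondecreasing_is_cvgn (tail_mono u x).
have lim0 x : (0 <= limn (fun D => (tail u D x)%:E))%E.
  apply: lime_ge; first exact: ereal_nondecreasing_is_cvgn (tail_mono u x).
  by apply: nearW => D; rewrite lee_fin sqrtr_ge0.
have mg : measurable_fun setT (fun x => (g x)%:E) by apply/measurable_EFinP; exact: lg.1.
have ma := measurable_avg t0 J' u.
apply: (@le_trans _ _ (\int[mu]_x ((p0%:R * B * (avg t0 J' u x * g x))%:E +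
   limn (fun D => (tail u D x)%:E) * (g x)%:E))%E).
  apply: ge0_le_integral => //.
  - by move=> x _; rewrite mule_ge0 ?sqrte_ge0// lee_fin.
  - apply: emeasurable_funM => //; apply: measurable_sqrte; last exact: measurable_sqfun.
    by move=> x; exact: sqfun_ge0.
  - apply: emeasurable_funD; last exact: emeasurable_funM.
    apply/measurable_EFinP; apply: measurable_funM => //; apply: measurable_funM => //.
    exact: lg.1.
  - move=> x _.
    apply: (@le_trans _ _ ((\sum_(i < p0) `|c i x|%:E +
       limn (fun D => (tail u D x)%:E)) * (g x)%:E)%E).
      by apply: lee_wpmul2r; [rewrite lee_fin|exact: sqfun_split].
    rewrite ge0_muleDl//; last by apply: sume_ge0 => i _; rewrite lee_fin.
    apply: leeD2r; rewrite sumEFin -EFinM lee_fin mulrA ler_wpM2r//.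
    apply: (@le_trans _ _ (\sum_(i < p0) B * avg t0 J' u x)).
      by apply: ler_sum => i _; apply: ncoef_coarse => //; exact: ltnW.
    by rewrite sumr_const card_ord -[leLHS]mulr_natl mulrA.
rewrite ge0_integralD//; last 4 first.
- move=> x _; rewrite lee_fin; apply: mulr_ge0; first exact: mulr_ge0.
  by apply: mulr_ge0; [exact: avg_ge0|exact: g0].
- apply/measurable_EFinP; apply: measurable_funM => //; apply: measurable_funM => //.
  exact: lg.1.
- by move=> x _; rewrite mule_ge0// lee_fin.
- exact: emeasurable_funM.
apply: leeD; last exact: tail_bilinear.
under eq_integral do rewrite EFinM.
rewrite ge0_integralZl//.
- by apply/measurable_EFinP; apply: measurable_funM => //; exact: lg.1.
- by move=> x _; rewrite lee_fin mulr_ge0 ?avg_ge0.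
- by rewrite lee_fin mulr_ge0.
Qed.

End one_generator.
End generator_norms.

(** * Norm bounds for one square function *)

Section generator_bounds.
Variables (R : realType) (n : nat).
Local Notation E := 'rV[R]_n.
Local Notation Zn := 'rV[int]_n.
Local Notation mu := (@lebesgue_rV R n).
Implicit Types (x y z : E) (u v g : E -> R) (j : int) (q k : Zn).
Variable rho : (E -> \bar R) -> \bar R.
Hypothesis Hr : ball_Banach_norm rho.
Local Notation kd := (Koethe_dual rho).
Hypothesis MX : Mloc_bounded rho.
Hypothesis MX' : Mloc_bounded kd.

(** Bounds c > 0 of the norm b stand for b itself, which may vanish. *)
Lemma all_scaled_le (a b : \bar R) (C : R) : 0 <= C -> (0 <= b)%E -> (b < +oo)%E ->
  (forall c : R, 0 < c -> (b <= c%:E)%E -> (a <= (C * c)%:E)%E) -> (a <= C%:E * b)%E.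
Proof.
move=> C0 b0 by_ H; case: b b0 by_ H => [r| |]//; rewrite lee_fin => r0 _ H.
apply/lee_addgt0Pr => e e0.
have C1 : 0 < C + 1 by rewrite ltr_wpDl.
have c0 : 0 < r + e / (C + 1) by rewrite ltr_wpDl// divr_gt0.
have := H _ c0; rewrite lee_fin lerDl divr_ge0 ?(ltW e0) ?(ltW C1)// => /(_ isT).
move=> /le_trans; apply; rewrite -EFinM -EFinD lee_fin mulrDr lerD2l.
rewrite mulrCA ger_pMr// ler_pdivrMr// mul1r; lra.
Qed.

Lemma kd_avg_bounded j t : (cM n 1)%:R < (2 : R) ^ j ->
  exists2 C : R, 0 <= C & forall u, locint u ->
  (kd (eabs u) < +oo)%E -> (kd (eabs (avg t j u)) <= C%:E * kd (eabs u))%E.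
Proof.
apply: avg_bounded => //.
- by move=> f _; exact: (kd_ge0 Hr).
- by move=> f g; exact: kd_mono.
- by move=> f a; exact: kd_scale.
Qed.

Lemma rho_avg_bounded j t : (cM n 1)%:R < (2 : R) ^ j ->
  exists2 C : R, 0 <= C & forall u, locint u ->
  (rho (eabs u) < +oo)%E -> (rho (eabs (avg t j u)) <= C%:E * rho (eabs u))%E.
Proof.
apply: avg_bounded => //.
- by move=> f; exact: (bbn_ge0 Hr).
- by move=> f g; exact: (rho_mono Hr).
- by move=> f a; exact: (rho_scale Hr).
Qed.

Section one_generator.
Variables (s0 : nat) (L : R) (psi : E -> R) (J : int) (p0 : nat).
Hypothesis n0 : (0 < n)%N.
Hypothesis gp : lip_gen s0 L psi.
Let s := s0.+1.
Hypothesis p0_big : (cM n s)%:R < (2 : R) ^ (J + p0%:Z).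
Hypothesis HB : bessel_from psi J.
Let J' := J + p0%:Z.
Let t0 : nat := (s.+1 * 2 ^ p0)%N.
Let a : R := (cM n s)%:R ^+ n.

Lemma cM1_le : (cM n 1)%:R < (2 : R) ^ J'.
Proof.
apply: le_lt_trans p0_big; rewrite ler_nat /cM leq_add2r leq_mul2l; apply/orP; right.
by rewrite /s !ltnS.
Qed.

Let a0 : 0 < a.
Proof. by rewrite exprn_gt0// ltr0n /cM addn1. Qed.

(** The bilinear bound and the Hoelder inequality, with the roles of u and g exchanged in
    the second part. *)
Lemma key_estimate : exists2 C : R, 0 < C & forall u g (c : R), locint u -> test_fun g ->
  0 < c -> (rho (eabs u) <= c%:E)%E ->
  ((forall x, 0 <= g x)%R ->
   \int[mu]_x (sqrte (sqfun psi J u x) * eabs g x) <= (C * c)%:E * kd (eabs g))%E /\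
  (\int[mu]_x (sqrte (sqfun psi J g x) * eabs u x) <= (C * c)%:E * kd (eabs g))%E.
Proof.
have [CA CA0 HA] := rho_avg_bounded t0 cM1_le.
have [CK CK0 HK] := kd_avg_bounded t0 cM1_le.
have [CM CM0 HM] := @Mloc_real_bounded R n rho (bbn_ge0 Hr) MX.
have [CN CN0 HN] := @Mloc_real_bounded R n kd (fun f _ => kd_ge0 Hr f) MX'.
have [L0 _ _] := gp.
pose B := L * (2 * s0%:R + 1).
have B0 : 0 <= B by rewrite mulr_ge0// addr_ge0// mulr_ge0.
pose Cc := Ccell n s0 L.
have Cc0 : 0 <= Cc by apply/ltW/Cbil_gt0/Cloc_gt0.
pose C1 := p0%:R * B; have C10 : 0 <= C1 by exact: mulr_ge0.
pose C : R := C1 * (CA + 1 + CK) + Cc * (a * (CM + 1) * (a * CN)) + 1.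
have bil u g (c : R) : locint u -> test_fun g -> 0 < c -> (rho (eabs u) <= c%:E)%E ->
    (\int[mu]_x (cMloc s0 u x * cMloc s0 g x) <= (a * (CM + 1) * (a * CN) * c)%:E * kd (eabs g))%E.
  move=> lu bg c0 uc; have fu : (rho (eabs u) < +oo)%E by apply: le_lt_trans uc (ltry _).
  have fg := kd_test_fun Hr bg.
  have nu := cMloc_nnm s0 lu.1; have ng := cMloc_nnm s0 bg.1.
  have k0 : 0 < a * (CM + 1) * c by rewrite !mulr_gt0// ltr_wpDl.
  apply: le_trans (hoelder Hr nu ng k0 _) _.
    apply: le_trans (rho_scale Hr (Mloc_nnm lu.1) (ltW a0)) _.
    rewrite -[a * (CM + 1) * c]mulrA EFinM; apply: lee_wpmul2l; first by rewrite lee_fin ltW.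
    apply: le_trans (HM _ lu.1 fu) _.
    apply: (@le_trans _ _ (CM%:E * c%:E)%E); first by apply: lee_wpmul2l; rewrite ?lee_fin.
    by rewrite -EFinM lee_fin ler_pM2r// lerDl.
  have -> : ((a * (CM + 1) * (a * CN) * c)%:E = (a * (CM + 1) * c)%:E * (a * CN)%:E)%E.
    by rewrite -EFinM; congr EFin; ring.
  rewrite -muleA; apply: lee_wpmul2l; first by rewrite lee_fin ltW.
  apply: le_trans (kd_scale _ (Mloc_nnm bg.1) (ltW a0)) _.
  by rewrite EFinM -muleA; apply: lee_wpmul2l; [rewrite lee_fin ltW|exact: (HN _ bg.1 fg)].
exists C.
  by rewrite /C ltr_wpDl// addr_ge0// mulr_ge0// ?mulr_ge0// ?addr_ge0// ltW.
move=> u g c lu bg c0 uc.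
have fu : (rho (eabs u) < +oo)%E by apply: le_lt_trans uc (ltry _).
have lg := test_fun_locint bg; have fg := kd_test_fun Hr bg.
have lau := locint_norm lu.
have kg0 := kd_ge0 Hr (eabs g).
have enavg (w : E -> R) x : locint w -> (avg t0 J' w x)%:E = eabs (avg t0 J' w) x.
  by move=> lw; rewrite /eabs ger0_norm// avg_ge0.
have sum_le (X : \bar R) (Y : \bar R) (D : R) : 0 <= D -> D <= CA + 1 + CK ->
    (X <= (D * c)%:E * kd (eabs g))%E -> (Y <= (a * (CM + 1) * (a * CN) * c)%:E * kd (eabs g))%E ->
    (C1%:E * X + Cc%:E * Y <= (C * c)%:E * kd (eabs g))%E.
  move=> D0 DC hX hY.
  have aCM : 0 <= a * (CM + 1) * (a * CN) by rewrite !mulr_ge0// ?addr_ge0// ltW.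
  have H1 : (C1%:E * X <= (C1 * (D * c))%:E * kd (eabs g))%E.
    by rewrite [(C1 * _)%:E]EFinM -muleA; apply: lee_wpmul2l; rewrite ?lee_fin.
  have H2 : (Cc%:E * Y <= (Cc * (a * (CM + 1) * (a * CN) * c))%:E * kd (eabs g))%E.
    by rewrite [(Cc * _)%:E]EFinM -muleA; apply: lee_wpmul2l; rewrite ?lee_fin.
  apply: le_trans (leeD H1 H2) _; rewrite -ge0_muleDl; first last.
  - by rewrite lee_fin; apply: mulr_ge0 => //; apply: mulr_ge0 => //; exact: ltW.
  - by rewrite lee_fin; apply: mulr_ge0 => //; apply: mulr_ge0 => //; exact: ltW.
  apply: lee_wpmul2r => //; rewrite -EFinD lee_fin /C.
  have := ler_wpM2l C10 DC; move: (C1 * (CA + 1 + CK)) aCM => Y1.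
  move: (a * _ * _) => Y2 _ DY.
  have -> : C1 * (D * c) + Cc * (Y2 * c) = (C1 * D + Cc * Y2) * c by ring.
  by rewrite ler_pM2r//; lra.
split=> [g0|].
  have gE x : (g x)%:E = eabs g x by rewrite /eabs ger0_norm.
  apply: (@le_trans _ _ (\int[mu]_x (sqrte (sqfun psi J u x) * (g x)%:E))%E).
    by rewrite le_eqVlt; apply/orP; left; apply/eqP/eq_integral => x _; rewrite gE.
  apply: le_trans (lip_gen_bilinear n0 gp p0_big HB lu lg g0) _.
  apply: (sum_le _ _ (CA + 1)); rewrite ?addr_ge0// ?lerDl//; last exact: bil.
  under eq_integral do rewrite EFinM enavg// gE.
  apply: hoelder => //; try exact: eabs_nnm; rewrite ?mulr_gt0 ?ltr_wpDl//.
  - by apply: eabs_nnm; exact: measurable_avg.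
  - by apply: eabs_nnm; exact: bg.1.
  apply: le_trans (HA _ lu fu) _.
  apply: (@le_trans _ _ (CA%:E * c%:E)%E); first by apply: lee_wpmul2l; rewrite ?lee_fin.
  by rewrite -EFinM lee_fin ler_pM2r// lerDl.
have au0 x : 0 <= `|u x| by [].
apply: le_trans (lip_gen_bilinear n0 gp p0_big HB lg lau au0) _.
apply: (sum_le _ _ CK) => //; first by rewrite lerDr addr_ge0.
  under eq_integral do rewrite EFinM enavg// muleC.
  apply: le_trans (hoelder Hr _ _ c0 uc) _.
  - by apply: eabs_nnm; exact: lu.1.
  - by apply: eabs_nnm; exact: measurable_avg.
  rewrite [(CK * c)%:E]EFinM [(CK%:E * _)%E]muleC -muleA.
  by apply: lee_wpmul2l; [rewrite lee_fin ltW|exact: HK].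
have -> : (\int[mu]_x (cMloc s0 g x * cMloc s0 (fun x => `|u x|%R) x) =
    \int[mu]_x (cMloc s0 u x * cMloc s0 g x))%E; last exact: bil.
have nE : cmodf (real_fun (fun x => `|u x|)) = cmodf (real_fun u).
  by rewrite !cmodf_real; apply/funext => x /=; rewrite normr_id.
by apply: eq_integral => x _; rewrite muleC /cMloc /Mloc nE.
Qed.

Lemma sqrte_sqfun_nnm u : nonneg_measurable (fun x => sqrte (sqfun psi J u x)).
Proof.
split; last by move=> x; exact: sqrte_ge0.
by apply: measurable_sqrte => [x|]; [exact: sqfun_ge0|exact: measurable_sqfun].
Qed.

(** Duality: the norm is tested against test functions. *)
Lemma rho_sqfun : exists2 C : R, 0 < C & forall u, measurable_fun setT u ->
  (rho (eabs u) < +oo)%E -> (rho (fun x => sqrte (sqfun psi J u x)) <= C%:E * rho (eabs u))%E.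
Proof.
have [C C0 key] := key_estimate; exists C => // u mu_ fu.
apply: all_scaled_le => //; [exact: ltW|exact: (bbn_ge0 Hr (eabs_nnm mu_))|move=> c c0 uc].
apply: (lorentz_luxemburg Hr (sqrte_sqfun_nnm u)); first exact: mulr_gt0.
by move=> g bg g0; have [/(_ g0)] := key u g c (rho_locint Hr mu_ fu) bg c0 uc.
Qed.

(** The dual norm is by definition a supremum over the u that the key estimate admits. *)
Lemma kd_sqfun : exists2 C : R, 0 < C & forall g, test_fun g ->
  (kd (fun x => sqrte (sqfun psi J g x)) <= C%:E * kd (eabs g))%E.
Proof.
have [C C0 key] := key_estimate; exists C => // g bg.
apply: ge_ereal_sup => _ [f [[mf ff] f1] <-].
have nf := nnm_cmodf mf.
pose u x : R := cmod (f x).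
have mu_ : measurable_fun setT u by apply/measurable_EFinP; exact: nf.1.
have uE : cmodf f = eabs u.
  by apply/funext => x; rewrite /eabs /cmodf ger0_norm// -lee_fin; exact: nf.2.
rewrite /Xnorm uE in f1.
have fu : (rho (eabs u) < +oo)%E by apply: le_lt_trans f1 (ltry _).
have [_] := key u g 1 (rho_locint Hr mu_ fu) bg ltr01 f1.
by rewrite mulr1; apply: le_trans; rewrite le_eqVlt; apply/orP; left; apply/eqP/eq_integral => x _; rewrite uE muleC.
Qed.

End one_generator.
End generator_bounds.

(** * Finite expansions in an orthonormal basis *)

Section real_orthonormal.
Variables (R : realType) (n : nat).
Local Notation E := 'rV[R]_n.
Local Notation mu := (@lebesgue_rV R n).
Variables (I : eqType) (e : I -> E -> R).
Implicit Types (u v w : E -> R) (S A : seq I) (a b : I).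
Hypothesis be : forall a, test_fun (e a).
Hypothesis oe : forall a b, ip (e a) (e b) = (a == b)%:R.

Definition comb S (c : I -> R) x : R := \sum_(a <- S) c a * e a x.

Definition proj v S := comb S (fun a => ip v (e a)).

Lemma test_fun_comb S c : test_fun (comb S c).
Proof. by apply: test_fun_sum => a; exact: test_funZ. Qed.

Lemma ip_comb u S c : locint u -> ip u (comb S c) = \sum_(a <- S) c a * ip u (e a).
Proof.
move=> lu; rewrite ip_sumr//; last by move=> a; exact: test_funZ.
by apply: eq_bigr => a _; rewrite ipZr.
Qed.

Lemma comb_basis S c b : uniq S -> ip (comb S c) (e b) = if b \in S then c b else 0.
Proof.
move=> uS; rewrite ipC ip_comb; last exact: test_fun_locint.
have [bS|bS] := boolP (b \in S).
  rewrite (bigD1_seq b)//= oe eqxx mulr1 big1 ?addr0// => a /negPf ab.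
  by rewrite oe eq_sym ab mulr0.
rewrite big_seq big1// => a aS; rewrite oe (_ : b == a = false) ?mulr0//.
by apply: contraNF bS => /eqP ->.
Qed.

Lemma proj_in v S a : test_fun v -> uniq S -> a \in S -> ip (fun x => v x - proj v S x) (e a) = 0.
Proof.
move=> bv uS aS; rewrite ipC ipBr//; try exact: test_fun_comb; last exact: test_fun_locint.
by rewrite [ip _ (proj _ _)]ipC comb_basis// aS ipC subrr.
Qed.

Lemma proj_notin v S a : uniq S -> a \notin S -> ip (proj v S) (e a) = 0.
Proof. by move=> uS /negPf aS; rewrite comb_basis// aS. Qed.

Lemma bessel v S : test_fun v -> uniq S -> \sum_(a <- S) ip v (e a) ^+ 2 <= ip v v.
Proof.
move=> bv uS; have lv := test_fun_locint bv; have bp := test_fun_comb S (fun a => ip v (e a)).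
have bd : test_fun (fun x => v x - proj v S x) by exact: test_funB.
have := ip_ge0 (fun x => v x - proj v S x).
rewrite ipBr//; last exact: test_fun_locint.
rewrite [X in _ - X]ip_comb; last exact: test_fun_locint.
rewrite [X in _ - X]big_seq [X in _ - X]big1 ?subr0; last first.
  by move=> a aS; rewrite proj_in// mulr0.
rewrite ipC ipBr// [ip v (proj _ _)]ip_comb// subr_ge0.
by under eq_bigr do rewrite -expr2.
Qed.

(** Pythagoras: a remainder orthogonal to two finite spans is the shortest one. *)
Lemma best_approx v A S (b c : I -> R) : test_fun v ->
  let d x := v x - comb A b x in let w x := v x - comb S c x in
  (forall a, a \in A -> ip d (e a) = 0) -> (forall a, a \in S -> ip d (e a) = 0) ->
  ip d d <= ip w w.
Proof.
move=> bv d w dA dS.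
have bA := test_fun_comb A b; have bS := test_fun_comb S c.
have bd : test_fun d by exact: test_funB.
have ld := test_fun_locint bd.
pose h x := comb A b x - comb S c x.
have bh : test_fun h by exact: test_funB.
have dh : ip d h = 0.
  rewrite ipBr// !ip_comb// big_seq big1 => [|a aA]; last by rewrite dA// mulr0.
  by rewrite big_seq big1 ?subr0// => a aS; rewrite dS// mulr0.
have wE : w = fun x => d x + h x by apply/funext => x; rewrite /w /d /h; ring.
rewrite wE; clear wE w; clearbody h d.
rewrite ipDr//; last by apply: test_fun_locint; exact: test_funD.
rewrite !ipDl//; try exact: test_fun_locint.
by rewrite [ip h d]ipC dh addr0 add0r lerDl ip_ge0.
Qed.

Hypothesis ce : forall v, test_fun v -> forall eps : R, 0 < eps -> exists S (c : I -> R),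
  ip (fun x => v x - comb S c x) (fun x => v x - comb S c x) <= eps.

Lemma proj_dense v eps : test_fun v -> 0 < eps -> exists2 S, uniq S &
  ip (fun x => v x - proj v S x) (fun x => v x - proj v S x) <= eps.
Proof.
move=> bv e0; have [S [c Sc]] := ce bv e0.
exists (undup S); first exact: undup_uniq.
apply: le_trans Sc; apply: best_approx => // a aS; apply: proj_in => //; try exact: undup_uniq.
by rewrite mem_undup.
Qed.

(** Parseval in its weakest form, which is all that comparing two bases takes. *)
Lemma basis_orth v w : test_fun v -> test_fun w ->
  (forall a, ip v (e a) = 0 \/ ip w (e a) = 0) -> ip v w = 0.
Proof.
move=> bv bw vw; apply/eqP; rewrite -normr_le0.
have W1 : 0 < ip w w + 1 by rewrite ltr_wpDl// ip_ge0.
apply: (@small_le _ _ _ 1) => k; rewrite add0r mul1r.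
set dl := (2 : R) ^ (- k%:Z); have d0 : 0 < dl by exact: pow2_gt0.
have [|S uS hS] := @proj_dense v (dl ^+ 2 / (ip w w + 1)) bv; first by rewrite divr_gt0// exprn_gt0.
set r := (fun x => _) in hS.
have br : test_fun r by apply: test_funB => //; exact: test_fun_comb.
have -> : ip v w = ip r w.
  rewrite [RHS]ipC [RHS]ipBr//; [|exact: test_fun_locint|exact: test_fun_comb].
  rewrite ip_comb; last exact: test_fun_locint.
  rewrite big1 ?subr0 1?ipC// => a _.
  by case: (vw a) => ->; rewrite ?mul0r ?mulr0.
have e0 : 0 < (ip w w + 1) / dl by rewrite divr_gt0.
have := ip_CS e0 br bw; rewrite invf_div => H.
have H1 : (ip w w + 1) / dl * ip r r <= dl.
  rewrite mulrAC ler_pdivrMr// -expr2 mulrC -ler_pdivlMr//.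
have H2 : dl / (ip w w + 1) * ip w w <= dl.
  by rewrite mulrAC ler_pdivrMr// ler_pM2l// lerDl.
lra.
Qed.

End real_orthonormal.

(** * The real wavelet basis *)

Section real_wavelets.
Variables (R : realType) (n : nat).
Local Notation E := 'rV[R]_n.
Local Notation Zn := 'rV[int]_n.
Local Notation mu := (@lebesgue_rV R n).
Implicit Types (x y : E) (f : E -> R[i]) (u v g : E -> R) (j : int) (q k : Zn).

Lemma lip_gen_supp u (N : nat) : supp u = cube (2 * N%:R - 1) ->
  forall y, u y != 0 -> box (2 * N) y.
Proof.
move=> su y uy i; have : supp u y by apply: subset_closure.
rewrite su => /(_ i) /andP[y0 y1]; rewrite ger0_norm// natrM; lra.
Qed.

Lemma wavelet_lip_gen (K : nat) phi (psi : 'I_(2 ^ n - 1) -> E -> R) :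
  wavelet_system K.+1 phi psi ->
  exists s0, exists2 L, lip_gen s0 L phi & forall l, lip_gen s0 L (psi l).
Proof.
move=> [Cphi Cpsi _ _ [N [sphi spsi]]].
have [L0 L00 H0] := lip_of_C1 Cphi (lip_gen_supp sphi).
have Hl l := lip_of_C1 (Cpsi l) (lip_gen_supp (spsi l)).
pose M l := projT1 (cid2 (Hl l)).
have M0 l : 0 <= M l by rewrite /M; case: cid2.
have HM l : forall x y (d : R), 0 <= d ->
    (forall i, `|x ord0 i - y ord0 i| <= d) -> `|psi l x - psi l y| <= M l * d.
  by rewrite /M; case: cid2.
have S0 : 0 <= \sum_l M l by apply: sumr_ge0.
exists (2 * N)%N, (L0 + \sum_l M l).
  split; [exact: addr_ge0| |exact: lip_gen_supp].
  by move=> x y d d0 xy; apply: le_trans (H0 _ _ _ d0 xy) _; rewrite ler_wpM2r// lerDl.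
move=> l; split; [exact: addr_ge0| |exact: lip_gen_supp].
move=> x y d d0 xy; apply: le_trans (HM l _ _ _ d0 xy) _; rewrite ler_wpM2r//.
by rewrite (bigD1 l)//= addrCA lerDl addr_ge0// sumr_ge0.
Qed.

Lemma inner_realE f g : inner f (real_fun g) =
  Complex (ip (fun x => complex.Re (f x)) g) (ip (fun x => complex.Im (f x)) g).
Proof.
rewrite /inner /cintegral; congr Complex; apply: eq_Rintegral => x _;
  by rewrite /real_fun; case: (f x) => a b /=; rewrite oppr0 ?mulr0 ?subr0 ?add0r.
Qed.

Lemma Re_le_cmod (z : R[i]) : complex.Re z ^+ 2 <= cmod z ^+ 2.
Proof.
by case: z => a b; rewrite /cmod /= sqr_sqrtr ?addr_ge0 ?sqr_ge0// lerDl sqr_ge0.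
Qed.

Lemma Re_sum (T : Type) (s : seq T) (F : T -> R[i]) :
  complex.Re (\sum_(t <- s) F t) = \sum_(t <- s) complex.Re (F t).
Proof.
elim: s => [|t s IH]; rewrite ?big_nil// !big_cons -IH.
by case: (F t) => a b; case: (\sum_(_ <- _) _).
Qed.

Lemma Im_sum (T : Type) (s : seq T) (F : T -> R[i]) :
  complex.Im (\sum_(t <- s) F t) = \sum_(t <- s) complex.Im (F t).
Proof.
elim: s => [|t s IH]; rewrite ?big_nil// !big_cons -IH.
by case: (F t) => a b; case: (\sum_(_ <- _) _).
Qed.

Lemma Lnorm2E f : ('N[mu]_2%:E [cmodf f] `^ 2 = \int[mu]_x (cmod (f x) ^+ 2)%:E)%E.
Proof.
rewrite poweR_Lnorm//; apply: eq_integral => x _.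
by rewrite /cmodf -[`|_|%E]/(`|cmod (f x)|%:E) poweR_EFin powR_mulrn// real_normK// num_real.
Qed.

Section fixed_system.
Variables (K : nat) (phi : E -> R) (psi : 'I_(2 ^ n - 1) -> E -> R).
Variables (s0 : nat) (L : R).
Hypothesis n0 : (0 < n)%N.
Hypothesis ws : wavelet_system K phi psi.
Hypothesis gphi : lip_gen s0 L phi.
Hypothesis gpsi : forall l, lip_gen s0 L (psi l).

Definition wavelet_real (J : int) (a : wavelet_index n) : E -> R :=
  match a with
  | inl k => dilate phi J k
  | inr (l, i, k) => dilate (psi l) (J + i%:Z) k
  end.

Lemma wavelet_familyE J a : wavelet_family phi psi J a = real_fun (wavelet_real J a).
Proof. by case: a => [k|[[l i] k]]. Qed.

Lemma test_fun_dilate g j k : lip_gen s0 L g -> test_fun (dilate g j k).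
Proof. by move=> gg; apply: test_funZ; exact: (rescaled_test_fun j k n0 gg). Qed.

Lemma test_fun_wavelet_real J a : test_fun (wavelet_real J a).
Proof. by case: a => [k|[[l i] k]]; exact: test_fun_dilate. Qed.

Lemma wavelet_real_orthonormal J a b : ip (wavelet_real J a) (wavelet_real J b) = (a == b)%:R.
Proof.
have [_ + _] := ws_basis ws J => /(_ a b).
rewrite !wavelet_familyE inner_realE => /(congr1 (@complex.Re R)) /= ->.
by case: (a == b).
Qed.

(** Taking real parts of the coefficients brings the combination closer to a real function. *)
Lemma wavelet_real_complete J v : test_fun v -> forall eps : R, 0 < eps ->
  exists S (c : wavelet_index n -> R),
  ip (fun x => v x - comb (wavelet_real J) S c x) (fun x => v x - comb (wavelet_real J) S c x) <= eps.
Proof.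
move=> bv eps e0; have [_ _ comp] := ws_basis ws J.
have lv := test_fun_locint bv.
have rv : L2 (real_fun v).
  split; first by split => //=; exact: bv.1.
  rewrite ltey; apply/eqP => Noo; have := Lnorm2E (real_fun v).
  rewrite Noo poweRE pnatr_eq0 /= => H.
  have := ipE lv bv; rewrite (_ : \int[mu]_x _ = +oo)%E// H.
  by apply: eq_integral => x _; rewrite sqr_sqrtr ?addr_ge0 ?sqr_ge0// expr0n addr0 expr2.
have se0 : 0 < Num.sqrt eps by rewrite sqrtr_gt0.
have [S [c Sc]] := comp _ rv _ se0.
exists S, (fun a => complex.Re (c a)); set w := fun x => _ - _.
have bw : test_fun w by apply: test_funB => //; apply: test_fun_comb; exact: test_fun_wavelet_real.
rewrite -lee_fin ipE//; last exact: test_fun_locint.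
set F := (fun x => _) in Sc.
apply: (@le_trans _ _ (\int[mu]_x (cmod (F x) ^+ 2)%:E)%E).
have ReB (z t : R[i]) : complex.Re (z - t) = complex.Re z - complex.Re t.
  by case: z; case: t.
have ImB (z t : R[i]) : complex.Im (z - t) = complex.Im z - complex.Im t.
  by case: z; case: t.
have FRe x : complex.Re (F x) = w x.
  rewrite /F /w /comb ReB Re_sum /=; congr (_ - _); apply: eq_bigr => a _.
  by rewrite wavelet_familyE /real_fun; case: (c a) => p q /=; rewrite mulr0 subr0.
have FIm x : complex.Im (F x) = 0 - comb (wavelet_real J) S (fun a => complex.Im (c a)) x.
  rewrite /F /comb ImB Im_sum /=; congr (_ - _); apply: eq_bigr => a _.
  by rewrite wavelet_familyE /real_fun; case: (c a) => p q /=; rewrite mulr0 add0r.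
have mF : cmeasurable F.
  split; first by rewrite (funext FRe); exact: bw.1.
  rewrite (funext FIm); apply: measurable_funB => //.
  by apply: test_fun_mea; apply: test_fun_comb; exact: test_fun_wavelet_real.
apply: (@le_trans _ _ (\int[mu]_x (cmod (F x) ^+ 2)%:E)%E).
  apply: ge0_le_integral => //.
  - by move=> x _; rewrite lee_fin -expr2 sqr_ge0.
  - by apply/measurable_EFinP/measurable_funM; exact: bw.1.
  - apply/measurable_EFinP/measurable_funX; apply/measurable_EFinP.
    exact: (nnm_cmodf mF).1.
  - by move=> x _; rewrite lee_fin -expr2 -FRe Re_le_cmod.
  exact: lexx.
apply: (@le_trans _ _ ((Num.sqrt eps)%:E `^ 2)%E); last first.
  by rewrite poweR_EFin powR_mulrn ?sqrtr_ge0// sqr_sqrtr// ltW.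
rewrite -Lnorm2E.
apply: gt0_ler_poweR => //; last exact: ltW.
- by rewrite in_itv/= leey andbT; exact: Lnorm_ge0.
- by rewrite in_itv/= leey andbT lee_fin sqrtr_ge0.
Qed.

End fixed_system.
End real_wavelets.

(** * Integer translates and scaling projections *)

Section shifts.
Variables (R : realType) (n : nat).
Local Notation E := 'rV[R]_n.
Local Notation Zn := 'rV[int]_n.
Local Notation mu := (@lebesgue_rV R n).
Implicit Types (x y : E) (u v g psi : E -> R) (j : int) (q k t : Zn).

Definition shifted t psi : E -> R := fun y => psi (y - \row_i (t ord0 i)%:~R).

Lemma rescaled_shifted t psi j q : rescaled (shifted t psi) j q = rescaled psi j (q + t).
Proof.
apply/funext => x; rewrite /rescaled /shifted -addrA -opprD; congr (psi (_ - _)).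
by apply/rowP => i; rewrite !mxE rmorphD.
Qed.

Lemma ncoef_shifted t psi u j q : ncoef (shifted t psi) u j q = ncoef psi u j (q + t).
Proof. by rewrite /ncoef rescaled_shifted. Qed.

Lemma dilate_shifted t psi j q : dilate (shifted t psi) j q = dilate psi j (q + t).
Proof.
apply/funext => x; rewrite /dilate -[shifted t psi _]/(rescaled (shifted t psi) j q x).
by rewrite rescaled_shifted.
Qed.

Lemma lip_gen_shifted s0 L psi t : t \in nbh 1 0 0 -> lip_gen s0 L psi -> lip_gen s0.+1 L (shifted t psi).
Proof.
rewrite mem_nbh => /forallP t1 [L0 lip sup]; split=> //.
  move=> x y d d0 xy; apply: lip => // i; rewrite !mxE.
  by rewrite opprB addrA subrK.
move=> y /sup H i; have := H i; rewrite !mxE; have := t1 i; rewrite anc0 !mxE subr0.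
rewrite -(ler_int R) intr_norm /= -natr1 !ler_norml; lra.
Qed.

Lemma avg_const_bound s j g B x : locint g -> 0 <= B -> (forall y, `|g y| <= B) ->
  avg s j g x <= B * (size (nbh s 0 (cellix j x)))%:R.
Proof.
move=> lg B0 gB; rewrite avg_sum// -sum1_size mulr_sumr; apply: ler_sum => k _.
have w0 := cell_vol_gt0 R n j; rewrite mulrC ler_pdivrMr//.
apply: (@le_trans _ _ (\int[mu]_(y in hcell j k) B)); last first.
  rewrite Rintegral_cst; last exact: measurable_hcell.
  by rewrite [X in fine X]mu_hcell.
apply: le_Rintegral; first exact: measurable_hcell.
- exact: (locint_norm lg).2.
- exact: (@locint_cst R n B).2.
- by move=> y _; exact: gB.
Qed.

End shifts.

Section wavelet_projections.
Variables (R : realType) (n : nat).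
Local Notation E := 'rV[R]_n.
Local Notation Zn := 'rV[int]_n.
Local Notation mu := (@lebesgue_rV R n).
Variables (K : nat) (phi : E -> R) (psi : 'I_(2 ^ n - 1) -> E -> R).
Variables (s0 : nat) (L : R).
Hypothesis n0 : (0 < n)%N.
Hypothesis ws : wavelet_system K phi psi.
Hypothesis gphi : lip_gen s0 L phi.
Hypothesis gpsi : forall l, lip_gen s0 L (psi l).
Implicit Types (x y : E) (u v g : E -> R) (J j : int) (q k t : Zn).
Implicit Types (A S : seq (wavelet_index n)) (a b : wavelet_index n).
Local Notation wavelet_real := (wavelet_real phi psi).
Let be J := test_fun_wavelet_real n0 gphi gpsi J.
Let oe J := wavelet_real_orthonormal ws J.
Let ce J := wavelet_real_complete n0 ws gphi gpsi J.

(** Translating psi by an integer vector permutes its dilates of each level. *)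
Lemma bessel_shift t l J : t \in nbh 1 0 0 -> bessel_from (shifted t (psi l)) J.
Proof.
move=> t1 v bv S uS; have lv := test_fun_locint bv.
have gt := lip_gen_shifted t1 (gpsi l).
pose h (a : nat * Zn) : wavelet_index n := inr (l, a.1, a.2 + t).
have uh : uniq (map h S).
  by rewrite map_inj_uniq// => -[i k] [i' k'] [] -> /addIr ->.
apply: le_trans (bessel (be J) (oe J) bv uh).
rewrite big_map; apply/eq_ler/eq_bigr => -[i k] _ /=.
by rewrite (ncoef_sqr lv (rescaled_test_fun _ _ n0 gt)) dilate_shifted.
Qed.

Lemma finite_coeffs h j g : lip_gen s0 L h -> test_fun g ->
  exists S : seq Zn, forall k, ip g (dilate h j k) != 0 -> k \in S.
Proof.
move=> gh [_ [B [r [_ _ gr]]]]; have [S0 _ rS] := @box_region R n j r.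
exists (flatten [seq nbh s0.+1 0 k | k <- S0]) => k; apply: contraR => kS.
rewrite -(@ip0r R n (fun=> 0)); apply/eqP/eq_Rintegral => x _; rewrite mulr0.
apply/eqP; rewrite mulf_eq0 /dilate mulf_eq0; apply: contraR kS.
rewrite !negb_or => /and3P[/gr/rS xS _ /(rescaled_supp gh) xk].
apply/flatten_mapP; exists (cellix j x) => //.
by have := mem_nbhC s0.+1 0 k (cellix j x); rewrite !anc0 => ->.
Qed.

Definition low (p : nat) a := match a with inl _ => true | inr (_, i, _) => (i < p)%N end.

(** A stands for all basis functions of level below p that g meets. *)
Definition low_list J p g A := [/\ uniq A, {in A, forall a, low p a} &
  forall a, low p a -> ip g (wavelet_real J a) != 0 -> a \in A].

Lemma low_list_exists J p g : test_fun g -> exists A, low_list J p g A.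
Proof.
move=> bg; have [S0 H0] := finite_coeffs J gphi bg.
have Hl l (i : nat) := finite_coeffs (J + i%:Z) (gpsi l) bg.
pose S l i := projT1 (cid (Hl l i)).
have HS l (i : nat) k : ip g (dilate (psi l) (J + i%:Z) k) != 0 -> k \in S l i.
  by rewrite /S; case: cid => ? /= H /H.
exists (undup (map inl S0 ++ flatten [seq flatten [seq [seq inr (l, i, k) | k <- S l i]
  | i <- iota 0 p] | l <- enum 'I_(2 ^ n - 1)])); split.
- exact: undup_uniq.
- move=> a; rewrite mem_undup mem_cat => /orP[/mapP[k _ ->//]|].
  by move=> /flatten_mapP[l _ /flatten_mapP[i + /mapP[k _ ->]]]; rewrite mem_iota.
case=> [k|[[l i] k]] /= ip0; rewrite mem_undup mem_cat => kS; apply/orP.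
  by left; apply/map_f/H0.
right; apply/flatten_mapP; exists l; first by rewrite mem_enum.
by apply/flatten_mapP; exists i; [rewrite mem_iota|apply/map_f/HS].
Qed.

Lemma low_in J p g A a : test_fun g -> low_list J p g A -> low p a ->
  ip (fun x => g x - proj (wavelet_real J) g A x) (wavelet_real J a) = 0.
Proof.
move=> bg [uA _ HA] la; have [aA|aA] := boolP (a \in A).
  exact: (proj_in (be J) (oe J)).
rewrite ipC ipBr//; [|exact: test_fun_locint|exact: test_fun_comb].
rewrite [ip _ (proj _ _ _)]ipC (proj_notin (be J) (oe J))// subr0 ipC.
by apply/eqP; apply: contraNT aA; exact: HA.
Qed.

Lemma low_out J p g A a : low_list J p g A -> ~~ low p a -> ip (proj (wavelet_real J) g A) (wavelet_real J a) = 0.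
Proof.
by move=> [uA lA _] la; apply: (proj_notin (be J) (oe J)) => //; apply: contraNN la => /lA.
Qed.

(** The two finite expansions are the projections on the space spanned by the
    scaling functions of level J + p: both remainders and the difference of the
    expansions satisfy the orthogonality relations that make them orthogonal to
    each other, once in the basis starting at J and once in that starting at
    J + p. *)
Lemma proj_scaling J p g A A' : test_fun g -> low_list J p g A ->
  low_list (J + p%:Z) 0 g A' ->
  {ae mu, forall x, proj (wavelet_real J) g A x = proj (wavelet_real (J + p%:Z)) g A' x}.
Proof.
move=> bg lA lA'.
set G := proj _ g A; set G' := proj _ g A'.
have bG : test_fun G by apply: test_fun_comb; exact: be.
have bG' : test_fun G' by apply: test_fun_comb; exact: be.
pose r x := G x - G' x; have br : test_fun r by exact: test_funB.
pose d x := g x - G x; have bd : test_fun d by exact: test_funB.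
pose d' x := g x - G' x; have bd' : test_fun d' by exact: test_funB.
have ipr v : test_fun v -> ip v r = ip v G - ip v G'.
  by move=> bv; rewrite ipBr//; exact: test_fun_locint.
have dr : ip d r = 0.
  apply: (basis_orth (be J) (oe J) (@ce J)) => // a.
  have [la|la] := boolP (low p a); first by left; exact: (low_in bg lA).
  right; rewrite ipC ipr; last exact: be.
  rewrite ipC (low_out lA la) sub0r; apply/eqP; rewrite oppr_eq0; apply/eqP.
  case: a la => [//|[[l i] k]] /=; rewrite -leqNgt => pi.
  have lev : J + i%:Z = J + p%:Z + (i - p)%N%:Z by rewrite -addrA -PoszD subnKC.
  by rewrite ipC lev; exact: (low_out (a := inr (l, (i - p)%N, k)) lA').
have d'r : ip d' r = 0.
  apply: (basis_orth (be (J + p%:Z)) (oe (J + p%:Z)) (@ce (J + p%:Z))) => // a.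
  have [la|la] := boolP (low 0 a); first by left; exact: (low_in bg lA').
  right; rewrite ipC ipr; last exact: be.
  rewrite [X in _ - X]ipC (low_out lA' la) subr0.
  case: a la => [//|[[l i] k]] /= _.
  have lev : J + p%:Z + i%:Z = J + (p + i)%N%:Z by rewrite -addrA -PoszD.
  rewrite ipC lev; apply: (low_out (a := inr (l, (p + i)%N, k)) lA) => /=.
  by rewrite -leqNgt leq_addr.
have rr : ip r r <= 0.
  apply/eq_ler; have rE : r = fun x => d' x - d x by apply/funext => x; rewrite /r /d /d'; ring.
  transitivity (ip d' r - ip d r); last by rewrite dr d'r subr0.
  rewrite [ip d' r]ipC [ip d r]ipC -ipBr//; last exact: test_fun_locint.
  by rewrite -rE.
by have := ip0_ae br rr; apply: filterS => x /eqP; rewrite subr_eq0 => /eqP.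
Qed.

End wavelet_projections.

(** * Weak convergence of wavelet expansions *)

Section weak_limits.
Variables (R : realType) (n : nat).
Local Notation E := 'rV[R]_n.
Local Notation mu := (@lebesgue_rV R n).
Implicit Types (x y : E) (u v g h : E -> R).

Lemma ip_ae u g h : locint u -> test_fun g -> test_fun h -> {ae mu, forall x, g x = h x} ->
  ip u g = ip u h.
Proof.
move=> lu bg bh gh; apply: EFin_inj; rewrite !ipE//.
apply: ae_eq_integral => //.
- by apply/measurable_EFinP/measurable_funM; [exact: lu.1|exact: bg.1].
- by apply/measurable_EFinP/measurable_funM; [exact: lu.1|exact: bh.1].
- by apply: filterS gh => x -> _.
Qed.

Let L1_L2_small_nonneg u (B : R) r (dl : R) : locint u -> (forall x, 0 <= u x) ->
  0 < dl -> exists2 eta : R, 0 < eta & forall h, test_fun h -> (forall x, `|h x| <= B) ->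
  (forall x, h x != 0 -> box r x) -> ip h h <= eta -> `|ip u h| <= dl.
Proof.
move=> lu u0 d0.
have mb := @measurable_box R n r.
pose w x : R := \1_(box r) x.
have bw : test_fun w.
  split; first exact: measurable_indic.
  exists 1, r; split => // x; rewrite /w indicE.
    by case: (_ \in _); rewrite ?normr1 ?normr0.
  by case: (boolP (x \in _)) => [/set_mem //|_]; rewrite eqxx.
have nu := eabs_nnm lu.1.
have trunc_atE N x : 0 <= trunc_at N (eabs u) x <= u x.
  rewrite trunc_at_ge0 ?nu.2//=; have := trunc_at_le N (nu.2 x).
  by rewrite {2}/eabs ger0_norm// lee_fin.
have ltr N : locint (trunc_at N (eabs u)) by apply: test_fun_locint; exact: trunc_at_test_fun.
have cv : ip (trunc_at N (eabs u)) w @[N --> \oo] --> ip u w.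
  have nw : nonneg_measurable (fun x => (w x)%:E).
    split; first by apply/measurable_EFinP; exact: bw.1.
    by move=> x; rewrite lee_fin.
  apply: (@fine_cvg _ _ _ _ (fun N => \int[mu]_x ((trunc_at N (eabs u) x)%:E * (w x)%:E))%E).
  rewrite ipE//; have := integral_trunc_at_cvg nu nw.
  suff -> : (\int[mu]_x (u x * w x)%:E = \int[mu]_x (eabs u x * (w x)%:E))%E by [].
  by apply: eq_integral => x _; rewrite /eabs ger0_norm.
pose B' := `|B| + 1; have B0 : 0 < B' by rewrite ltr_wpDl.
have /cvgrPdist_le /(_ (dl / (2 * B'))) := cv.
case; [by rewrite divr_gt0// mulr_gt0|move=> N _ /(_ N (leqnn N)) /= HN].
pose u' := trunc_at N (eabs u); have bu' : test_fun u' by exact: trunc_at_test_fun.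
have M0 := ip_ge0 u'; set M := ip u' u' in M0.
pose e := dl / (2 * (M + 1)); have e0 : 0 < e by rewrite divr_gt0// mulr_gt0// ltr_wpDl.
(* With this bound on ip h h, both terms of ip_CS with weight e are at most dl / 2. *)
exists (e * (dl / 2)); first by rewrite mulr_gt0// divr_gt0.
move=> h bh hB hr hh.
have lu' : locint (fun x => - 1 * u' x) by exact/locintZ/ltr.
pose v x := u x + - 1 * u' x; have lv : locint v by exact: locintD.
have -> : ip u h = ip u' h + ip v h by rewrite ipDl// ipZl//; [ring|exact: ltr].
have H1 : `|ip u' h| <= dl / 2.
  have := ip_CS e0 bu' bh; rewrite -/M => H.
  have eM : e * M <= dl / 2.
    rewrite /e invfM mulrA -mulrA ger_pMr ?divr_gt0// mulrC ler_pdivrMr ?ltr_wpDl//.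
    by rewrite mul1r lerDl.
  have : e^-1 * ip h h <= dl / 2 by rewrite mulrC ler_pdivrMr// mulrC.
  lra.
have H2 : `|ip v h| <= B' * (ip u w - ip u' w).
  have bn := test_fun_norm bh; have bB := test_funZ B' bw.
  apply: le_trans (ip_abs lv bh) _.
  have -> : ip u w - ip u' w = ip v w by rewrite ipDl// ipZl//; [ring|exact: ltr].
  rewrite -ipZr//; apply: le_Rintegral => //; try exact: integrableM; try (apply: integrableM => //; exact: locint_norm).
  move=> x _; have /andP[t0 tu] := trunc_atE N x.
  have v0 : 0 <= v x by rewrite /v /u'; lra.
  rewrite (ger0_norm v0) ler_wpM2l//.
  have [hx|hx] := eqVneq (h x) 0.
    by rewrite hx normr0 mulr_ge0 ?(ltW B0)//.
  rewrite /w indicE mem_set; last exact: hr.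
  by rewrite mulr1; apply: le_trans (hB x) _; rewrite /B'; have := ler_norm B; lra.
have H3 : B' * (ip u w - ip u' w) <= dl / 2.
  have : ip u w - ip u' w <= dl / (2 * B') by apply: le_trans HN; exact: ler_norm.
  move=> /(ler_wpM2l (ltW B0)) /le_trans; apply; apply: eq_ler; field; exact: lt0r_neq0.
apply: le_trans (ler_normD _ _) _; lra.
Qed.

(** Split u into a truncation, paired in L^2, and a rest of small integral over the box, paired
    with a bounded function. *)
Lemma L1_L2_small u (B : R) r (dl : R) : locint u ->
  0 < dl -> exists2 eta : R, 0 < eta & forall h, test_fun h -> (forall x, `|h x| <= B) ->
  (forall x, h x != 0 -> box r x) -> ip h h <= eta -> `|ip u h| <= dl.
Proof.
move=> lu d0; have ln := locint_norm lu.
pose up x := 2^-1 * (`|u x| + u x); pose um x := 2^-1 * (`|u x| + -1 * u x).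
have lp : locint up by apply/locintZ/locintD.
have lm : locint um by apply/locintZ/locintD => //; exact: locintZ.
have up0 x : 0 <= up x by rewrite mulr_ge0//; have := ler_norm (- u x); rewrite normrN; lra.
have um0 x : 0 <= um x by rewrite mulr_ge0//; have := ler_norm (u x); lra.
have d2 : 0 < dl / 2 by rewrite divr_gt0.
have [e1 e10 H1] := L1_L2_small_nonneg B r lp up0 d2.
have [e2 e20 H2] := L1_L2_small_nonneg B r lm um0 d2.
exists (Num.min e1 e2); first by rewrite lt_min e10.
move=> h bh hB hr; rewrite le_min => /andP[h1 h2].
have lum : locint (fun x => -1 * um x) by exact: locintZ.
have -> : ip u h = ip up h - ip um h.
  have := ipDl lp lum bh; rewrite (@ipZl R n um h (-1) lm bh) mulN1r => <-.
  by congr ip; apply/funext => x; rewrite /up /um; lra.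
have := H1 h bh hB hr h1; have := H2 h bh hB hr h2.
by have := ler_normB (ip up h) (ip um h); lra.
Qed.

End weak_limits.

Section wavelet_expansion.
Variables (R : realType) (n : nat).
Local Notation E := 'rV[R]_n.
Local Notation Zn := 'rV[int]_n.
Local Notation mu := (@lebesgue_rV R n).
Variables (K : nat) (phi : E -> R) (psi : 'I_(2 ^ n - 1) -> E -> R).
Variables (s0 : nat) (L : R).
Hypothesis n0 : (0 < n)%N.
Hypothesis ws : wavelet_system K phi psi.
Hypothesis gphi : lip_gen s0 L phi.
Hypothesis gpsi : forall l, lip_gen s0 L (psi l).
Implicit Types (x y : E) (u v g : E -> R) (J j : int) (q k t : Zn).
Implicit Types (A S : seq (wavelet_index n)) (a b : wavelet_index n).
Local Notation wavelet_real := (wavelet_real phi psi).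
Let be J := test_fun_wavelet_real n0 gphi gpsi J.
Let oe J := wavelet_real_orthonormal ws J.
Let ce J := wavelet_real_complete n0 ws gphi gpsi J.

Lemma cellix_surj j k : exists x : E, cellix j x = k.
Proof.
exists (\row_i (2 ^ (- j) * (k ord0 i)%:~R)); apply/rowP => i.
by rewrite cellixE mxE pow2N mulrA mulfV ?pow2_neq0// mul1r intrKfloor.
Qed.

Let M : R := L * (2 * s0%:R + 1).

(** A rescaled function has mass comparable to the volume of a cell. *)
Lemma ncoef_bounded h j g B k : lip_gen s0 L h -> locint g -> 0 <= B -> (forall y, `|g y| <= B) ->
  `|ncoef h g j k| <= M * (B * (size (nbh s0.+2 0 (0 : Zn)))%:R).
Proof.
move=> gh lg B0 gB; have [x <-] := cellix_surj j k.
have M0 : 0 <= M by have [L0 _ _] := gh; rewrite mulr_ge0// addr_ge0// mulr_ge0.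
have := @ncoef_coarse R n s0 L h j 0 n0 gh 0 g x (leqnn 0) lg.
rewrite !addr0 muln1 => /le_trans; apply; rewrite ler_wpM2l//.
apply: le_trans (avg_const_bound _ _ _ lg B0 gB) _.
by rewrite !size_nbh.
Qed.

Lemma scaling_term j g k x : locint g ->
  ip g (wavelet_real j (inl k)) * wavelet_real j (inl k) x = ncoef phi g j k * rescaled phi j k x.
Proof.
move=> lg; have br := rescaled_test_fun j k n0 gphi.
by rewrite ncoefE//= /dilate -/(rescaled phi j k x) mulrA [_ * L2_factor n j]mulrC.
Qed.

(** Unlike the wavelet expansions that they equal, these are local averages with
    kernels of bounded mass, hence bounded uniformly in the level. *)
Lemma proj_scaling_bounded J g : test_fun g -> exists B r, forall (p : nat) A,
  low_list phi psi (J + p%:Z) 0 g A ->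
  (forall x, `|proj (wavelet_real (J + p%:Z)) g A x| <= B) /\
  (forall x, proj (wavelet_real (J + p%:Z)) g A x != 0 -> box r x).
Proof.
move=> bg; have lg := test_fun_locint bg; have [_ [Bg [r [B0 gB gr]]]] := bg.
pose C := M * (Bg * (size (nbh s0.+2 0 (0 : Zn)))%:R).
have [L0 _ sup] := gphi.
have M0 : 0 <= M by rewrite mulr_ge0// addr_ge0// mulr_ge0.
have C0 : 0 <= C by rewrite !mulr_ge0.
pose Q : R := r%:R + 2 * s0%:R * 2 ^ (- J).
exists (C * M * (size (nbh s0.+1 0 (0 : Zn)))%:R), (Num.truncn Q).+1 => p A.
set m := J + p%:Z => -[uA lA _]; split=> x.
  apply: le_trans (ler_norm_sum _ _ _) _.
  pose s2 : seq (wavelet_index n) := map inl (nbh s0.+1 0 (cellix m x)).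
  apply: (@le_trans _ _ (\sum_(a <- A) C * M * (a \in s2)%:R)).
    rewrite big_seq [leRHS]big_seq; apply: ler_sum => -[k|[[l i] k]] /lA//= _.
    rewrite -/(wavelet_real m (inl k)) scaling_term// normrM.
    have [rx|rx] := eqVneq (rescaled phi m k x) 0; first by rewrite rx normr0 mulr0 !mulr_ge0.
    have -> : inl k \in s2.
      apply: map_f; have := rescaled_supp gphi rx.
      by have := mem_nbhC s0.+1 0 k (cellix m x); rewrite !anc0 => ->.
    by rewrite mulr1 ler_pM//; [exact: ncoef_bounded|exact: (lip_gen_bounded n0 gphi)].
  rewrite -mulr_sumr ler_wpM2l//; first exact: mulr_ge0.
  apply: le_trans (sum_mem_le _ uA _) _.
    by rewrite map_inj_uniq ?uniq_nbh// => ? ? [].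
  by rewrite size_map !size_nbh.
move=> px; have [k [gk xk]] : exists k, ip g (rescaled phi m k) != 0 /\ rescaled phi m k x != 0.
  apply: contrapT => H; move/eqP: px; apply; rewrite /proj /comb big_seq big1//.
  move=> [k|[[l i] k]] /lA//= _; rewrite -/(wavelet_real m (inl k)) scaling_term// /ncoef.
  apply/eqP; rewrite mulf_eq0 mulf_eq0; apply: contrapT => /negP.
  by rewrite !negb_or => /andP[/andP[_ h1] h2]; apply: H; exists k.
have [y [gy yk]] : exists y, g y != 0 /\ rescaled phi m k y != 0.
  apply: contrapT => H; move/eqP: gk; apply; rewrite -(@ip0r R n (fun=> 0)).
  apply/eq_Rintegral => y _; rewrite mulr0; apply/eqP; rewrite mulf_eq0.
  by apply: contrapT => /negP; rewrite negb_or => /andP[h1 h2]; apply: H; exists y.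
move=> i; apply: (@le_trans _ _ Q); last exact/ltW/truncnS_gt.
have := sup _ xk i; have := sup _ yk i; have := gr _ gy i; rewrite !mxE.
move: (x ord0 i) (y ord0 i) (k ord0 i)%:~R => xi yi ki h1 h2 h3.
have p2 := pow2_gt0 R m; have pJ := pow2_gt0 R (- J).
have mJ : 1 <= 2 ^ m * 2 ^ (- J) :> R.
  have -> : 2 ^ m * 2 ^ (- J) = (2 : R) ^+ p.
    by rewrite /m pow2D mulrAC -pow2D subrr expr0z mul1r.
  by rewrite exprn_ege1// ler1n.
have h4 : `|2 ^ m * (xi - yi)| <= 2 * s0%:R.
  by rewrite mulrBr; move: h2 h3; rewrite !ler_norml; lra.
have h5 : `|xi - yi| <= 2 * s0%:R * 2 ^ (- J).
  rewrite normrM (gtr0_norm p2) in h4.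
  apply: (@le_trans _ _ (2 ^ m * 2 ^ (- J) * `|xi - yi|)); first by rewrite ler_peMl.
  by rewrite mulrAC ler_wpM2r// ltW.
have := ler_normD yi (xi - yi); rewrite addrC subrK /Q; lra.
Qed.

(** The remainder of the expansion of g equals almost everywhere that of its scaling
    projection, which is uniformly bounded with bounded support and tends to 0 in L^2. *)
Lemma wavelet_expansion J u g (dl : R) : locint u -> test_fun g -> 0 < dl ->
  exists p A, low_list phi psi J p g A /\
    `|ip u g - \sum_(a <- A) ip u (wavelet_real J a) * ip g (wavelet_real J a)| <= dl.
Proof.
move=> lu bg d0; have lg := test_fun_locint bg.
have [B [r HB]] := proj_scaling_bounded J bg.
have [_ [Bg [rg [B0 gB gr]]]] := bg.
have [eta e0 He] := L1_L2_small (Bg + B) (maxn rg r) lu d0.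
have [S [c Sc]] := @ce J _ bg _ e0.
pose lev a : nat := match a with inl _ => 0%N | inr (_, i, _) => i end.
pose p := (\max_(a <- S) lev a).+1.
have Sp a : a \in S -> low p a.
  move=> aS; have : (lev a <= \max_(b <- S) lev b)%N by apply: leq_bigmax_seq.
  by case: a aS => [//|[[l i] k]] _ /=; rewrite /p ltnS.
have [A lA] := low_list_exists gphi gpsi J p bg.
have [A' lA'] := low_list_exists gphi gpsi (J + p%:Z) 0 bg.
have [H1 H2] := HB p A' lA'.
exists p, A; split=> //.
pose G' := proj (wavelet_real (J + p%:Z)) g A'; pose d x := g x - proj (wavelet_real J) g A x.
pose h x := g x - G' x.
have bA : test_fun (proj (wavelet_real J) g A) by exact: test_fun_comb.
have bh : test_fun h by apply: test_funB => //; exact: test_fun_comb.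
have bd : test_fun d by exact: test_funB.
have dh : {ae mu, forall x, d x = h x}.
  by apply: filterS (proj_scaling n0 ws gphi gpsi bg lA lA') => x; rewrite /d /h => ->.
have -> : ip u g - \sum_(a <- A) ip u (wavelet_real J a) * ip g (wavelet_real J a) = ip u d.
  rewrite ipBr// [ip u (proj _ _ _)]ip_comb//.
  by congr (_ - _); apply: eq_bigr => a _; rewrite mulrC.
rewrite (ip_ae lu bd bh dh); apply: (He _ bh).
- by move=> x; apply: le_trans (ler_normB _ _) _; exact: lerD.
- move=> x; have [gx|/gr gx _] := eqVneq (g x) 0; last by apply: box_sub gx; exact: leq_maxl.
  rewrite /h gx sub0r oppr_eq0 => /H2; apply: box_sub; exact: leq_maxr.
have <- : ip d d = ip h h.
  have ld := test_fun_locint bd; have lh := test_fun_locint bh.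
  by rewrite (ip_ae ld bd bh dh) ipC (ip_ae lh bd bh dh).
apply: le_trans Sc; apply: (best_approx (be J)) => // a aS.
  by apply: (low_in n0 ws gphi gpsi bg lA); have [_ + _] := lA; apply.
by apply: (low_in n0 ws gphi gpsi bg lA); exact: Sp.
Qed.

End wavelet_expansion.

(** * The pairing bounded by square functions *)

Lemma sum_CS (R : rcfType) (T : Type) (s : seq T) (a b : T -> R) :
  \sum_(i <- s) a i * b i <=
  Num.sqrt (\sum_(i <- s) a i ^+ 2) * Num.sqrt (\sum_(i <- s) b i ^+ 2).
Proof.
elim: s => [|i s IH]; first by rewrite !big_nil mulr_ge0 ?sqrtr_ge0.
rewrite !big_cons; apply: le_trans (lerD (lexx _) IH) _.
have A0 : 0 <= \sum_(j <- s) a j ^+ 2 by apply: sumr_ge0 => j _; exact: sqr_ge0.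
have B0 : 0 <= \sum_(j <- s) b j ^+ 2 by apply: sumr_ge0 => j _; exact: sqr_ge0.
move: A0 B0; move: (\sum_(j <- s) a j ^+ 2) (\sum_(j <- s) b j ^+ 2) => A B A0 B0.
rewrite -(sqr_sqrtr A0) -(sqr_sqrtr B0) !sqrtr_sqr.
move: (sqrtr_ge0 A) (sqrtr_ge0 B); move: (Num.sqrt A) (Num.sqrt B) => x y x0 y0.
rewrite (ger0_norm x0) (ger0_norm y0) -sqrtrM ?addr_ge0 ?sqr_ge0//.
have [/ltW h|h] := ltP (a i * b i + x * y) 0; first by apply: le_trans h (sqrtr_ge0 _).
rewrite -(ger0_norm h) -sqrtr_sqr ler_wsqrtr//.
have := sqr_ge0 (a i * y - b i * x); nra.
Qed.

Section square_functions.
Variables (R : realType) (n : nat).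
Local Notation E := 'rV[R]_n.
Local Notation Zn := 'rV[int]_n.
Local Notation mu := (@lebesgue_rV R n).
Variables (K : nat) (phi : E -> R) (psi : 'I_(2 ^ n - 1) -> E -> R).
Variables (s0 : nat) (L : R).
Hypothesis n0 : (0 < n)%N.
Hypothesis ws : wavelet_system K phi psi.
Hypothesis gphi : lip_gen s0 L phi.
Hypothesis gpsi : forall l, lip_gen s0 L (psi l).
Variable J : int.
Implicit Types (x y : E) (f : E -> R[i]) (u v w g h : E -> R) (j : int) (q k t : Zn).
Local Notation wavelet_real := (wavelet_real phi psi).

(** The real square function with the half-open cells in place of the closed cubes. *)
Definition full_sqfun u x : \bar R :=
  sqrte ((ncoef phi u J (cellix J x) ^+ 2)%:E + \sum_l sqfun (psi l) J u x)%E.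

Lemma measurable_ncoef h j t u : measurable_fun setT (fun x : E => ncoef h u j (cellix j x + t)).
Proof. exact: (measurable_comp_cellix j (fun k => ncoef h u j (k + t))). Qed.

Let sum_sqfun_ge0 u x : (0 <= \sum_l sqfun (psi l) J u x)%E.
Proof. by apply: sume_ge0 => l _; exact: sqfun_ge0. Qed.

Lemma full_sqfun_nnm u : nonneg_measurable (full_sqfun u).
Proof.
split; last by move=> x; exact: sqrte_ge0.
apply: measurable_sqrte => [x|].
  by rewrite adde_ge0// lee_fin sqr_ge0.
apply: emeasurable_funD; last by apply: emeasurable_sum => l; exact: measurable_sqfun.
apply/measurable_EFinP/measurable_funX.
exact: (measurable_comp_cellix J (fun k => ncoef phi u J k)).
Qed.

Definition covers x (a : wavelet_index n) : bool :=
  match a with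
  | inl k => cellix J x == k
  | inr (_, i, k) => cellix (J + i%:Z) x == k
  end.

Definition coef u (a : wavelet_index n) : R :=
  match a with
  | inl k => ncoef phi u J k
  | inr (l, i, k) => ncoef (psi l) u (J + i%:Z) k
  end.

(** The volume of the cell over which the product of the two coefficients is spread. *)
Definition awt (a : wavelet_index n) : R :=
  match a with inl k => cell_vol R n J | inr (_, i, _) => cell_vol R n (J + i%:Z) end.

Lemma coef_wavelet_real u g a : locint u -> locint g ->
  ip u (wavelet_real J a) * ip g (wavelet_real J a) = awt a * (coef u a * coef g a).
Proof.
have aux h j k : lip_gen s0 L h -> locint u -> locint g ->
    ip u (dilate h j k) * ip g (dilate h j k) = cell_vol R n j * (ncoef h u j k * ncoef h g j k).
  move=> gh lu' lg'; have br := rescaled_test_fun j k n0 gh; rewrite !ncoefE//.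
  move: (ip u _) (ip g _) => a1 a2.
  have -> : cell_vol R n j * (L2_factor n j * a1 * (L2_factor n j * a2)) =
    cell_vol R n j * L2_factor n j ^+ 2 * (a1 * a2) by ring.
  by rewrite L2_factor_sqr mulfV ?mul1r// cell_vol_neq0.
by move=> lu lg; case: a => [k|[[l i] k]] /=; exact: aux.
Qed.

Lemma integral_covers a (c : R) : 0 <= c ->
  (\int[mu]_x ((covers x a)%:R * c)%:E = (awt a * c)%:E)%E.
Proof.
move=> c0; have aux j k : (\int[mu]_x ((cellix j x == k)%:R * c)%:E = (cell_vol R n j * c)%:E)%E.
  have -> : (\int[mu]_x ((cellix j x == k)%:R * c)%:E = \int[mu]_x (c%:E * (\1_(hcell j k) x)%:E))%E.
    apply: eq_integral => x _; rewrite -EFinM mulrC indicE; congr (_ * _)%:E; congr (nat_of_bool _)%:R.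
    by apply/idP/idP => [/eqP e|/set_mem/eqP//]; exact/mem_set.
  rewrite ge0_integralZl//; first by rewrite integral_indic ?setIT//; [rewrite [X in (_ * X)%E]mu_hcell -EFinM mulrC|exact: measurable_hcell].
  by apply/measurable_EFinP; apply: measurable_indic; exact: measurable_hcell.
by case: a => [k|[[l i] k]]; exact: aux.
Qed.

(** At each level, only one index covers x. *)
Lemma covers_le_full_sqfun u x (p : nat) (A : seq (wavelet_index n)) : uniq A ->
  {in A, forall a, low p a} ->
  ((Num.sqrt (\sum_(a <- [seq a <- A | covers x a]) `|coef u a| ^+ 2))%:E <= full_sqfun u x)%E.
Proof.
move=> uA lA; apply: (@le_sqrte R (_%:E)).
pose B : seq (wavelet_index n) := inl (cellix J x) ::
  [seq inr (l, i, cellix (J + i%:Z) x) | l <- enum 'I_(2 ^ n - 1), i <- iota 0 p].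
have uB : uniq B.
  rewrite /= ; apply/andP; split; first by apply/negP => /allpairsP[? [_ _]].
  apply: allpairs_uniq; [exact: enum_uniq|exact: iota_uniq|].
  by move=> [l i] [l' i'] _ _ /= [-> ->].
have AB : {subset [seq a <- A | covers x a] <= B}.
  move=> a; rewrite mem_filter => /andP[+ /lA]; case: a => [k|[[l i] k]] /= /eqP <-.
    by move=> _; rewrite mem_head.
  move=> ip; rewrite in_cons /=; apply/allpairsP; exists (l, i); split => //=.
    by rewrite mem_enum.
  by rewrite mem_iota.
apply: (@le_trans _ _ ((\sum_(a <- B) `|coef u a| ^+ 2)%:E)).
  by rewrite lee_fin; apply: ler_sum_subset => //; exact: filter_uniq.
rewrite /B big_cons big_allpairs_dep EFinD /= real_normK ?num_real//; apply: leeD2l.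
rewrite -sumEFin big_enum /=; apply: lee_sum => l _.
rewrite -sumEFin -{1}(subn0 p) -/(index_iota 0 p) /sqfun.
under eq_bigr do rewrite real_normK ?num_real//.
by apply: nneseries_lim_ge => i _ _; rewrite lee_fin sqr_ge0.
Qed.

(** The products of coefficients are spread over their cells, and the Cauchy-Schwarz
    inequality is applied at each point. *)
Lemma pairing u g : locint u -> test_fun g ->
  (`|ip u g|%:E <= \int[mu]_x (full_sqfun u x * full_sqfun g x))%E.
Proof.
move=> lu bg; apply/lee_addgt0Pr => e e0; have lg := test_fun_locint bg.
have [p [A [[uA lA _] HA]]] := wavelet_expansion n0 ws gphi gpsi J lu bg e0.
pose F a := `|coef u a| * `|coef g a|.
apply: (@le_trans _ _ ((\sum_(a <- A) awt a * F a)%:E + e%:E)%E).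
  rewrite -EFinD lee_fin.
  have H : `|\sum_(a <- A) ip u (wavelet_real J a) * ip g (wavelet_real J a)| <= \sum_(a <- A) awt a * F a.
    apply: le_trans (ler_norm_sum _ _ _) _; apply: ler_sum => a _.
    rewrite coef_wavelet_real// normrM normrM ger0_norm//.
    by case: a => [k|[[l i] k]]; exact/ltW/cell_vol_gt0.
  have := ler_normD (\sum_(a <- A) ip u (wavelet_real J a) * ip g (wavelet_real J a))
    (ip u g - \sum_(a <- A) ip u (wavelet_real J a) * ip g (wavelet_real J a)).
  by rewrite addrC subrK; lra.
apply: leeD2r; rewrite -sumEFin.
have F0 a : 0 <= F a by exact: mulr_ge0.
have mcov a : measurable_fun setT (fun x => ((covers x a)%:R * F a)%:E : \bar R).
  apply/measurable_EFinP/measurable_funM => //.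
  case: a => [k|[[l i] k]]; first exact: (measurable_comp_cellix J (fun k' => (k' == k)%:R : R)).
  exact: (measurable_comp_cellix (J + i%:Z) (fun k' => (k' == k)%:R : R)).
under eq_bigr do rewrite -integral_covers//.
rewrite -ge0_integral_sum//; last by move=> a x _; rewrite lee_fin mulr_ge0.
apply: ge0_le_integral => //.
- by move=> x _; apply: sume_ge0 => a _; rewrite lee_fin mulr_ge0.
- exact: emeasurable_sum.
- by apply: emeasurable_funM; [exact: (full_sqfun_nnm u).1|exact: (full_sqfun_nnm g).1].
move=> x _; rewrite sumEFin.
have -> : \sum_(a <- A) (covers x a)%:R * F a = \sum_(a <- [seq a <- A | covers x a]) F a.
  by rewrite big_filter [RHS]big_mkcond; apply: eq_bigr => a _; case: ifP; rewrite ?mul1r ?mul0r.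
apply: (@le_trans _ _ (_%:E)); first by rewrite lee_fin; exact: sum_CS.
by rewrite EFinM; apply: lee_pmul; rewrite ?lee_fin ?sqrtr_ge0//; exact: covers_le_full_sqfun uA lA.
Qed.

End square_functions.

(** * Closed cubes against half-open cells *)

Section cubes.
Variables (R : realType) (n : nat).
Local Notation E := 'rV[R]_n.
Local Notation Zn := 'rV[int]_n.
Local Notation mu := (@lebesgue_rV R n).
Implicit Types (x y : E) (f : E -> R[i]) (u v w g h : E -> R) (j : int) (q k t : Zn).

Lemma cube_near j k x : dyadic_cube j k x -> k - cellix j x \in nbh 1 0 (0 : Zn).
Proof.
move=> xk; rewrite mem_nbh; apply/forallP => i; rewrite anc0 mxE [(- cellix j x) _ _]mxE [X in _ - X]mxE subr0.
have := xk i; have /andP[h1 h2] := cellix_itv j x i; rewrite pow2N ![_^-1 * _]mulrC.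
rewrite ler_pdivrMr ?ler_pdivlMr ?pow2_gt0// ![x ord0 i * _]mulrC => /andP[h3 h4].
move: h1 h2 h3 h4; move: (2 ^ j * x ord0 i) (cellix j x ord0 i) (k ord0 i) => z a b h1 h2 h3 h4.
have : b < a + 1 by rewrite -(ltr_int R) intrD; apply: le_lt_trans h3 _.
have : a <= b + 1 by rewrite -(ler_int R) intrD; apply: le_trans h1 _.
lia.
Qed.

Lemma cube_cellix j x : dyadic_cube j (cellix j x) x.
Proof.
move=> i; have /andP[h1 h2] := cellix_itv j x i; rewrite pow2N ![_^-1 * _]mulrC.
by rewrite ler_pdivrMr ?ler_pdivlMr ?pow2_gt0// ![x ord0 i * _]mulrC h1 ltW.
Qed.

Lemma measurable_cube j k : measurable (@dyadic_cube R n j k).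
Proof.
rewrite (_ : dyadic_cube _ _ = [set x : E | forall i,
  [set` `[2 ^ (- j) * (k ord0 i)%:~R, 2 ^ (- j) * ((k ord0 i)%:~R + 1)]] (x ord0 i)]).
  apply: (@measurable_forall R n (fun i => [set` `[2 ^ (- j) * (k ord0 i)%:~R, 2 ^ (- j) * ((k ord0 i)%:~R + 1)]])) => i.
  exact: measurable_itv.
by apply/seteqP; split => x /= H i; have := H i; rewrite in_itv.
Qed.

Lemma measurable_shifted_cube j t :
  measurable_fun setT (fun x : E => \1_(dyadic_cube j (cellix j x + t)) x : R).
Proof.
pose D : set E := \bigcup_k (hcell j k `&` dyadic_cube j (k + t)).
rewrite (_ : (fun _ => _) = \1_D).
  apply: measurable_indic; apply: countable_bigcupT_measurable => [|k]; first exact: countableP.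
  by apply: measurableI; [exact: measurable_hcell|exact: measurable_cube].
apply/funext => x; rewrite !indicE; congr (nat_of_bool _)%:R.
apply/idP/idP => /set_mem H; apply/mem_set; first by exists (cellix j x).
by case: H => k _ [/= <-].
Qed.

(** Only the cubes touching the half-open cell of x can contain x. *)
Lemma esum_cube j (c : Zn -> R) x : (forall k, 0 <= c k) ->
  (\esum_(k in [set: Zn]) (c k * \1_(dyadic_cube j k) x)%:E =
   \sum_(t <- nbh 1 0 0) (c (cellix j x + t) * \1_(dyadic_cube j (cellix j x + t)) x)%:E)%E.
Proof.
move=> c0; pose a k : \bar R := (c k * \1_(dyadic_cube j k) x)%:E.
have a0 k : (0 <= a k)%E by rewrite lee_fin mulr_ge0.
pose s := [seq cellix j x + t | t <- nbh 1 0 (0 : Zn)].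
have us : uniq s by rewrite map_inj_uniq ?uniq_nbh//; exact: addrI.
rewrite -[LHS]/(\esum_(k in [set: Zn]) a k)%E (esumID [set` s])//.
rewrite [X in (_ + X)%E]esum1 ?adde0; last first.
  move=> k [_ ks]; rewrite /a indicE memNset ?mulr0// => /cube_near kn; apply: ks.
  by rewrite /=; apply/mapP; exists (k - cellix j x) => //; rewrite addrC subrK.
have -> : [set: Zn] `&` [set` s] = [set` s] by apply/seteqP; split => k // [].
rewrite esum_fset//; last exact: finite_seq.
by rewrite -fsbig_seq// big_map.
Qed.

Variables (J : int).

Definition Re_fun f x : R := complex.Re (f x).
Definition Im_fun f x : R := complex.Im (f x).

(** The term of the square function of f at the t-th neighbour of the cell of x. *)
Definition cube_term h j t f x : R :=
  (ncoef h (Re_fun f) j (cellix j x + t) ^+ 2 + ncoef h (Im_fun f) j (cellix j x + t) ^+ 2) *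
  \1_(dyadic_cube j (cellix j x + t)) x.

Lemma cube_term_ge0 h j t f x : 0 <= cube_term h j t f x.
Proof. by rewrite mulr_ge0// addr_ge0// sqr_ge0. Qed.

Lemma measurable_cube_term h j t f : measurable_fun setT (cube_term h j t f).
Proof.
apply: measurable_funM; last exact: measurable_shifted_cube.
by apply: measurable_funD; apply: measurable_funX; exact: measurable_ncoef.
Qed.

Lemma esum_cube_term s0 L h j f x : (0 < n)%N -> lip_gen s0 L h -> locint (Re_fun f) -> locint (Im_fun f) ->
  (\esum_(k in [set: Zn]) ((cmod (inner f (real_fun (dilate h j k))) * chi j k x) ^+ 2)%:E =
   \sum_(t <- nbh 1 0 0) (cube_term h j t f x)%:E)%E.
Proof.
move=> n0 gh lr li.
rewrite -(@esum_cube j (fun k => ncoef h (Re_fun f) j k ^+ 2 + ncoef h (Im_fun f) j k ^+ 2)); last first.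
  by move=> k; rewrite addr_ge0// sqr_ge0.
apply: eq_esum => k _; congr EFin; have br := rescaled_test_fun j k n0 gh.
rewrite inner_realE -/(Re_fun f) -/(Im_fun f) !ncoefE// /chi exprMn.
rewrite /cmod /= sqr_sqrtr ?addr_ge0 ?sqr_ge0//.
rewrite indicE; case: (_ \in _); last by rewrite /= !mulr0 expr0n mulr0.
rewrite /= /Re_fun /Im_fun; ring.
Qed.

End cubes.

(** * Pointwise comparison of the square functions *)

Section pointwise_bounds.
Variables (R : realType) (n : nat).
Local Notation E := 'rV[R]_n.
Local Notation Zn := 'rV[int]_n.
Local Notation mu := (@lebesgue_rV R n).
Variables (phi : E -> R) (psi : 'I_(2 ^ n - 1) -> E -> R).
Variables (s0 : nat) (L : R).
Hypothesis n0 : (0 < n)%N.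
Hypothesis gphi : lip_gen s0 L phi.
Hypothesis gpsi : forall l, lip_gen s0 L (psi l).
Variable J : int.
Implicit Types (x y : E) (f : E -> R[i]) (u v w g h : E -> R) (j : int) (q k t : Zn).
Local Notation full_sqfun := (full_sqfun phi psi J).
Local Notation nb := (nbh 1 0 (0 : Zn)).

(** The square functions with half-open cells that dominate those with closed cubes; None
    stands for the scaling function. *)
Definition piece (o : option 'I_(2 ^ n - 1)) t w x : \bar R :=
  match o with
  | None => `|ncoef (shifted t phi) w J (cellix J x)|%:E
  | Some l => sqrte (sqfun (shifted t (psi l)) J w x)
  end.

Definition pieces : seq (option 'I_(2 ^ n - 1)) := None :: map Some (enum 'I_(2 ^ n - 1)).

Lemma big_pieces (F : option 'I_(2 ^ n - 1) -> \bar R) :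
  (\sum_(o <- pieces) F o = F None + \sum_l F (Some l))%E.
Proof. by rewrite /pieces big_cons big_map big_enum. Qed.

Lemma piece_nnm o t w : nonneg_measurable (piece o t w).
Proof.
case: o => [l|]; split=> [|x] /=; try exact: sqrte_ge0.
- by apply: measurable_sqrte => [x|]; [exact: sqfun_ge0|exact: measurable_sqfun].
- apply/measurable_EFinP/measurableT_comp => //.
  exact: (measurable_comp_cellix J (fun k => ncoef (shifted t phi) w J k)).
- by rewrite lee_fin.
Qed.

Lemma mem_nb0 : 0 \in nb.
Proof. by rewrite mem_nbh; apply/forallP => i; rewrite anc0 subrr. Qed.

Lemma shifted0 h : shifted 0 h = h.
Proof.
apply/funext => x; rewrite /shifted; congr h; apply/rowP => i.
by rewrite !mxE subr0.
Qed.

Let sqr_abs (r : R) : sqrte (r ^+ 2)%:E = `|r|%:E.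
Proof. by rewrite /= sqrtr_sqr. Qed.

Let sqfun0 h w x : (0 <= sqfun h J w x)%E := sqfun_ge0 _ _ _ _.

Lemma full_sqfun_le_piece w x : (full_sqfun w x <= \sum_(o <- pieces) piece o 0 w x)%E.
Proof.
rewrite big_pieces; apply: le_trans (sqrteD_le _ _) _.
- by rewrite lee_fin sqr_ge0.
- exact: sume_ge0.
rewrite sqr_abs /= shifted0; apply: leeD2l.
apply: le_trans (sqrte_sum_le _ (fun l => sqfun0 (psi l) w x)) _.
by apply: lee_sum => l _; rewrite shifted0.
Qed.

Section one_function.
Variable f : E -> R[i].
Hypothesis lR : locint (Re_fun f).
Hypothesis lI : locint (Im_fun f).

Lemma VsqE x : Vsq J phi f x = sqrte (\sum_(t <- nb) (cube_term phi J t f x)%:E)%E.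
Proof. by rewrite /Vsq (esum_cube_term J x n0 gphi). Qed.

Lemma WsqE x : Wsq J psi f x =
  sqrte (\sum_l \sum_(0 <= i <oo) \sum_(t <- nb) (cube_term (psi l) (J + i%:Z) t f x)%:E)%E.
Proof.
rewrite /Wsq; congr sqrte; apply: eq_bigr => l _; apply: eq_eseriesr => i _.
exact: (esum_cube_term _ x n0 (gpsi l)).
Qed.

Let sct0 h j x : (0 <= \sum_(t <- nb) (cube_term h j t f x)%:E)%E.
Proof. by apply: sume_ge0 => t _; rewrite lee_fin cube_term_ge0. Qed.

Let ser0 l x : (0 <= \sum_(0 <= i <oo) \sum_(t <- nb) (cube_term (psi l) (J + i%:Z) t f x)%:E)%E.
Proof. exact: nneseries_ge0. Qed.

Lemma Vsq_nnm : nonneg_measurable (Vsq J phi f).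
Proof.
rewrite (funext VsqE); split; last by move=> x; exact: sqrte_ge0.
apply: measurable_sqrte => //; apply: emeasurable_sum => t.
by apply/measurable_EFinP; exact: measurable_cube_term.
Qed.

Lemma Wsq_nnm : nonneg_measurable (Wsq J psi f).
Proof.
rewrite (funext WsqE); split; last by move=> x; exact: sqrte_ge0.
apply: measurable_sqrte => [x|]; first exact: sume_ge0.
apply: emeasurable_sum => l; apply: ge0_emeasurable_sum => [i x _ _|i _]; first exact: sct0.
by apply: emeasurable_sum => t; apply/measurable_EFinP; exact: measurable_cube_term.
Qed.

Let cube_term_le h j t x : cube_term h j t f x <=
  ncoef (shifted t h) (Re_fun f) j (cellix j x) ^+ 2 + ncoef (shifted t h) (Im_fun f) j (cellix j x) ^+ 2.
Proof.
by rewrite !ncoef_shifted ler_piMr ?addr_ge0 ?sqr_ge0.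
Qed.

Lemma Vsq_le_piece x :
  (Vsq J phi f x <= \sum_(t <- nb) (piece None t (Re_fun f) x + piece None t (Im_fun f) x))%E.
Proof.
rewrite VsqE; apply: le_trans (sqrte_sum_le _ _) _ => [t|]; first by rewrite lee_fin cube_term_ge0.
apply: lee_sum => t _; rewrite /piece -!sqr_abs.
apply: (le_trans _ (sqrteD_le _ _)); [|by rewrite lee_fin sqr_ge0..].
by apply: le_sqrte; rewrite -EFinD lee_fin; exact: cube_term_le.
Qed.

Lemma Wsq_le_piece x : (Wsq J psi f x <=
  \sum_l \sum_(t <- nb) (piece (Some l) t (Re_fun f) x + piece (Some l) t (Im_fun f) x))%E.
Proof.
rewrite WsqE; apply: le_trans (sqrte_sum_le _ _) _ => //; apply: lee_sum => l _.
rewrite nneseries_sum; last by move=> t i _; rewrite lee_fin cube_term_ge0.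
apply: le_trans (sqrte_sum_le _ _) _ => [t|].
  by apply: nneseries_ge0 => i _ _; rewrite lee_fin cube_term_ge0.
apply: lee_sum => t _; apply: (le_trans _ (sqrteD_le _ _)) => //.
apply: le_sqrte; rewrite /sqfun -nneseriesD; try by move=> i _ _; rewrite lee_fin sqr_ge0.
apply: lee_nneseries => [i _ _|i _]; first by rewrite lee_fin cube_term_ge0.
by rewrite -EFinD lee_fin cube_term_le.
Qed.

(** A cube containing x is a neighbour of the cell of x, and the coefficient at the neighbour t
    is the coefficient, at the cell itself, of a translated generator. *)
Lemma VW_le_piece x : (Vsq J phi f x + Wsq J psi f x <=
  \sum_(o <- pieces) \sum_(t <- nb) (piece o t (Re_fun f) x + piece o t (Im_fun f) x))%E.
Proof. by rewrite big_pieces; apply: leeD; [exact: Vsq_le_piece|exact: Wsq_le_piece]. Qed.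

(** The half-open cell of x is among the cubes containing x. *)
Lemma full_sqfun_le_VW w x : w = Re_fun f \/ w = Im_fun f -> (full_sqfun w x <= Vsq J phi f x + Wsq J psi f x)%E.
Proof.
move=> wf.
have le_cube_term h j : ((ncoef h w j (cellix j x) ^+ 2)%:E <= \sum_(t <- nb) (cube_term h j t f x)%:E)%E.
  apply: (@le_trans _ _ (cube_term h j 0 f x)%:E).
    rewrite lee_fin /cube_term addr0 indicE mem_set ?mulr1; last exact: cube_cellix.
    by case: wf => ->; rewrite ?lerDl ?lerDr sqr_ge0.
  rewrite (bigD1_seq 0) ?uniq_nbh ?mem_nb0//= leeDl//.
  by apply: sume_ge0 => t _; rewrite lee_fin cube_term_ge0.
apply: le_trans (sqrteD_le _ _) _; [by rewrite lee_fin sqr_ge0|exact: sume_ge0|].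
rewrite VsqE WsqE; apply: leeD; apply: le_sqrte; first exact: le_cube_term.
apply: lee_sum => l _; apply: lee_nneseries => [i _ _|i _]; first by rewrite lee_fin sqr_ge0.
exact: le_cube_term.
Qed.

End one_function.
End pointwise_bounds.

(** * Equivalence of the norms *)

Section sublinear.
Variables (R : realType) (n : nat).
Local Notation E := 'rV[R]_n.
Variable N : (E -> \bar R) -> \bar R.
Hypothesis N0 : (N (fun=> 0) <= 0)%E.
Hypothesis Nadd : forall f g : E -> \bar R, nonneg_measurable f -> nonneg_measurable g ->
  (N (fun x => f x + g x) <= N f + N g)%E.

Lemma nnm_sum (T : Type) (s : seq T) (F : T -> E -> \bar R) :
  (forall t, nonneg_measurable (F t)) -> nonneg_measurable (fun x => \sum_(t <- s) F t x)%E.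
Proof.
move=> nF; split=> [|x]; first by apply: emeasurable_sum => t; exact: (nF t).1.
by apply: sume_ge0 => t _; exact: (nF t).2.
Qed.

(** One constant serves for all w, which is why the bounds are stated for a family. *)
Lemma sum_bounded (T : eqType) (W : Type) (s : seq T) (F : T -> W -> E -> \bar R)
  (good : W -> Prop) (b : W -> \bar R) : (forall w, good w -> 0 <= b w)%E ->
  (forall t w, good w -> nonneg_measurable (F t w)) ->
  (forall t, t \in s -> exists2 C : R, 0 <= C & forall w, good w -> (N (F t w) <= C%:E * b w)%E) ->
  exists2 C : R, 0 <= C & forall w, good w ->
    (N (fun x => \sum_(t <- s) F t w x) <= C%:E * b w)%E.
Proof.
move=> b0 nF; elim: s => [|t s IH] H.
  exists 0 => // w _; rewrite mul0e; apply: le_trans N0.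
  by rewrite (_ : (fun _ => _) = fun=> 0%E)//; apply/funext => x; rewrite big_nil.
have [C1 C10 H1] := H t (mem_head _ _).
have [|C2 C20 H2] := IH; first by move=> t' t's; apply: H; rewrite in_cons t's orbT.
exists (C1 + C2) => [|w gw]; first exact: addr_ge0.
have -> : (fun x => \sum_(t <- t :: s) F t w x)%E =
    (fun x => F t w x + \sum_(t <- s) F t w x)%E.
  by apply/funext => x; rewrite big_cons.
apply: le_trans (Nadd _ _) _; [exact: nF|by apply: nnm_sum => t'; exact: nF|].
by rewrite EFinD ge0_muleDl//; apply: leeD; [exact: H1|exact: H2].
Qed.

End sublinear.

Section norm_equivalence.
Variables (R : realType) (n : nat).
Local Notation E := 'rV[R]_n.
Local Notation Zn := 'rV[int]_n.
Local Notation mu := (@lebesgue_rV R n).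
Variable rho : (E -> \bar R) -> \bar R.
Hypothesis Hr : ball_Banach_norm rho.
Local Notation kd := (Koethe_dual rho).
Hypothesis MX : Mloc_bounded rho.
Hypothesis MX' : Mloc_bounded kd.
Variables (K : nat) (phi : E -> R) (psi : 'I_(2 ^ n - 1) -> E -> R).
Variables (s0 : nat) (L : R).
Hypothesis n0 : (0 < n)%N.
Hypothesis ws : wavelet_system K phi psi.
Hypothesis gphi : lip_gen s0 L phi.
Hypothesis gpsi : forall l, lip_gen s0 L (psi l).
Variable J : int.
Implicit Types (x y : E) (f : E -> R[i]) (u v w g h : E -> R) (j : int) (q k t : Zn).
Local Notation full_sqfun := (full_sqfun phi psi J).
Local Notation nb := (nbh 1 0 (0 : Zn)).
Local Notation piece := (piece phi psi J).

Lemma kd0 : (kd (fun=> 0) <= 0)%E.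
Proof.
apply: ge_ereal_sup => _ [f _ <-].
by under eq_integral do rewrite mule0; rewrite integral0.
Qed.

Lemma kd_add (f g : E -> \bar R) : nonneg_measurable f -> nonneg_measurable g ->
  (kd (fun x => f x + g x) <= kd f + kd g)%E.
Proof.
move=> nf ng; apply: ge_ereal_sup => _ [h [hX h1] <-].
have nh := nnm_cmodf hX.1.
have -> : (\int[mu]_x (cmodf h x * (f x + g x)) =
    \int[mu]_x (cmodf h x * f x) + \int[mu]_x (cmodf h x * g x))%E.
  rewrite -ge0_integralD//; try exact: (nnm_mul _ _).1; try (by move=> x _; exact: (nnm_mul _ _).2).
  by apply: eq_integral => x _; rewrite ge0_muleDr//; [exact: nf.2|exact: ng.2].
by apply: leeD; apply: ereal_sup_ubound; exists h.
Qed.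

(** The generators translated by a unit have the box of radius s0 + 1. *)
Lemma fine_scale : exists p0 : nat, (cM n s0.+2)%:R < (2 : R) ^ (J + p0%:Z).
Proof.
(* The first summand makes the exponent nonnegative, whatever the sign of J. *)
exists (`|J| + cM n s0.+2)%N; apply: (@lt_le_trans _ _ (2 ^ (cM n s0.+2)%:Z)).
  by rewrite -exprnP -natrX ltr_nat ltn_expl.
rewrite ler_weXz2l// ?ler1n//; lia.
Qed.

Lemma rho_piece o t : t \in nb -> exists2 C : R, 0 <= C & forall w, measurable_fun setT w ->
  (rho (eabs w) < +oo)%E -> (rho (piece o t w) <= C%:E * rho (eabs w))%E.
Proof.
move=> tn; have [p0 hp] := fine_scale.
case: o => [l|].
  have [C C0 H] := rho_sqfun Hr MX MX' n0 (lip_gen_shifted tn (gpsi l)) hp (bessel_shift n0 ws gphi gpsi l J tn).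
  by exists C; [exact: ltW|exact: H].
have gt := lip_gen_shifted tn gphi; have [L0 _ _] := gt.
pose B : R := L * (2 * s0.+1%:R + 1).
have B0 : 0 <= B by rewrite mulr_ge0// addr_ge0// mulr_ge0.
have [C C0 H] := rho_avg_bounded Hr MX (s0.+3 * 2 ^ p0) (cM1_le hp).
exists (B * C) => [|w mw fw]; first exact: mulr_ge0.
have lw := rho_locint Hr mw fw.
have ma := eabs_nnm (measurable_avg (s0.+3 * 2 ^ p0) (J + p0%:Z) w).
apply: le_trans (rho_mono Hr (nnm_scale ma B0) (piece_nnm _ _ _ None t w) _) _.
  move=> x; have := @ncoef_coarse R n _ _ _ J p0 n0 gt 0 w x (leq0n p0) lw.
  by rewrite !addr0 /= /eabs -EFinM lee_fin (ger0_norm (avg_ge0 _ _ _ _)).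
apply: le_trans (rho_scale Hr ma B0) _.
by rewrite [(B * C)%:E]EFinM -muleA; apply: lee_wpmul2l; [rewrite lee_fin|exact: H].
Qed.

Lemma kd_piece o t : t \in nb -> exists2 C : R, 0 <= C & forall g, test_fun g ->
  (kd (piece o t g) <= C%:E * kd (eabs g))%E.
Proof.
move=> tn; have [p0 hp] := fine_scale.
case: o => [l|].
  have [C C0 H] := kd_sqfun Hr MX MX' n0 (lip_gen_shifted tn (gpsi l)) hp (bessel_shift n0 ws gphi gpsi l J tn).
  by exists C; [exact: ltW|exact: H].
have gt := lip_gen_shifted tn gphi; have [L0 _ _] := gt.
pose B : R := L * (2 * s0.+1%:R + 1).
have B0 : 0 <= B by rewrite mulr_ge0// addr_ge0// mulr_ge0.
have [C C0 H] := kd_avg_bounded Hr MX' (s0.+3 * 2 ^ p0) (cM1_le hp).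
exists (B * C) => [|g bg]; first exact: mulr_ge0.
have lg := test_fun_locint bg.
have ma := eabs_nnm (measurable_avg (s0.+3 * 2 ^ p0) (J + p0%:Z) g).
apply: le_trans (kd_mono _ (nnm_scale ma B0) (piece_nnm _ _ _ None t g) _) _.
  move=> x; have := @ncoef_coarse R n _ _ _ J p0 n0 gt 0 g x (leq0n p0) lg.
  by rewrite !addr0 /= /eabs -EFinM lee_fin (ger0_norm (avg_ge0 _ _ _ _)).
apply: le_trans (kd_scale _ ma B0) _.
by rewrite [(B * C)%:E]EFinM -muleA; apply: lee_wpmul2l; [rewrite lee_fin|apply: H => //; exact: kd_test_fun].
Qed.

Lemma kd_full_sqfun : exists2 C : R, 0 <= C & forall g, test_fun g ->
  (kd (full_sqfun g) <= C%:E * kd (eabs g))%E.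
Proof.
have [||t _|C C0 H] := @sum_bounded R n kd kd0 kd_add _ _ (pieces n)
  (fun o g => piece o 0 g) (fun g => test_fun g) (fun g => kd (eabs g)).
- by move=> g _; exact: kd_ge0.
- by move=> o g _; exact: piece_nnm.
- exact: (kd_piece t (mem_nb0 n)).
exists C => // g bg; apply: le_trans (H g bg).
apply: kd_mono; [|exact: full_sqfun_nnm|exact: full_sqfun_le_piece].
by apply: nnm_sum => o; exact: piece_nnm.
Qed.

(** The sign of u is moved to the test function, so that the pairing with |u| becomes one
    with u, and the bound on the pairing is closed by the bound for the dual norm. *)
Lemma rho_of_full_sqfun : exists2 C : R, 0 <= C & forall u (h : E -> \bar R), locint u ->
  nonneg_measurable h -> (forall x, full_sqfun u x <= h x)%E -> (rho h < +oo)%E ->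
  (rho (eabs u) <= C%:E * rho h)%E.
Proof.
have [C C0 H] := kd_full_sqfun; exists (C + 1) => [|u h lu nh uh fh]; first by rewrite addr_ge0.
have C1 : 0 < C + 1 by rewrite ltr_wpDl.
apply: all_scaled_le => //; [exact: ltW|exact: (bbn_ge0 Hr nh)|move=> c c0 hcell].
apply: (lorentz_luxemburg Hr (eabs_nnm lu.1)); first exact: mulr_gt0.
move=> g bg g0.
pose g' x := g x * (if 0 <= u x then 1 else -1).
have eg : eabs g' = eabs g.
  by apply/funext => x; rewrite /eabs /g' normrM; case: ifP; rewrite ?normrN normr1 mulr1.
have bg' : test_fun g'.
  have [mg [B [r [B0 gB gr]]]] := bg; split.
    apply: measurable_funM => //; apply: measurable_fun_ifT => //.
    by apply: measurable_fun_ler => //; exact: lu.1.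
  exists B, r; split=> // x.
    by rewrite /g' normrM; case: ifP; rewrite ?normrN normr1 mulr1.
  by rewrite /g' mulf_eq0 negb_or => /andP[/gr].
have -> : (\int[mu]_x (eabs u x * eabs g x) = (ip u g')%:E)%E.
  rewrite ipE//; apply: eq_integral => x _; rewrite /eabs /g' -EFinM (ger0_norm (g0 x)).
  by congr EFin; case: ifPn => [/ger0_norm ->|]; [ring|rewrite -ltNge => /ltr0_norm ->; ring].
apply: (@le_trans _ _ `|ip u g'|%:E); first by rewrite lee_fin ler_norm.
apply: le_trans (pairing n0 ws gphi gpsi J lu bg') _.
apply: (@le_trans _ _ (c%:E * kd (full_sqfun g'))%E).
  apply: hoelder => //; [exact: full_sqfun_nnm|exact: full_sqfun_nnm|].
  by apply: le_trans hcell; apply: rho_mono => //; exact: full_sqfun_nnm.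
rewrite mulrC EFinM -muleA; apply: lee_wpmul2l; first by rewrite lee_fin ltW.
apply: le_trans (H _ bg') _; rewrite eg; apply: lee_wpmul2r; last by rewrite lee_fin lerDl.
exact: kd_ge0.
Qed.

Lemma Re_fun_le f x : `|Re_fun f x| <= cmod (f x).
Proof.
rewrite /Re_fun /cmod; case: (f x) => a b /=.
by rewrite -sqrtr_sqr ler_wsqrtr// lerDl sqr_ge0.
Qed.

Lemma Im_fun_le f x : `|Im_fun f x| <= cmod (f x).
Proof.
rewrite /Im_fun /cmod; case: (f x) => a b /=.
by rewrite -sqrtr_sqr ler_wsqrtr// lerDr sqr_ge0.
Qed.

Lemma cmod_le f x : cmod (f x) <= `|Re_fun f x| + `|Im_fun f x|.
Proof.
rewrite /Re_fun /Im_fun /cmod; case: (f x) => a b /=.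
apply: sqrt_leP; first exact: addr_ge0.
rewrite sqrrD !real_normK ?num_real// addrAC lerDl mulrn_wge0// mulr_ge0//.
Qed.

Lemma rho_Re_fun f : cmeasurable f -> (rho (eabs (Re_fun f)) <= rho (cmodf f))%E.
Proof.
move=> mf; apply: rho_mono => //; [exact: nnm_cmodf|exact: eabs_nnm mf.1|].
by move=> x; rewrite lee_fin Re_fun_le.
Qed.

Lemma rho_Im_fun f : cmeasurable f -> (rho (eabs (Im_fun f)) <= rho (cmodf f))%E.
Proof.
move=> mf; apply: rho_mono => //; [exact: nnm_cmodf|exact: eabs_nnm mf.2|].
by move=> x; rewrite lee_fin Im_fun_le.
Qed.

Let good f := cmeasurable f /\ (rho (cmodf f) < +oo)%E.

Lemma rho_VW : exists2 C : R, 0 <= C & forall f, cmeasurable f -> (rho (cmodf f) < +oo)%E ->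
  (rho (fun x => Vsq J phi f x + Wsq J psi f x) <= C%:E * rho (cmodf f))%E.
Proof.
have b0 f : good f -> (0 <= rho (cmodf f))%E by move=> [mf _]; exact: (bbn_ge0 Hr (nnm_cmodf mf)).
have r0 : (rho (fun=> 0) <= 0)%E by rewrite (rho0 Hr).
have radd := bbn_triangle Hr.
have H1 o : exists2 C : R, 0 <= C & forall f, good f ->
    (rho (fun x => \sum_(t <- nb) (piece o t (Re_fun f) x + piece o t (Im_fun f) x)) <= C%:E * rho (cmodf f))%E.
  apply: (@sum_bounded R n rho r0 radd _ _ nb
    (fun t f x => piece o t (Re_fun f) x + piece o t (Im_fun f) x)%E good (fun f => rho (cmodf f))) => //.
    by move=> t f _; apply: nnm_add; exact: piece_nnm.
  move=> t tn; have [C C0 HC] := rho_piece o tn.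
  exists (C + C) => [|f [mf ff]]; first exact: addr_ge0.
  apply: le_trans (radd _ _ (piece_nnm _ _ _ _ _ _) (piece_nnm _ _ _ _ _ _)) _.
  rewrite EFinD ge0_muleDl//; apply: leeD.
    apply: le_trans (HC _ mf.1 (le_lt_trans (rho_Re_fun mf) ff)) _.
    by apply: lee_wpmul2l; [rewrite lee_fin|exact: rho_Re_fun].
  apply: le_trans (HC _ mf.2 (le_lt_trans (rho_Im_fun mf) ff)) _.
  by apply: lee_wpmul2l; [rewrite lee_fin|exact: rho_Im_fun].
have [||o _|C C0 H] := @sum_bounded R n rho r0 radd _ _ (pieces n)
  (fun o f x => \sum_(t <- nb) (piece o t (Re_fun f) x + piece o t (Im_fun f) x))%E good (fun f => rho (cmodf f)).
- exact: b0.
- by move=> o f _; apply: nnm_sum => t; apply: nnm_add; exact: piece_nnm.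
- exact: H1.
exists C => // f mf ff; apply: le_trans (H f (conj mf ff)).
have lR := rho_locint Hr mf.1 (le_lt_trans (rho_Re_fun mf) ff).
have lI := rho_locint Hr mf.2 (le_lt_trans (rho_Im_fun mf) ff).
apply: rho_mono => //.
- by apply: nnm_sum => o; apply: nnm_sum => t; apply: nnm_add; exact: piece_nnm.
- by apply: nnm_add; [exact: (Vsq_nnm n0 gphi J lR lI)|exact: (Wsq_nnm n0 gpsi J lR lI)].
- by move=> x; exact: (VW_le_piece n0 gphi gpsi J lR lI).
Qed.

Lemma rho_le_VW : exists2 C : R, 0 <= C & forall f, locint (Re_fun f) -> locint (Im_fun f) ->
  (rho (fun x => Vsq J phi f x + Wsq J psi f x) < +oo)%E ->
  (rho (cmodf f) <= C%:E * rho (fun x => Vsq J phi f x + Wsq J psi f x))%E.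
Proof.
have [C C0 H] := rho_of_full_sqfun; exists (C + C) => [|f lR lI fh]; first exact: addr_ge0.
have nh : nonneg_measurable (fun x => Vsq J phi f x + Wsq J psi f x)%E.
  by apply: nnm_add; [exact: (Vsq_nnm n0 gphi J lR lI)|exact: (Wsq_nnm n0 gpsi J lR lI)].
have nR := eabs_nnm lR.1; have nI := eabs_nnm lI.1.
apply: (@le_trans _ _ (rho (eabs (Re_fun f)) + rho (eabs (Im_fun f)))%E).
  apply: le_trans (bbn_triangle Hr nR nI); apply: rho_mono => //.
  - exact: nnm_add.
  - by apply: nnm_cmodf; split; [exact: lR.1|exact: lI.1].
  - by move=> x; rewrite lee_fin cmod_le.
rewrite EFinD ge0_muleDl//; apply: leeD; apply: H => // x;
  apply: (full_sqfun_le_VW n0 gphi gpsi J lR lI); [by left|by right].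
Qed.

End norm_equivalence.

Lemma L1loc_locint (R : realType) (n : nat) (f : 'rV[R]_n -> R[i]) (u : 'rV[R]_n -> R) :
  L1loc f -> measurable_fun setT u -> (forall x, `|u x| <= cmod (f x)) -> locint u.
Proof.
move=> [mf lf] mu_ uf; split => // j k; apply/integrableP; split.
  by apply/measurable_EFinP; exact: measurable_funS mu_.
have [r hr] := @box_hcell R n j k; apply: (le_lt_trans _ (lf _ (@compact_box R n r))).
have nf := nnm_cmodf mf.
apply: (@le_trans _ _ (\int[@lebesgue_rV R n]_(x in hcell j k) cmodf f x)%E).
  apply: ge0_le_integral => //.
  - exact: measurable_hcell.
  - by apply/measurable_EFinP/measurableT_comp => //; exact: measurable_funS mu_.
  - by apply: measurable_funS nf.1.
  - by move=> x _; rewrite lee_fin.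
apply: ge0_subset_integral => //; [exact: measurable_hcell|exact: measurable_box| |].
  by apply: measurable_funS nf.1.
by move=> x _; exact: nf.2.
Qed.

Theorem corollary2p4 (R : realType) (n : nat)
    (rho : ('rV[R]_n -> \bar R) -> \bar R) (K : nat) (J : int)
    (phi : 'rV[R]_n -> R) (psi : 'I_(2 ^ n - 1) -> 'rV[R]_n -> R) :
  (0 < n)%N ->
  ball_Banach_norm rho ->
  Mloc_bounded rho ->
  Mloc_bounded (Koethe_dual rho) ->
  (1 <= K)%N ->
  wavelet_system K phi psi ->
  (forall f : 'rV[R]_n -> R[i], L1loc f ->
     (inX_nonneg rho (fun x => Vsq J phi f x + Wsq J psi f x)%E <->
      inX rho f)) /\
  (exists C : R, 0 < C /\
     forall f : 'rV[R]_n -> R[i], L1loc f -> inX rho f ->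
       (C^-1%:E * rho (fun x => Vsq J phi f x + Wsq J psi f x) <= Xnorm rho f
        <= C%:E * rho (fun x => Vsq J phi f x + Wsq J psi f x))%E).
Proof.
move=> n0 Hr MX MX'; case: K => // K _ ws.
have [s0 [L gphi gpsi]] := wavelet_lip_gen ws.
have [C1 C10 H1] := rho_VW Hr MX MX' n0 ws gphi gpsi J.
have [C2 C20 H2] := rho_le_VW Hr MX MX' n0 ws gphi gpsi J.
have lparts (f : 'rV[R]_n -> R[i]) : L1loc f -> locint (Re_fun f) /\ locint (Im_fun f).
  move=> lf; split; [apply: (L1loc_locint lf lf.1.1 (@Re_fun_le _ _ f))|exact: (L1loc_locint lf lf.1.2 (@Im_fun_le _ _ f))].
have nVW (f : 'rV[R]_n -> R[i]) : L1loc f -> nonneg_measurable (fun x => Vsq J phi f x + Wsq J psi f x)%E.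
  move=> lf; have [lR lI] := lparts f lf.
  by apply: nnm_add; [exact: (Vsq_nnm n0 gphi J lR lI)|exact: (Wsq_nnm n0 gpsi J lR lI)].
have fin (a b : \bar R) (C : R) : (a <= C%:E * b)%E -> (0 <= b)%E -> (b < +oo)%E -> (a < +oo)%E.
  by case: b => [b| |]// ab _ _; apply: le_lt_trans ab _; rewrite -EFinM ltry.
split=> [f lf|].
  have [lR lI] := lparts f lf; split=> [[_ fVW]|[mf ff]].
    by split; [exact: lf.1|exact: fin _ _ _ (H2 f lR lI fVW) (bbn_ge0 Hr (nVW f lf)) fVW].
  split; first exact: nVW.
  exact: fin _ _ _ (H1 f mf ff) (bbn_ge0 Hr (nnm_cmodf mf)) ff.
have C0 : 0 < C1 + C2 + 1 by rewrite ltr_wpDl// addr_ge0.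
exists (C1 + C2 + 1); split=> // f lf [mf ff]; have [lR lI] := lparts f lf.
have rVW := bbn_ge0 Hr (nVW f lf); have rf := bbn_ge0 Hr (nnm_cmodf mf).
have fVW := fin _ _ _ (H1 f mf ff) rf ff.
apply/andP; split; last first.
  by apply: le_trans (H2 f lR lI fVW) _; apply: lee_wpmul2r => //; rewrite lee_fin; lra.
rewrite lee_pdivrMl//; apply: le_trans (H1 f mf ff) _.
by apply: lee_wpmul2r => //; rewrite lee_fin; lra.
Qed.
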